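(* Let $\mu$ be a positive, radial, Borel measure on $\mathbb{D}$ with $\int_{\mathbb{D}}(1-|z|^2)\,d\mu(z)<\infty$. If the Cesàro operator $\mathcal{C}:H^\infty\to M(\mathcal{D}_\mu)$ is bounded, then $$\|\mathcal{C}\|_{H^\infty\to M(\mathcal{D}_\mu)}=1+\left(\int_{\mathbb{D}}\frac{4}{|1-z^2|^2}\,U_\mu(z)\,dA(z)\right)^{1/2}.$$
   Context: $\mathbb{D}$ is the open unit disc in $\mathbb{C}$, $dA(z)=\pi^{-1}\,dx\,dy$ for $z=x+iy$, $\mathrm{Hol}(\mathbb{D})$ is the space of analytic functions on $\mathbb{D}$, and $\mathrm{Aut}(\mathbb{D})$ is the group of one-to-one analytic maps of $\mathbb{D}$ onto itself. $H^\infty$ is the space of bounded analytic functions on $\mathbb{D}$ with the supremum norm. A measure on $\mathbb{D}$ is radial if it is invariant under the rotations $z\mapsto\lambda z$, $|\lambda|=1$. For $f(z)=\sum_{n\ge 0}a_nz^n\in\mathrm{Hol}(\mathbb{D})$, the Cesàro operator is $$\mathcal{C}(f)(z)=\sum_{n=0}^{\infty}\frac{1}{n+1}\left(\sum_{k=0}^{n}a_k\right)z^n,\qquad z\in\mathbb{D}.$$ For a positive Borel measure $\mu$ on $\mathbb{D}$ put $$U_\mu(z)=\int_{\mathbb{D}}\log\left|\frac{1-\overline{w}z}{z-w}\right|^2d\mu(w).$$ The conformally invariant Dirichlet space $M(\mathcal{D}_\mu)$ consists of all $f\in\mathrm{Hol}(\mathbb{D})$ such that $$\|f\|_{M(\mathcal{D}_\mu)}=|f(0)|+\sup_{\phi\in\mathrm{Aut}(\mathbb{D})}\left(\int_{\mathbb{D}}|f'(w)|^2U_\mu(\phi(w))\,dA(w)\right)^{1/2}<\infty.$$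 The operator norm is $\|\mathcal{C}\|_{H^\infty\to M(\mathcal{D}_\mu)}=\sup\{\|\mathcal{C}(f)\|_{M(\mathcal{D}_\mu)}:\|f\|_{H^\infty}\le 1\}$, and this is the norm with which $\mathcal{C}$ is meant to be bounded. *)

(* Defs.v *)
From mathcomp Require Import all_boot all_order all_algebra.
From mathcomp Require Import complex.
From mathcomp Require Import all_classical all_reals all_analysis.

Set Implicit Arguments.
Unset Strict Implicit.
Unset Printing Implicit Defensive.

Import Order.TTheory GRing.Theory Num.Theory.
Import numFieldNormedType.Exports.

Local Open Scope classical_set_scope.
Local Open Scope ring_scope.

Local Notation normc := Normc.normc.

(* R[i] as a numFieldType: MathComp-Analysis attaches the norm topology to
   an abstract numFieldType, not to the carrier R[i]. *)
Definition Cplx (R : realType) : numFieldType := R[i].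

Section Disc.
Variable R : realType.
Local Notation C := (Cplx R).

Definition unit_disc : set C := [set z | normc z < 1].

(* Analytic functions are total functions whose values off the disc are
   irrelevant: the disc is open, so complex differentiability at its points
   depends only on the values there. *)
Definition Hol (f : C -> C) : Prop := forall z, unit_disc z -> derivable f z 1.

Definition Aut (phi : C -> C) : Prop :=
  [/\ Hol phi,
      (forall z w, unit_disc z -> unit_disc w -> phi z = phi w -> z = w)
    & phi @` unit_disc = unit_disc].

Definition Hinf_norm (f : C -> C) : \bar R :=
  ereal_sup [set (normc (f z))%:E | z in unit_disc].

Definition Hinf (f : C -> C) : Prop := Hol f /\ (Hinf_norm f < +oo)%E.

Definition is_power_series (f : C -> C) (a : nat -> C) : Prop :=
  forall z, unit_disc z -> [series a n * z ^+ n]_n @ \oo --> f z.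

(* The coefficients a of f(z) = \sum_n a_n z^n, which exist and are unique
   when f is in Hol; the zero sequence if there are none. *)
Definition coefs (f : C -> C) : nat -> C :=
  xget (fun=> 0) [set a | is_power_series f a].

Definition cesaro_op (f : C -> C) (z : C) : C :=
  limn [series (n.+1%:R)^-1 * (\sum_(0 <= k < n.+1) coefs f k) * z ^+ n]_n.

End Disc.

(* The plane carries the product of two copies of the Borel sigma-algebra of
   the line, that is the Borel sigma-algebra of R^2, and is identified with the
   complex numbers through to_cplx. *)
Notation plane R := (measurableTypeR R * measurableTypeR R)%type.

Section DirichletSpace.
Variable R : realType.
Local Notation C := (Cplx R).

Definition to_cplx (p : plane R) : C := Complex p.1 p.2.

Definition plane_disc : set (plane R) := to_cplx @^-1` @unit_disc R.

Lemma invpi_ge0 : 0 <= (pi : R)^-1.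
Proof. by rewrite invr_ge0 pi_ge0. Qed.

Definition area : {measure set (plane R) -> \bar R} :=
  mscale (NngNum invpi_ge0) (@lebesgue_measure R \x @lebesgue_measure R)%E.

Definition rotation (c : C) (p : plane R) : plane R :=
  (complex.Re (c * to_cplx p), complex.Im (c * to_cplx p)).

(* A Borel measure on the disc is given by a Borel measure on the plane, of
   which only the restriction to the disc is ever used. *)
Variable mu : {measure set (plane R) -> \bar R}.

Definition radial : Prop :=
  forall (c : C) (A : set (plane R)), normc c = 1 ->
    measurable A -> A `<=` plane_disc -> mu (rotation c @^-1` A) = mu A.

(* log |(1 - conj w z) / (z - w)|^2, which is +oo on the diagonal. *)
Definition green (z w : C) : \bar R :=
  if z == w then +oo%E
  else (ln (normc ((1 - (w^*)%C * z) / (z - w)) ^+ 2))%:E.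

Definition U (z : C) : \bar R :=
  (\int[mu]_(p in plane_disc) green z (to_cplx p))%E.

Definition M_norm (f : C -> C) : \bar R :=
  ((normc (f 0))%:E +
   ereal_sup
     [set sqrte (\int[area]_(p in plane_disc)
        ((normc (derive1 f (to_cplx p)) ^+ 2)%:E * U (phi (to_cplx p))))
     | phi in @Aut R])%E.

Definition M_space (f : C -> C) : Prop := Hol f /\ (M_norm f < +oo)%E.

Definition cesaro_bounded : Prop :=
  exists K : R, forall f, Hinf f ->
    M_space (@cesaro_op R f) /\ (M_norm (@cesaro_op R f) <= K%:E * Hinf_norm f)%E.

Definition cesaro_opnorm : \bar R :=
  ereal_sup [set M_norm (@cesaro_op R f) |
    f in [set f | Hinf f /\ (Hinf_norm f <= 1)%E]].

End DirichletSpace.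

(* Main.v *)
(* Write F for the Cesaro transform of f, so that (zF)' = f/(1 - z), and B for
   the integral of 4/|1 - z^2|^2 against U dA (the factor 1/pi is irrelevant).

   Every automorphism of the disc is a Blaschke factor psi composed with a
   rotation (maximum principle and Schwarz lemma), and U is radial, so only the
   weights U o psi matter.  Let G be the Green function.  For a polynomial P
   and a point a, the composites P o psi_a and (zP) o psi_a = psi_a (P o psi_a)
   have the same modulus on the unit circle, and the Littlewood-Paley formula
   for the weight G(., 0) = log 1/|z|^2 gives that the integral of
   |P'|^2 G(., a) is at most that of |(zP)'|^2 G(., a).  Integrating in a yields
   the same inequality for the weights U o psi.

   Upper bound: for P a partial sum of the Taylor series of F(rho z), |(zP)'| is
   at most (1 + o(1))/|1 - rho z|.  After the substitution psi the function
   1/(1 - rho z) becomes the power series with coefficients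
   (c^(n+1) - d^(n+1))/rho for some |c|, |d| <= 1.  Since
   sum |c^(n+1) - d^(n+1)|^2 s^n <= 4/(1 - s^2), with equality for c = 1 and
   d = -1, which is the series 2/(1 - z^2), Parseval's identity for the radial
   weight U bounds the integral by rho^-2 B.

   Lower bound: for f = 1, (1 - w) F'(w) tends to 1 as w tends to 1
   nontangentially, so |(F o psi_t)'|^2 tends to 4/|1 - z^2|^2 as t increases
   to 1, and Fatou's lemma applies. *)
From HB Require Import structures.
Require Import Defs.
From mathcomp Require Import all_boot all_order all_algebra.
From mathcomp Require Import complex.
From mathcomp Require Import all_classical all_reals all_analysis.
From mathcomp Require Import measurable_realfun.
From mathcomp Require Import ring lra.

Set Implicit Arguments.
Unset Strict Implicit.
Unset Printing Implicit Defensive.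

Import Order.TTheory GRing.Theory Num.Theory.
Import numFieldNormedType.Exports.

Local Open Scope classical_set_scope.
Local Open Scope ring_scope.

Local Notation normc z := (Normc.normc (z : Cplx _)).
#[local] Arguments Normc.normc : simpl never.

(** * The complex modulus and the plane topology *)

(** The step from |P'| to |(zP)'| is made because |(zF)'| = |f|/|1 - z| is controlled pointwise by
    the sup norm of f, whereas F' brings in F itself. It is made for polynomials because P o psi_a
    then has geometrically decaying coefficients, and the Littlewood-Paley formula turns into a sum
    over coefficients that telescopes; what is lost is the value at 0, where |a P(a)| <= |P(a)|. All
    integrals are of nonnegative functions and may be infinite, and the weights take the value +oo.
    Hence every passage to the limit is Fatou's lemma with lower approximations, and Parseval's
    identity appears as two inequalities. Circle means are averages over 2^m-th roots of unity, and
    the moments of the Green function come from Tonelli's theorem on the layers |z|^2 < u < 1. The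
    substitution psi_a is split into affine maps and an inversion, the latter treated through Haar
    measure. Integrating in a needs a sigma-finite measure, which the integrability of 1 - |z|^2
    provides on the disc. As [Aut] consists of analytic bijections, its description starts from
    Goursat's theorem. *)

Section Modulus.
Variable R : realType.
Local Notation C := (Cplx R).
Implicit Types (x y z w : C) (r e : R).

Lemma normE z : `|z| = (normc z)%:C%C :> R[i].
Proof. by case: z. Qed.

Lemma normc_ge0 z : 0 <= normc z.
Proof. by case: z => a b; exact: sqrtr_ge0. Qed.

Lemma normc0 : normc (0 : C) = 0. Proof. exact: Normc.normc0. Qed.

Lemma normc1 : normc (1 : C) = 1. Proof. exact: Normc.normc1. Qed.

Lemma normcM z w : normc (z * w) = normc z * normc w.
Proof. exact: Normc.normcM. Qed.

Lemma normcV z : normc z^-1 = (normc z)^-1.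
Proof. exact: Normc.normcV. Qed.

Lemma normcN z : normc (- z) = normc z.
Proof. by case: z => a b; rewrite /Normc.normc /= !sqrrN. Qed.

Lemma normcX z n : normc (z ^+ n) = normc z ^+ n.
Proof. by elim: n => [|n IH]; rewrite ?expr0 ?normc1// !exprS normcM IH. Qed.

Lemma normcBC z w : normc (z - w) = normc (w - z).
Proof. by rewrite -normcN opprB. Qed.

Lemma ler_normcD z w : normc (z + w) <= normc z + normc w.
Proof. exact: le_normcD. Qed.

Lemma ler_normcB z w : normc (z - w) <= normc z + normc w.
Proof. by rewrite -(normcN w); exact: ler_normcD. Qed.

Lemma lerB_normcD z w : normc z - normc w <= normc (z + w).
Proof. by rewrite lerBlDr -{1}(addrK w z); exact: ler_normcB. Qed.

Lemma lerB_normcB z w : normc z - normc w <= normc (z - w).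
Proof. by rewrite -(normcN w); exact: lerB_normcD. Qed.

Lemma normc_distD y z w : normc (z - w) <= normc (z - y) + normc (y - w).
Proof. by rewrite -{1}(subrK y z) -addrA; exact: ler_normcD. Qed.

Lemma normc_eq0 z : (normc z == 0) = (z == 0).
Proof.
by apply/idP/idP => [/eqP/Normc.eq0_normc ->//|/eqP ->]; rewrite normc0.
Qed.

Lemma normc_gt0 z : (0 < normc z) = (z != 0).
Proof. by rewrite lt_neqAle normc_ge0 andbT eq_sym normc_eq0. Qed.

Lemma normc_real r : normc (r%:C%C : C) = `|r|.
Proof. by rewrite /Normc.normc /= expr0n /= addr0 sqrtr_sqr. Qed.

Lemma normc_nat n : normc (n%:R : C) = n%:R.
Proof. by rewrite -[n%:R]/(n%:R : R[i]) -(rmorph_nat (real_complex R)) normc_real normr_nat. Qed.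

Lemma normc_conj z : normc (z^*)%C = normc z.
Proof. by case: z => a b; rewrite /Normc.normc /= sqrrN. Qed.

Lemma normc_sqr z : normc z ^+ 2 = complex.Re z ^+ 2 + complex.Im z ^+ 2.
Proof. by case: z => a b /=; rewrite sqr_sqrtr// addr_ge0 ?sqr_ge0. Qed.

Lemma mul_conjE z : z * (z^*)%C = ((normc z ^+ 2)%:C)%C :> C.
Proof.
rewrite normc_sqr; case: z => a b /=; simpc; congr (_ +i* _)%C; ring.
Qed.

Lemma Re_le_normc z : `|complex.Re z| <= normc z.
Proof.
by rewrite -(@ler_sqr _) ?nnegrE ?normc_ge0// normc_sqr real_normK ?num_real// lerDl sqr_ge0.
Qed.

Lemma Im_le_normc z : `|complex.Im z| <= normc z.
Proof.
by rewrite -(@ler_sqr _) ?nnegrE ?normc_ge0// normc_sqr real_normK ?num_real// lerDr sqr_ge0.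
Qed.

Lemma normc_le_ReIm z : normc z <= `|complex.Re z| + `|complex.Im z|.
Proof.
rewrite -(@ler_sqr _) ?nnegrE ?normc_ge0 ?addr_ge0// normc_sqr sqrrD !real_normK ?num_real//.
by rewrite -addrA lerD2l lerDr mulrn_wge0// mulr_ge0.
Qed.

Lemma cplxE z : z = Complex (complex.Re z) (complex.Im z) :> C.
Proof. by case: z. Qed.

Lemma conj_mul z w : ((z * w)%R^*)%C = (z^*)%C * (w^*)%C :> C.
Proof. by case: z w => a b [c d]; congr Complex => /=; ring. Qed.

Lemma conj_exp z n : ((z ^+ n)%R^*)%C = (z^*)%C ^+ n :> C.
Proof.
by elim: n => [|n IH]; rewrite ?expr0 ?conjc1// !exprS conj_mul IH.
Qed.

Lemma cplx_eq z w : complex.Re z = complex.Re w -> complex.Im z = complex.Im w -> z = w.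
Proof. by case: z w => a b [c d] /= -> ->. Qed.

Lemma normc_sum (I : Type) (s : seq I) (P : pred I) (F : I -> C) :
  normc (\sum_(i <- s | P i) F i) <= \sum_(i <- s | P i) normc (F i).
Proof.
elim/big_ind2 : _ => // [|x1 x2 y1 y2 h1 h2]; first by rewrite normc0.
by rewrite (le_trans (ler_normcD _ _))// lerD.
Qed.

End Modulus.

Section Convergence.
Variable R : realType.
Local Notation C := (Cplx R).

Lemma cvg_normcP (u : nat -> C) (l : C) :
  (u @ \oo --> l) <-> (normc (u n - l) @[n --> \oo] --> (0 : R)).
Proof.
split=> [/cvgrPdist_lt H|/cvgrPdist_lt H]; apply/cvgrPdist_lt => e e0.
- have e0' : 0 < (e%:C)%C :> C by rewrite -[0]/((0%:C)%C) ltcR.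
  have := H _ e0'; apply: filterS => n.
  rewrite sub0r normrN [X in _ -> X < _]ger0_norm ?normc_ge0// => h.
  by move: h; rewrite normE ltcR normcBC.
- have e1 : e = ((complex.Re e)%:C)%C.
    by rewrite RRe_real// ger0_real// ltW.
  have := H (complex.Re e); rewrite e1 -[0 < _]/((0%:C)%C < _ :> C) ltcR in e0.
  move=> /(_ e0); apply: filterS => n.
  rewrite sub0r normrN ger0_norm ?normc_ge0// => h.
  by rewrite normE e1 ltcR normcBC.
Qed.

(* [l] is the derivative of [f] at [z], with real [e] and [d]; the positive
   elements of the numFieldType [C] are themselves complex numbers. *)
Definition cderive (f : C -> C) (z l : C) := forall e : R, 0 < e ->
  exists2 d : R, 0 < d &
    forall h, normc h < d -> normc (f (z + h) - f z - l * h) <= e * normc h.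

Lemma nbhs_normcP (z : C) (P : set C) : nbhs z P <->
  exists2 d : R, 0 < d & forall w, normc (w - z) < d -> P w.
Proof.
split.
- move/nbhs_ballP => [e /= e0 H].
  have e1 : e = ((complex.Re e)%:C)%C by rewrite RRe_real// ger0_real// ltW.
  exists (complex.Re e).
    by move: e0; rewrite e1 -[0 < _]/((0%:C)%C < _ :> C) ltcR.
  move=> w hw; apply: H; rewrite /ball /= normE normcBC e1 ltcR//.
- move=> [d d0 H]; apply/nbhs_ballP; exists (d%:C)%C => /=.
    by rewrite -[0]/((0%:C)%C) ltcR.
  by move=> w; rewrite /ball /= normE normcBC ltcR; exact: H.
Qed.

Lemma is_derive_cderive (f : C -> C) (z l : C) :
  is_derive z 1 f l <-> cderive f z l.
Proof.
split.
- move=> [dfz <-] e e0.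
  move/cvg_ex: (dfz) => [k hk].
  have -> : 'D_1 f z = k by exact: cvg_lim hk.
  move: hk => /cvgrPdist_le /(_ (e%:C)%C).
  rewrite -[0]/((0%:C)%C : C) ltcR => /(_ e0).
  rewrite near_withinE => /nbhs_normcP [d d0 H]; exists d => // h hd.
  have [->|h0] := eqVneq h 0; first by rewrite addr0 subrr mulr0 subrr normc0 mulr0.
  have := H h; rewrite subr0 => /(_ hd h0).
  rewrite normE lecR => hk.
  have -> : f (z + h) - f z - k * h = - h * (k - h^-1 *: (f (h *: 1 + z) - f z)).
    rewrite scalerDr /GRing.scale /= mulr1 [h + z]addrC; field => //.
  by rewrite normcM normcN mulrC ler_wpM2r ?normc_ge0.
- move=> H.
  have hc : h^-1 *: (f (h *: 1 + z) - f z) @[h --> 0^'] --> l.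
    apply/cvgrPdist_le => e e0.
    have e1 : e = ((complex.Re e)%:C)%C by rewrite RRe_real// ger0_real// ltW.
    move: e0; rewrite e1 -[0 < _]/((0%:C)%C < _ :> C) ltcR => e0.
    have [d d0 hd] := H _ e0.
    rewrite near_withinE; apply/nbhs_normcP; exists d => // h; rewrite subr0 => hh h0.
    rewrite normE lecR.
    have := hd h hh.
    have -> : f (z + h) - f z - l * h = - h * (l - h^-1 *: (f (h *: 1 + z) - f z)).
      rewrite scalerDr /GRing.scale /= mulr1 [h + z]addrC; field => //.
    by rewrite normcM normcN mulrC ler_pM2r// normc_gt0.
  split; last exact: cvg_lim hc.
  by apply/cvg_ex; exists l.
Qed.

Lemma derivable_cderive (f : C -> C) (z : C) :
  derivable f z 1 <-> exists l, cderive f z l.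
Proof.
split=> [H|[l /is_derive_cderive[]//]].
by exists ('D_1 f z); apply/is_derive_cderive; split.
Qed.

Lemma cderive_derive1 (f : C -> C) (z l : C) : cderive f z l -> derive1 f z = l.
Proof. by move/is_derive_cderive => [_ <-]; rewrite derive1E. Qed.

End Convergence.

(** * Complex derivatives through continuous slopes *)

Section Caratheodory.
Variable R : realType.
Local Notation C := (Cplx R).
Implicit Types (f g p q : C -> C) (z w l : C).

Definition cnear z (P : C -> Prop) :=
  exists2 d : R, 0 < d & forall w, normc (w - z) < d -> P w.

Lemma cnearW z (P : C -> Prop) : (forall w, P w) -> cnear z P.
Proof. by move=> H; exists 1. Qed.

Lemma cnearI z (P Q : C -> Prop) :
  cnear z P -> cnear z Q -> cnear z (fun w => P w /\ Q w).
Proof.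
move=> [d d0 hd] [e e0 he]; exists (Num.min d e); first by rewrite lt_min d0.
by move=> w; rewrite lt_min => /andP[/hd ? /he].
Qed.

Lemma cnearS z (P Q : C -> Prop) : (forall w, P w -> Q w) -> cnear z P -> cnear z Q.
Proof. by move=> PQ [d d0 hd]; exists d => // w /hd /PQ. Qed.

Lemma cnear_refl z (P : C -> Prop) : cnear z P -> P z.
Proof. by move=> [d d0]; apply; rewrite subrr normc0. Qed.

Definition ccont q z := forall e : R, 0 < e ->
  cnear z (fun w => normc (q w - q z) <= e).

Lemma ccont_cst l z : ccont (cst l) z.
Proof. by move=> e e0; apply: cnearW => w; rewrite subrr normc0 ltW. Qed.

Lemma ccont_id z : ccont id z.
Proof. by move=> e e0; exists e => // w; exact: ltW. Qed.

Lemma ccontD p q z : ccont p z -> ccont q z -> ccont (fun w => p w + q w) z.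
Proof.
move=> cp cq e e0; have e2 : 0 < e / 2 by rewrite divr_gt0.
apply: cnearS (cnearI (cp _ e2) (cq _ e2)) => w [h1 h2].
rewrite [X in normc X](_ : _ = (p w - p z) + (q w - q z) :> C); last by ring.
by rewrite (le_trans (ler_normcD _ _))// [leRHS](splitr e) lerD.
Qed.

Lemma ccontM p q z : ccont p z -> ccont q z -> ccont (fun w => p w * q w) z.
Proof.
move=> cp cq e e0.
have a0 : 0 < normc (q z) + 1 by rewrite ltr_wpDl ?normc_ge0.
have b0 : 0 < normc (p z) + 1 by rewrite ltr_wpDl ?normc_ge0.
have ea0 : 0 < e / 2 / (normc (q z) + 1) by rewrite !divr_gt0.
have eb0 : 0 < e / 2 / (normc (p z) + 1) by rewrite !divr_gt0.
apply: cnearS (cnearI (cp _ ea0) (cnearI (cq _ ltr01) (cq _ eb0))) => w [h1 [h2 h3]].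
rewrite [X in normc X](_ : _ = (p w - p z) * q w + p z * (q w - q z) :> C); last by ring.
rewrite (le_trans (ler_normcD _ _))// [leRHS](splitr e) !normcM.
have hq : normc (q w) <= normc (q z) + 1.
  by rewrite -lerBlDl (le_trans (lerB_normcB _ _)).
apply: lerD.
  rewrite -(@divfK _ (normc (q z) + 1) _ (e / 2)) ?gt_eqF//.
  by apply: ler_pM; rewrite ?normc_ge0.
rewrite mulrC -(@divfK _ (normc (p z) + 1) _ (e / 2)) ?gt_eqF//.
by apply: ler_pM; rewrite ?normc_ge0// lerDl.
Qed.

Lemma ccontX q z n : ccont q z -> ccont (fun w => q w ^+ n) z.
Proof.
move=> cq; elim: n => [|n IH]; first exact: (@ccont_cst 1).
by move=> e e0; have := ccontM cq IH e0; apply: cnearS => w; rewrite !exprS.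
Qed.

Lemma ccont_neq0 q z : ccont q z -> q z != 0 ->
  cnear z (fun w => normc (q z) / 2 <= normc (q w)).
Proof.
move=> cq qz0; have h0 : 0 < normc (q z) / 2 by rewrite divr_gt0 ?normc_gt0.
apply: cnearS (cq _ h0) => w h.
have := lerB_normcB (q z) (q w); rewrite normcBC => h2.
by have := le_trans h2 h; lra.
Qed.

Lemma ccontV q z : ccont q z -> q z != 0 -> ccont (fun w => (q w)^-1) z.
Proof.
move=> cq qz0 e e0.
have a0 : 0 < normc (q z) by rewrite normc_gt0.
have ea0 : 0 < e * (normc (q z) ^+ 2 / 2) by rewrite mulr_gt0// divr_gt0// exprn_gt0.
apply: cnearS (cnearI (ccont_neq0 cq qz0) (cq _ ea0)) => w [h1 h2].
have b0 : 0 < normc (q w) by rewrite (lt_le_trans _ h1)// divr_gt0.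
have qw0 : q w != 0 by rewrite -normc_gt0.
rewrite [X in normc X](_ : _ = (q z - q w) / (q w * q z) :> C); last first.
  by field; rewrite qz0 qw0.
rewrite normcM normcV normcBC normcM ler_pdivrMr ?mulr_gt0//.
by apply: le_trans h2 _; rewrite ler_pM2l// expr2 mulrAC ler_pM2r.
Qed.

Lemma ccont_comp p q z : ccont q z -> ccont p (q z) -> ccont (fun w => p (q w)) z.
Proof.
move=> cq cp e e0; have [d d0 hd] := cp e e0.
have d2 : 0 < d / 2 by rewrite divr_gt0.
apply: cnearS (cq _ d2) => w hw; apply: hd; apply: le_lt_trans hw _; lra.
Qed.

Lemma cnear_comp q z (P : C -> Prop) :
  ccont q z -> cnear (q z) P -> cnear z (fun w => P (q w)).
Proof.
move=> cq [d d0 hd]; have d2 : 0 < d / 2 by rewrite divr_gt0.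
apply: cnearS (cq _ d2) => w hw; apply: hd; apply: le_lt_trans hw _; lra.
Qed.

Lemma ccont_near p q z : cnear z (fun w => p w = q w) -> ccont p z -> ccont q z.
Proof.
move=> pq cp e e0; have pqz := cnear_refl pq.
by apply: cnearS (cnearI pq (cp e e0)) => w [<-]; rewrite pqz.
Qed.

(** Caratheodory's form of the derivative: a slope function [q], continuous at [z], replaces the
    limit. The rules for sums, products, inverses and composites then reduce to algebra with
    slopes. *)
Lemma cderive_quotient f z l : cderive f z l <->
  exists q, [/\ ccont q z, q z = l &
                cnear z (fun w => f w = f z + q w * (w - z))].
Proof.
split=> [H|[q [cq qz Hq]] e e0].
- pose q w := if w == z then l else (f w - f z) / (w - z).
  exists q; split; [|by rewrite /q eqxx|]; last first.
    apply: cnearW => w; rewrite /q.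
    case: eqP => [->|/eqP wz]; first by rewrite subrr mulr0 addr0.
    by rewrite divfK ?subr_eq0// addrC subrK.
  move=> e e0; have [d d0 hd] := H _ e0; exists d => // w wd.
  rewrite /q eqxx; case: eqP => [_|/eqP wz]; first by rewrite subrr normc0 ltW.
  have h0 : w - z != 0 by rewrite subr_eq0.
  have := hd _ wd; rewrite subrKC.
  have -> : f w - f z - l * (w - z) = (w - z) * ((f w - f z) / (w - z) - l).
    by field.
  by rewrite normcM mulrC ler_pM2r ?normc_gt0.
- have [d d0 hd] := cnearI Hq (cq _ e0).
  exists d => // h hh; have [] := hd (z + h); first by rewrite addrC addKr.
  rewrite /= qz => -> hq.
  have -> : f z + q (z + h) * (z + h - z) - f z - l * h = (q (z + h) - l) * h.
    by ring.
  by rewrite normcM ler_wpM2r ?normc_ge0.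
Qed.

Lemma cderive_continuous f z l : cderive f z l -> ccont f z.
Proof.
move=> /cderive_quotient[q [cq qz hq]].
apply: (@ccont_near (fun w => f z + q w * (w - z))).
  by apply: cnearS hq => w ->.
apply: ccontD; first exact: ccont_cst.
apply: ccontM => //; apply: ccontD; [exact: ccont_id|exact: ccont_cst].
Qed.

Lemma cderive_near f g z l : cnear z (fun w => f w = g w) ->
  cderive f z l -> cderive g z l.
Proof.
move=> fg /cderive_quotient[q [cq qz hq]]; apply/cderive_quotient.
exists q; split=> //; have fgz := cnear_refl fg.
by apply: cnearS (cnearI fg hq) => w [<- ->]; rewrite fgz.
Qed.

Lemma cderive_ext f g z l : f =1 g -> cderive f z l -> cderive g z l.
Proof. by move=> fg; apply: cderive_near; apply: cnearW. Qed.

Lemma cderive_cst (c : C) z : cderive (cst c) z 0.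
Proof.
move=> e e0; exists 1 => // h _.
by rewrite /= mul0r subr0 subrr normc0 mulr_ge0 ?normc_ge0// ltW.
Qed.

Lemma cderive_id z : cderive id z 1.
Proof.
move=> e e0; exists 1 => // h _.
by rewrite /= mul1r (addrC z) addrK subrr normc0 mulr_ge0 ?normc_ge0// ltW.
Qed.

Lemma cderiveD f g z k l : cderive f z k -> cderive g z l ->
  cderive (fun w => f w + g w) z (k + l).
Proof.
move=> /cderive_quotient[p [cp pz hp]] /cderive_quotient[q [cq qz hq]].
apply/cderive_quotient; exists (fun w => p w + q w); split.
- exact: ccontD.
- by rewrite pz qz.
- by apply: cnearS (cnearI hp hq) => w [-> ->]; ring.
Qed.

Lemma cderiveM f g z k l : cderive f z k -> cderive g z l ->
  cderive (fun w => f w * g w) z (k * g z + f z * l).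
Proof.
move=> df dg; have cf := cderive_continuous df; move: df dg.
move=> /cderive_quotient[p [cp pz hp]] /cderive_quotient[q [cq qz hq]].
apply/cderive_quotient; exists (fun w => p w * g z + f w * q w); split.
- by apply: ccontD; apply: ccontM => //; exact: ccont_cst.
- by rewrite pz qz.
- by apply: cnearS (cnearI hp hq) => w [h1 ->]; rewrite mulrDr [in X in X + _]h1; ring.
Qed.

Lemma cderiveZ (c : C) f z k : cderive f z k -> cderive (fun w => c * f w) z (c * k).
Proof.
by move=> /(cderiveM (cderive_cst c z)); rewrite mul0r add0r.
Qed.

Lemma cderiveN f z k : cderive f z k -> cderive (fun w => - f w) z (- k).
Proof.
move=> /(cderiveZ (-1)); rewrite mulN1r; apply: cderive_ext => w.
by rewrite mulN1r.
Qed.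

Lemma cderiveB f g z k l : cderive f z k -> cderive g z l ->
  cderive (fun w => f w - g w) z (k - l).
Proof. by move=> df /cderiveN; exact: cderiveD. Qed.

Lemma cderiveV f z k : cderive f z k -> f z != 0 ->
  cderive (fun w => (f w)^-1) z (- k / f z ^+ 2).
Proof.
move=> df fz0; have cf := cderive_continuous df; move: df.
move=> /cderive_quotient[p [cp pz hp]].
apply/cderive_quotient; exists (fun w => (- 1 * p w) * (f w * f z)^-1); split.
- apply: ccontM; first by apply: ccontM => //; exact: ccont_cst.
  by apply: ccontV; [apply: ccontM => //; exact: ccont_cst|rewrite mulf_neq0].
- by rewrite pz expr2 mulN1r.
- apply: cnearS (cnearI hp (ccont_neq0 cf fz0)) => w [h1 h2].
  have fw0 : f w != 0.
    by rewrite -normc_gt0 (lt_le_trans _ h2)// divr_gt0// normc_gt0.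
  have h3 : f w - f z = p w * (w - z) by rewrite h1; ring.
  have -> : - 1 * p w / (f w * f z) * (w - z) = - (p w * (w - z)) / (f w * f z) by ring.
  by rewrite -h3; field; rewrite fz0 fw0.
Qed.

Lemma cderive_comp f g z k l : cderive g z l -> cderive f (g z) k ->
  cderive (fun w => f (g w)) z (k * l).
Proof.
move=> dg; have cg := cderive_continuous dg; move: dg.
move=> /cderive_quotient[q [cq qz hq]] /cderive_quotient[p [cp pz hp]].
apply/cderive_quotient; exists (fun w => p (g w) * q w); split.
- by apply: ccontM => //; exact: ccont_comp cg cp.
- by rewrite pz qz.
- by apply: cnearS (cnearI hq (cnear_comp cg hp)) => w [h1 ->]; rewrite h1; ring.
Qed.

Lemma cderiveX f z k n : cderive f z k ->
  cderive (fun w => f w ^+ n) z (n%:R * f z ^+ n.-1 * k).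
Proof.
move=> df; elim: n => [|n IH].
  rewrite !mul0r; apply: (@cderive_ext (cst 1)) => [w|]; first by rewrite expr0.
  exact: cderive_cst.
have := cderiveM df IH.
have -> : k * f z ^+ n + f z * (n%:R * f z ^+ n.-1 * k) = n.+1%:R * f z ^+ n * k.
  case: n {IH} => [|n]; first by rewrite /=; ring.
  by rewrite /= exprS -[n.+2%:R]natr1; ring.
by apply: cderive_ext => w; rewrite exprS.
Qed.

Lemma cderive_uniq f z k l : cderive f z k -> cderive f z l -> k = l.
Proof. by move=> fk fl; rewrite -(cderive_derive1 fk) -(cderive_derive1 fl). Qed.

End Caratheodory.

(** * Measurability of complex functions *)

Section ComplexMeasurability.
Context d (T : measurableType d) (R : realType).
Local Notation C := (Cplx R).
Implicit Types (f g : T -> R) (F G : T -> C).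

Lemma measurable_fun_inv f : measurable_fun setT f -> measurable_fun setT (fun x => (f x)^-1).
Proof.
move=> mf.
(* The square makes the base of the real power nonnegative; at a zero of [f] both sides are 0, as
   [0^-1 = 0]. *)
have -> : (fun x => (f x)^-1) = (fun x => f x * ((f x ^+ 2) `^ (-1))).
  apply/funext => x; rewrite powR_inv1 ?sqr_ge0//.
  have [->|f0] := eqVneq (f x) 0; first by rewrite invr0 mul0r.
  by rewrite expr2 invfM mulrA divff// mul1r.
apply: measurable_funM => //.
by apply: (measurableT_comp (measurable_powR (-1))); exact: measurable_funX.
Qed.

Lemma measurable_fun_sqrt f : (forall x, 0 <= f x) -> measurable_fun setT f ->
  measurable_fun setT (fun x => Num.sqrt (f x)).
Proof.
move=> f0 mf.
have -> : (fun x => Num.sqrt (f x)) = (fun x => f x `^ (2^-1)).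
  by apply/funext => x; rewrite powR12_sqrt.
exact: (measurableT_comp (measurable_powR _)).
Qed.

Definition cmfun F := measurable_fun setT (fun x => complex.Re (F x)) /\
  measurable_fun setT (fun x => complex.Im (F x)).

Lemma cmfun_cst (c : C) : cmfun (fun=> c).
Proof. by split; exact: measurable_cst. Qed.

Lemma cmfunD F G : cmfun F -> cmfun G -> cmfun (fun x => F x + G x).
Proof.
move=> [a b] [c e]; split.
  under eq_fun do rewrite raddfD /=; exact: measurable_funD.
under eq_fun do rewrite raddfD /=; exact: measurable_funD.
Qed.

Lemma cmfunN F : cmfun F -> cmfun (fun x => - F x).
Proof.
move=> [a b]; split.
  under eq_fun do rewrite raddfN /=; exact: measurable_funN.
under eq_fun do rewrite raddfN /=; exact: measurable_funN.
Qed.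

Lemma cmfunB F G : cmfun F -> cmfun G -> cmfun (fun x => F x - G x).
Proof. by move=> hF /cmfunN; exact: cmfunD. Qed.

Lemma ReM (z w : C) : complex.Re (z * w) =
  complex.Re z * complex.Re w - complex.Im z * complex.Im w.
Proof. by case: z w => a b []. Qed.

Lemma ImM (z w : C) : complex.Im (z * w) =
  complex.Re z * complex.Im w + complex.Im z * complex.Re w.
Proof. by case: z w => a b []. Qed.

Lemma cmfunM F G : cmfun F -> cmfun G -> cmfun (fun x => F x * G x).
Proof.
move=> [a b] [c e]; split.
  under eq_fun do rewrite ReM; apply: measurable_funB; exact: measurable_funM.
under eq_fun do rewrite ImM; apply: measurable_funD; exact: measurable_funM.
Qed.

Lemma cmfunX F n : cmfun F -> cmfun (fun x => F x ^+ n).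
Proof.
move=> mF; elim: n => [|n IH]; first exact: (cmfun_cst 1).
have [a b] := cmfunM mF IH.
by split; under eq_fun do rewrite exprS.
Qed.

Lemma cmfun_sum (s : seq nat) (F : nat -> T -> C) : (forall i, cmfun (F i)) ->
  cmfun (fun x => \sum_(i <- s) F i x).
Proof.
move=> mF; elim: s => [|i s IH].
  by have [a b] := cmfun_cst 0; split; under eq_fun do rewrite big_nil.
have [a b] := cmfunD (mF i) IH.
by split; under eq_fun do rewrite big_cons.
Qed.

Lemma cmfun_conj F : cmfun F -> cmfun (fun x => ((F x)^*)%C).
Proof.
have Rc (z : C) : complex.Re (z^*)%C = complex.Re z by case: z.
have Ic (z : C) : complex.Im (z^*)%C = - complex.Im z by case: z.
move=> [a b]; split; first by under eq_fun do rewrite Rc.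
by under eq_fun do rewrite Ic; exact: measurable_funN.
Qed.

Lemma measurable_normc F : cmfun F -> measurable_fun setT (fun x => normc (F x)).
Proof.
move=> [a b].
have E (z : C) : normc z = Num.sqrt (complex.Re z ^+ 2 + complex.Im z ^+ 2) by case: z.
under eq_fun do rewrite E.
apply: measurable_fun_sqrt; first by move=> x; rewrite addr_ge0 ?sqr_ge0.
by apply: measurable_funD; exact: measurable_funX.
Qed.

Lemma cmfunV F : cmfun F -> cmfun (fun x => (F x)^-1).
Proof.
move=> mF.
have E (z : C) : z^-1 = ((z^*)%C * (((normc z ^+ 2)^-1)%:C)%C) :> C.
  have [->|z0] := eqVneq z 0; first by rewrite invr0 conjc0 mul0r.
  apply: (mulfI z0); rewrite divff// mulrA mul_conjE -rmorphM /= divff//.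
  by rewrite expf_neq0// normc_eq0.
have mr f : measurable_fun setT f -> cmfun (fun x => (f x)%:C%C).
  by move=> mf; split => //=; exact: measurable_cst.
have [a b] : cmfun (fun x => ((F x)^*)%C * (((normc (F x) ^+ 2)^-1)%:C)%C).
  apply: cmfunM; first exact: cmfun_conj.
  by apply: mr; apply: measurable_fun_inv; apply: measurable_funX; exact: measurable_normc.
by split; under eq_fun do rewrite E.
Qed.

Lemma cmfun_div F G : cmfun F -> cmfun G -> cmfun (fun x => F x / G x).
Proof. by move=> mF /cmfunV; exact: cmfunM. Qed.

Lemma measurable_ceq F G : cmfun F -> cmfun G ->
  measurable_fun setT (fun x => F x == G x).
Proof.
move=> mF mG.
have mn := measurable_normc (cmfunB mF mG).
have -> : (fun x => F x == G x) = (fun x => normc (F x - G x) <= 0).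
  by apply/funext => x; rewrite le_eqVlt ltNge normc_ge0 orbF normc_eq0 subr_eq0.
by apply: measurable_fun_ler => //; exact: measurable_cst.
Qed.

End ComplexMeasurability.

Section PlaneFunctions.
Context (R : realType).
Local Notation C := (Cplx R).

Definition of_cplx (z : C) : plane R := (complex.Re z, complex.Im z).

Lemma of_cplxK : cancel of_cplx (@to_cplx R).
Proof. by case. Qed.

Lemma to_cplxK : cancel (@to_cplx R) of_cplx.
Proof. by case. Qed.

Lemma cmfun_to_cplx : cmfun (@to_cplx R).
Proof. by split; [exact: measurable_fst|exact: measurable_snd]. Qed.

(* Measurability on [C], which carries no sigma-algebra of its own. *)
Definition cmeasurable (h : C -> \bar R) := measurable_fun setT (h \o @to_cplx R).

Lemma cmeasurable_comp d (T : measurableType d) (h : C -> \bar R) (F : T -> C) :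
  cmeasurable h -> cmfun F -> measurable_fun setT (fun x => h (F x)).
Proof.
move=> mh [a b].
have -> : (fun x => h (F x)) = (h \o @to_cplx R) \o (fun x => (complex.Re (F x), complex.Im (F x))).
  by apply/funext => x /=; rewrite /to_cplx /= -cplxE.
by apply: measurableT_comp => //; exact: measurable_fun_pair.
Qed.

Lemma measurable_plane_disc : measurable (@plane_disc R).
Proof.
have := measurable_fun_ltr (measurable_normc cmfun_to_cplx)
  (@measurable_cst _ _ (plane R) _ setT (1 : R)).
move=> /(_ measurableT [set true]); rewrite setTI => H.
have -> : @plane_disc R = [set p | normc (to_cplx p) < 1] by [].
rewrite (_ : [set p | _] = (fun p : plane R => normc (to_cplx p) < 1) @^-1` [set true]).
  exact: H.
by apply/seteqP; split.
Qed.

End PlaneFunctions.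

(** * Disc automorphisms *)

Section Blaschke.
Variable R : realType.
Local Notation C := (Cplx R).
Implicit Types (a b u z w : C).

Definition blaschke a z : C := (a - z) / (1 - (a^*)%C * z).

Lemma blaschke_normE a z :
  normc (1 - (a^*)%C * z) ^+ 2 - normc (a - z) ^+ 2 =
  (1 - normc a ^+ 2) * (1 - normc z ^+ 2).
Proof.
by rewrite !normc_sqr; case: a z => a1 a2 [z1 z2] /=; ring.
Qed.

Lemma blaschke_den_gt0 a z : normc a < 1 -> normc z <= 1 ->
  0 < normc (1 - (a^*)%C * z).
Proof.
move=> a1 z1; apply: lt_le_trans (lerB_normcB _ _).
rewrite normc1 subr_gt0 normcM normc_conj; apply: le_lt_trans a1.
by rewrite ler_piMr// normc_ge0.
Qed.

Lemma blaschke_den_neq0 a z : normc a < 1 -> normc z <= 1 ->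
  1 - (a^*)%C * z != 0.
Proof. by move=> a1 z1; rewrite -normc_gt0 blaschke_den_gt0. Qed.

Lemma blaschke_1Bnorm a z : normc a < 1 -> normc z <= 1 ->
  1 - normc (blaschke a z) ^+ 2 =
  (1 - normc a ^+ 2) * (1 - normc z ^+ 2) / normc (1 - (a^*)%C * z) ^+ 2.
Proof.
move=> a1 z1; have h := blaschke_den_gt0 a1 z1.
rewrite /blaschke normcM normcV -blaschke_normE; field.
by rewrite gt_eqF.
Qed.

Lemma normc_lt1P z : (normc z < 1) = (0 < 1 - normc z ^+ 2).
Proof. by rewrite subr_gt0 expr_lt1// normc_ge0. Qed.

Lemma normc_le1P z : (normc z <= 1) = (0 <= 1 - normc z ^+ 2).
Proof. by rewrite subr_ge0 expr_le1// normc_ge0. Qed.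

Lemma blaschke_lt1 a z : normc a < 1 -> normc z < 1 -> normc (blaschke a z) < 1.
Proof.
move=> a1 z1; rewrite normc_lt1P blaschke_1Bnorm ?ltW//.
rewrite divr_gt0 ?exprn_gt0 ?blaschke_den_gt0 ?ltW//.
by rewrite mulr_gt0// -normc_lt1P.
Qed.

Lemma blaschke_le1 a z : normc a < 1 -> normc z <= 1 -> normc (blaschke a z) <= 1.
Proof.
move=> a1 z1; rewrite normc_le1P blaschke_1Bnorm//.
rewrite divr_ge0 ?exprn_ge0 ?normc_ge0//.
by rewrite mulr_ge0// -normc_le1P// ltW.
Qed.

Lemma blaschke_eq1 a z : normc a < 1 -> normc z = 1 -> normc (blaschke a z) = 1.
Proof.
move=> a1 z1; have z1' : normc z <= 1 by rewrite z1.
have := blaschke_1Bnorm a1 z1'.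
rewrite z1 expr1n subrr mulr0 mul0r => /eqP; rewrite subr_eq0 eq_sym => /eqP h.
by apply/eqP; rewrite -(@eqrXn2 _ 2)// ?normc_ge0// expr1n h.
Qed.

Lemma blaschke0 a : blaschke a 0 = a.
Proof. by rewrite /blaschke mulr0 !subr0 divr1. Qed.

Lemma blaschke_id a : blaschke a a = 0.
Proof. by rewrite /blaschke subrr mul0r. Qed.

Lemma blaschkeK a z : normc a < 1 -> normc z <= 1 -> blaschke a (blaschke a z) = z.
Proof.
move=> a1 z1; have h := blaschke_den_neq0 a1 z1.
have h1 := blaschke_den_neq0 a1 (ltW a1).
rewrite /blaschke.
have -> : a - (a - z) / (1 - (a^*)%C * z) = z * (1 - (a^*)%C * a) / (1 - (a^*)%C * z).
  by field.
have -> : 1 - (a^*)%C * ((a - z) / (1 - (a^*)%C * z)) =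
   (1 - (a^*)%C * a) / (1 - (a^*)%C * z) by field.
by field; rewrite h1 h.
Qed.

Lemma cderive_blaschke a z : normc a < 1 -> normc z <= 1 ->
  cderive (blaschke a) z ((((normc a ^+ 2 - 1)%:C)%C : C) / (1 - (a^*)%C * z) ^+ 2).
Proof.
move=> a1 z1; have h := blaschke_den_neq0 a1 z1.
have d1 : cderive (fun w => a - w) z (0 - 1).
  by apply: cderiveB; [exact: cderive_cst|exact: cderive_id].
have d2 : cderive (fun w => 1 - (a^*)%C * w) z (0 - (a^*)%C * 1).
  by apply: cderiveB; [exact: cderive_cst|apply: cderiveZ; exact: cderive_id].
have := cderiveM d1 (cderiveV d2 h).
rewrite [X in cderive _ _ X](_ : _ = (((normc a ^+ 2 - 1)%:C)%C : C) / (1 - (a^*)%C * z) ^+ 2)//.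
by rewrite rmorphB rmorph1 /= -mul_conjE; field.
Qed.

(* Invariance of the pseudo-hyperbolic distance. *)
Lemma blaschke_blaschke a z w : normc a < 1 -> normc z < 1 -> normc w < 1 ->
  normc (blaschke (blaschke a w) (blaschke a z)) = normc (blaschke w z).
Proof.
move=> a1 z1 w1.
apply/eqP; rewrite -(@eqrXn2 _ 2)// ?normc_ge0// -(inj_eq (can_inj (subKr 1))).
rewrite !blaschke_1Bnorm ?blaschke_lt1 ?(ltW (blaschke_lt1 _ _)) ?ltW//.
have ha := blaschke_den_neq0 a1 (ltW z1); have hb := blaschke_den_neq0 a1 (ltW w1).
have hc := blaschke_den_neq0 w1 (ltW z1).
have hd : 1 - a * (w^*)%C != 0.
  by rewrite -(inj_eq (can_inj (@conjcK R))) rmorphB rmorphM rmorph1 rmorph0 /= conjcK.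
have haa := blaschke_den_neq0 a1 (ltW a1).
have -> : 1 - ((blaschke a w)^*)%C * blaschke a z =
    (1 - (a^*)%C * a) * (1 - (w^*)%C * z) / ((1 - a * (w^*)%C) * (1 - (a^*)%C * z)).
  rewrite /blaschke rmorphM rmorphV ?unitfE//= !rmorphB rmorphM rmorph1 /= conjcK.
  by field; rewrite ha hd.
rewrite normcM normcV !normcM.
have -> : normc (1 - a * (w^*)%C) = normc (1 - (a^*)%C * w).
  by rewrite -normc_conj rmorphB rmorphM rmorph1 /= conjcK.
have -> : normc (1 - (a^*)%C * a) = 1 - normc a ^+ 2.
  rewrite mulrC mul_conjE -[1]/((1%:C)%C : C) -rmorphB normc_real ger0_norm//.
  by rewrite -normc_le1P ltW.
have g0 x : x != 0 -> normc x != 0 by rewrite normc_eq0.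
have ea : 1 - normc a ^+ 2 != 0 by rewrite gt_eqF// -normc_lt1P.
by apply/eqP; field; rewrite !g0.
Qed.

End Blaschke.

(** * Complex-valued integrals over a segment *)

Section ContourIntegral.
Variable R : realType.
Local Notation C := (Cplx R).
Local Notation mu := (@lebesgue_measure R).
Implicit Types (g : R -> C) (a b c : R).

Definition rcont g (t : R) := forall e : R, 0 < e ->
  exists2 d : R, 0 < d & forall s, `|s - t| < d -> normc (g s - g t) <= e.

Definition rcont_on a b g := forall t, a <= t <= b -> rcont g t.

Definition cint a b g : C :=
  Complex (\int[mu]_(t in `[a, b]) complex.Re (g t))
          (\int[mu]_(t in `[a, b]) complex.Im (g t)).

Lemma rcont_onB a b g h : rcont_on a b g -> rcont_on a b h ->
  rcont_on a b (fun t => g t - h t).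
Proof.
move=> Hg Hh t tab e e0; have e2 : 0 < e / 2 by rewrite divr_gt0.
have [d1 d10 h1] := Hg t tab _ e2; have [d2 d20 h2] := Hh t tab _ e2.
exists (Num.min d1 d2); first by rewrite lt_min d10.
move=> s; rewrite lt_min => /andP[/h1 {}h1 /h2 {}h2].
rewrite [X in Normc.normc X](_ : _ = (g s - g t) - (h s - h t) :> C); last by ring.
by rewrite (le_trans (ler_normcB _ _))// [leRHS](splitr e) lerD.
Qed.

Lemma within_real_continuous a b (u : R -> R) :
  (forall t, a <= t <= b -> forall e : R, 0 < e ->
    exists2 d : R, 0 < d & forall s, `|s - t| < d -> `|u s - u t| <= e) ->
  {within `[a, b], continuous u}.
Proof.
move=> H; apply: continuous_in_subspaceT => t; rewrite inE /= in_itv /= => tab.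
apply/cvgrPdist_le => e e0; have [d d0 hd] := H t tab e e0.
near=> s; rewrite distrC; apply: hd.
by near: s; apply/nbhs_ballP; exists d => //= s; rewrite /ball /= distrC.
Unshelve. all: by end_near.
Qed.

Lemma integrable_Re a b g : rcont_on a b g ->
  mu.-integrable `[a, b] (EFin \o (fun t => complex.Re (g t))).
Proof.
move=> H; apply: continuous_compact_integrable; first exact: segment_compact.
apply: within_real_continuous => t tab e e0; have [d d0 hd] := H t tab e e0.
exists d => // s /hd; apply: le_trans; rewrite -raddfB.
exact: (Re_le_normc (g s - g t)).
Qed.

Lemma integrable_Im a b g : rcont_on a b g ->
  mu.-integrable `[a, b] (EFin \o (fun t => complex.Im (g t))).
Proof.
move=> H; apply: continuous_compact_integrable; first exact: segment_compact.
apply: within_real_continuous => t tab e e0; have [d d0 hd] := H t tab e e0.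
exists d => // s /hd; apply: le_trans; rewrite -raddfB.
exact: (Im_le_normc (g s - g t)).
Qed.

Lemma cint_cat a b c g : a <= c -> c <= b -> rcont_on a b g ->
  cint a b g = cint a c g + cint c b g.
Proof.
move=> ac cb gc; rewrite /cint.
have H (u : R -> R) : mu.-integrable `[a, b] (EFin \o u) ->
    \int[mu]_(t in `[a, b]) u t =
    \int[mu]_(t in `[a, c]) u t + \int[mu]_(t in `[c, b]) u t.
  move=> iu; rewrite -(@Rintegral_itv_obnd_cbnd _ c (BRight b)); last first.
    by apply: integrableS iu => //; apply: subset_itv => //=; rewrite bnd_simp.
  by rewrite -(@Rintegral_itvB _ u (BLeft a) (BRight b) c)// ?bnd_simp// addrC subrK.
by rewrite !H; [simpc|exact: integrable_Im|exact: integrable_Re].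
Qed.

Lemma cintB a b g h : rcont_on a b g -> rcont_on a b h ->
  cint a b (fun t => g t - h t) = cint a b g - cint a b h.
Proof.
move=> cg ch; rewrite /cint.
have -> : \int[mu]_(t in `[a, b]) complex.Re (g t - h t) =
    \int[mu]_(t in `[a, b]) (complex.Re (g t) - complex.Re (h t)).
  by apply: eq_Rintegral => t _; rewrite raddfB.
have -> : \int[mu]_(t in `[a, b]) complex.Im (g t - h t) =
    \int[mu]_(t in `[a, b]) (complex.Im (g t) - complex.Im (h t)).
  by apply: eq_Rintegral => t _; rewrite raddfB.
by rewrite !RintegralB//; [exact: integrable_Im|exact: integrable_Im|
  exact: integrable_Re|exact: integrable_Re].
Qed.

Lemma Rintegral_near_cst a b (u : R -> R) (k M : R) : a <= b ->
  mu.-integrable `[a, b] (EFin \o u) ->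
  (forall t, a <= t <= b -> `|u t - k| <= M) ->
  `|\int[mu]_(t in `[a, b]) u t - k * (b - a)| <= M * (b - a).
Proof.
move=> ab iu H.
have ic (r : R) : mu.-integrable `[a, b] (EFin \o cst r).
  apply: continuous_compact_integrable; first exact: segment_compact.
  by apply: continuous_subspaceT => x; exact: cvg_cst.
have Ic (r : R) : \int[mu]_(t in `[a, b]) r = r * (b - a).
  rewrite Rintegral_cst//= lebesgue_measure_itv /= lte_fin.
  by case: ltP => // ba; rewrite (@le_anti _ _ a b) ?ab// subrr.
rewrite -!Ic -RintegralB//; last exact: ic.
apply: le_trans (le_normr_Rintegral _ _) _ => //.
  rewrite (_ : EFin \o _ = (fun t => (u t)%:E - k%:E)%E)//.
  by apply: integrableB => //; exact: ic.
apply: le_Rintegral => //; last exact: (ic M).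
rewrite (_ : EFin \o _ = (abse \o (fun t => (u t)%:E - k%:E))%E)//.
by apply: integrable_abse; apply: integrableB => //; exact: ic.
Qed.

(** The factor 2 is the price of estimating real and imaginary parts separately; passing to powers
    removes it again from the mean value estimate. *)
Lemma cint_near_cst a b g (k : C) (M : R) : a <= b -> rcont_on a b g ->
  (forall t, a <= t <= b -> normc (g t - k) <= M) ->
  normc (cint a b g - k * ((b - a)%:C)%C) <= 2 * M * (b - a).
Proof.
move=> ab cg H; apply: le_trans (normc_le_ReIm _) _.
rewrite -mulrA mulr2n mulrDl !mul1r; apply: lerD.
- rewrite [X in `|X|](_ : _ = \int[mu]_(t in `[a, b]) complex.Re (g t) -
      complex.Re k * (b - a)); last first.
    by case: (k) => k1 k2; rewrite /cint; simpc; rewrite /= ?mulr0 ?subr0.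
  apply: Rintegral_near_cst => //; first exact: integrable_Re.
  by move=> t /H; apply: le_trans; rewrite -raddfB; exact: (Re_le_normc (g t - k)).
- rewrite [X in `|X|](_ : _ = \int[mu]_(t in `[a, b]) complex.Im (g t) -
      complex.Im k * (b - a)); last first.
    by case: (k) => k1 k2; rewrite /cint; simpc; rewrite /= ?mulr0 ?add0r.
  apply: Rintegral_near_cst => //; first exact: integrable_Im.
  by move=> t /H; apply: le_trans; rewrite -raddfB; exact: (Im_le_normc (g t - k)).
Qed.

End ContourIntegral.

(** * Goursat's theorem for rectangles *)

Section Goursat.
Variable R : realType.
Local Notation C := (Cplx R).
Implicit Types (J : C -> C) (x y s t : R).

Definition horiz J x s y : C := cint x (x + s) (fun u => J (Complex u y)).
Definition vert J y t x : C := cint y (y + t) (fun v => J (Complex x v)).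

(** The contour integral of [J], counterclockwise, round the rectangle with lower left corner
    [x + i y] and sides [s] and [t]; on the vertical sides [dz = i dy]. *)
Definition rect_int J x y s t : C :=
  horiz J x s y - horiz J x s (y + t) +
  Complex 0 1 * (vert J y t (x + s) - vert J y t x).

Arguments rect_int : simpl never.

Definition in_rect x y s t : set C :=
  [set z | x <= complex.Re z <= x + s /\ y <= complex.Im z <= y + t].

Lemma in_rectS x y s t x' y' s' t' : x <= x' -> y <= y' ->
  x' + s' <= x + s -> y' + t' <= y + t -> in_rect x' y' s' t' `<=` in_rect x y s t.
Proof. move=> h1 h2 h3 h4 z [/andP[a b] /andP[c d]]; split; lra. Qed.

Lemma rcont_horiz J x s y : (forall u, x <= u <= x + s -> ccont J (Complex u y)) ->
  rcont_on x (x + s) (fun u => J (Complex u y)).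
Proof.
move=> H u /H cu e e0; have [d d0 hd] := cu e e0; exists d => // v vu; apply: hd.
by rewrite (_ : _ - _ = ((v - u)%:C)%C :> C) ?normc_real//; simpc.
Qed.

Lemma rcont_vert J y t x : (forall v, y <= v <= y + t -> ccont J (Complex x v)) ->
  rcont_on y (y + t) (fun v => J (Complex x v)).
Proof.
move=> H u /H cu e e0; have [d d0 hd] := cu e e0; exists d => // v vu; apply: hd.
rewrite (_ : _ - _ = Complex 0 (v - u) :> C); last by simpc.
by rewrite /Normc.normc /= expr0n add0r sqrtr_sqr.
Qed.

Lemma horiz_halves J x s y : 0 <= s -> (forall u, x <= u <= x + s -> ccont J (Complex u y)) ->
  horiz J x s y = horiz J x (s / 2) y + horiz J (x + s / 2) (s / 2) y.
Proof.
move=> s0 H; rewrite /horiz (cint_cat _ _ (rcont_horiz H) (c := x + s / 2)); [|lra..].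
by rewrite -addrA -splitr.
Qed.

Lemma vert_halves J y t x : 0 <= t -> (forall v, y <= v <= y + t -> ccont J (Complex x v)) ->
  vert J y t x = vert J y (t / 2) x + vert J (y + t / 2) (t / 2) x.
Proof.
move=> s0 H; rewrite /vert (cint_cat _ _ (rcont_vert H) (c := y + t / 2)); [|lra..].
by rewrite -addrA -splitr.
Qed.

Lemma rect_int_quarters J x y s t : 0 <= s -> 0 <= t ->
  (forall z, in_rect x y s t z -> ccont J z) ->
  rect_int J x y s t =
    rect_int J x y (s / 2) (t / 2) + rect_int J (x + s / 2) y (s / 2) (t / 2) +
    (rect_int J x (y + t / 2) (s / 2) (t / 2) +
     rect_int J (x + s / 2) (y + t / 2) (s / 2) (t / 2)).
Proof.
move=> s0 t0 H; rewrite /rect_int -!addrA -!splitr.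
rewrite (horiz_halves s0); last by move=> u hu; apply: H; split => //=; lra.
rewrite (horiz_halves s0); last by move=> u hu; apply: H; split => //=; lra.
rewrite (vert_halves t0); last by move=> u hu; apply: H; split => //=; lra.
rewrite (vert_halves t0); last by move=> u hu; apply: H; split => //=; lra.
ring.
Qed.

(* On a small rectangle [J] is affine up to [e * (s + t)], and an affine
   function contributes nothing to the contour integral. *)
Lemma rect_int_affine_bound J x y s t p l e : 0 <= s -> 0 <= t -> 0 <= e ->
  (forall z, in_rect x y s t z -> ccont J z) ->
  (forall z, in_rect x y s t z -> normc (J z - J p - l * (z - p)) <= e * (s + t)) ->
  normc (rect_int J x y s t) <= 4 * e * (s + t) ^+ 2.
Proof.
move=> s0 t0 e0 cJ aff; rewrite /rect_int.
have Hh : normc (horiz J x s y - horiz J x s (y + t) -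
    (- l * Complex 0 t) * ((x + s - x)%:C)%C) <= 2 * (2 * (e * (s + t))) * (x + s - x).
  rewrite /horiz -cintB; last 2 first.
  - by apply: rcont_horiz => u hu; apply: cJ; split => //=; lra.
  - by apply: rcont_horiz => u hu; apply: cJ; split => //=; lra.
  apply: cint_near_cst; first lra.
    by apply: rcont_onB; apply: rcont_horiz => u hu; apply: cJ; split => //=; lra.
  move=> u hu.
  have h1 : in_rect x y s t (Complex u y) by split => //=; lra.
  have h2 : in_rect x y s t (Complex u (y + t)) by split => //=; lra.
  rewrite [X in Normc.normc X](_ : _ = (J (Complex u y) - J p - l * (Complex u y - p)) -
    (J (Complex u (y + t)) - J p - l * (Complex u (y + t) - p)) :> C); last first.
    have -> : Complex 0 t = Complex u (y + t) - Complex u y :> C.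
      by apply: cplx_eq => /=; lra.
    ring.
  rewrite (le_trans (ler_normcB _ _))// mulr2n mulrDl !mul1r.
  by apply: lerD; apply: aff.
have Hv : normc (vert J y t (x + s) - vert J y t x -
    (l * ((s%:C)%C)) * ((y + t - y)%:C)%C) <= 2 * (2 * (e * (s + t))) * (y + t - y).
  rewrite /vert -cintB; last 2 first.
  - by apply: rcont_vert => u hu; apply: cJ; split => //=; lra.
  - by apply: rcont_vert => u hu; apply: cJ; split => //=; lra.
  apply: cint_near_cst; first lra.
    by apply: rcont_onB; apply: rcont_vert => u hu; apply: cJ; split => //=; lra.
  move=> u hu.
  have h1 : in_rect x y s t (Complex (x + s) u) by split => //=; lra.
  have h2 : in_rect x y s t (Complex x u) by split => //=; lra.
  rewrite [X in Normc.normc X](_ : _ = (J (Complex (x + s) u) - J p - l * (Complex (x + s) u - p)) -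
    (J (Complex x u) - J p - l * (Complex x u - p)) :> C); last first.
    have -> : (s%:C)%C = Complex (x + s) u - Complex x u :> C.
      by apply: cplx_eq => /=; lra.
    ring.
  rewrite (le_trans (ler_normcB _ _))// mulr2n mulrDl !mul1r.
  by apply: lerD; apply: aff.
rewrite [X in Normc.normc X](_ : _ =
  (horiz J x s y - horiz J x s (y + t) - (- l * Complex 0 t) * ((x + s - x)%:C)%C) +
  Complex 0 1 * (vert J y t (x + s) - vert J y t x -
    (l * ((s%:C)%C)) * ((y + t - y)%:C)%C) :> C); last first.
  have -> : Complex 0 t = Complex 0 1 * (t%:C)%C :> C by apply: cplx_eq => /=; lra.
  rewrite !(addrC _ s) !(addrC _ t) !addrK; ring.
apply: le_trans (ler_normcD _ _) _.
rewrite normcM (_ : normc (Complex 0 1 : C) = 1) ?mul1r; last first.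
  by rewrite /Normc.normc /= expr0n add0r expr1n sqrtr1.
apply: le_trans (lerD Hh Hv) _.
by rewrite !(addrC _ s) !(addrC _ t) !addrK expr2; lra.
Qed.

Lemma nested_intervals (u v : nat -> R) :
  {homo u : n m / (n <= m)%N >-> n <= m} ->
  {homo v : n m / (n <= m)%N >-> m <= n} ->
  (forall n, u n <= v n) -> exists p, forall n, u n <= p <= v n.
Proof.
move=> iu dv uv.
have uvm n m : u n <= v m.
  case/orP: (leq_total n m) => nm; first by rewrite (le_trans (iu _ _ nm)).
  by rewrite (le_trans (uv _))// dv.
have hs : has_sup (range u).
  by split; [exists (u 0%N), 0%N|exists (v 0%N) => _ [n _ <-]].
exists (sup (range u)) => n; apply/andP; split.
  by apply: (sup_upper_bound hs); exists n.
by apply: ge_sup; [exists (u 0%N), 0%N|move=> _ [m _ <-]].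
Qed.

(** The corner of a quarter rectangle that carries at least a fourth of the contour integral. The
    last quarter is taken untested: by the triangle inequality it qualifies when the other three
    fail. *)
Let quarter J (s t : R) (q : R * R) : R * R :=
  let ok q' := normc (rect_int J q.1 q.2 s t) <=
    4 * normc (rect_int J q'.1 q'.2 (s / 2) (t / 2)) in
  if ok q then q else
  if ok (q.1 + s / 2, q.2) then (q.1 + s / 2, q.2) else
  if ok (q.1, q.2 + t / 2) then (q.1, q.2 + t / 2) else
  (q.1 + s / 2, q.2 + t / 2).

Lemma quarter_spec J s t q : 0 <= s -> 0 <= t ->
  (forall z, in_rect q.1 q.2 s t z -> ccont J z) ->
  let q' := quarter J s t q in
  [/\ q.1 <= q'.1 <= q.1 + s / 2, q.2 <= q'.2 <= q.2 + t / 2 &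
    normc (rect_int J q.1 q.2 s t) <=
    4 * normc (rect_int J q'.1 q'.2 (s / 2) (t / 2))].
Proof.
move=> s0 t0 cJ; have := rect_int_quarters s0 t0 cJ; move=> E; rewrite /quarter.
case: ifPn => [h1|h1] /=; first by split => //; apply/andP; split; lra.
case: ifPn => [h2|h2] /=; first by split => //; apply/andP; split; lra.
case: ifPn => [h3|h3] /=; first by split => //; apply/andP; split; lra.
split; [by apply/andP; split; lra|by apply/andP; split; lra|].
rewrite leNgt; apply/negP => h4.
move: h1 h2 h3; rewrite -!ltNge /= => h1 h2 h3.
have lem (a b1 b2 b3 b4 m1 m2 : R) : 4 * b1 < a -> 4 * b2 < a -> 4 * b3 < a ->
  4 * b4 < a -> a <= m1 + m2 -> m1 <= b1 + b2 -> m2 <= b3 + b4 -> False by lra.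
apply: (lem _ _ _ _ _ _ _ h1 h2 h3 h4 _ (ler_normcD _ _) (ler_normcD _ _)).
by rewrite {1}E; exact: ler_normcD.
Qed.

(** Repeated quartering keeps [4 ^+ n] times the integral at least [c] while the rectangles shrink
    to a point [p]; differentiability at [p] bounds the same quantity by a small multiple of
    [(s + t) ^+ 2]. *)
Theorem goursat J x y s t : 0 <= s -> 0 <= t ->
  (forall z, in_rect x y s t z -> exists l, cderive J z l) ->
  rect_int J x y s t = 0.
Proof.
move=> s0 t0 dJ; apply/eqP; rewrite -normc_eq0; apply/negPn/negP => nz.
have c0 : 0 < normc (rect_int J x y s t) by rewrite lt_neqAle eq_sym nz normc_ge0.
set c := normc _ in c0.
have cJ z : in_rect x y s t z -> ccont J z by move=> /dJ[l]; exact: cderive_continuous.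
pose S n := s / 2 ^+ n; pose T n := t / 2 ^+ n.
pose q := fix q n := if n is m.+1 then quarter J (S m) (T m) (q m) else (x, y).
have p2 n : 0 < 2 ^+ n :> R by rewrite exprn_gt0.
have S0 n : 0 <= S n by rewrite divr_ge0// ltW.
have T0 n : 0 <= T n by rewrite divr_ge0// ltW.
have SS n : S n.+1 = S n / 2 by rewrite /S exprSr invfM mulrA.
have TS n : T n.+1 = T n / 2 by rewrite /T exprSr invfM mulrA.
have inv n : in_rect (q n).1 (q n).2 (S n) (T n) `<=` in_rect x y s t /\
    c <= 4 ^+ n * normc (rect_int J (q n).1 (q n).2 (S n) (T n)).
  elim: n => [|n [IH1 IH2]].
    by rewrite /S /T /= !expr0 !divr1 mul1r; split.
  have [h1 h2 h3] := quarter_spec (S0 n) (T0 n) (fun z hz => cJ z (IH1 z hz)).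
  rewrite SS TS /=; split.
    apply: subset_trans IH1; apply: in_rectS; lra.
  rewrite exprSr -mulrA; apply: le_trans IH2 _; apply: ler_wpM2l; first by rewrite exprn_ge0.
  exact: h3.
have st n : [/\ (q n).1 <= (q n.+1).1, (q n).2 <= (q n.+1).2,
    (q n.+1).1 + S n.+1 <= (q n).1 + S n & (q n.+1).2 + T n.+1 <= (q n).2 + T n].
  have [IH1 _] := inv n.
  have [h1 h2 _] := quarter_spec (S0 n) (T0 n) (fun z hz => cJ z (IH1 z hz)).
  rewrite SS TS /=; split; lra.
have [p1 hp1] : exists p, forall n, (q n).1 <= p <= (q n).1 + S n.
  apply: nested_intervals => [||n]; last by rewrite lerDl.
  - by apply/nondecreasing_seqP => n; have [] := st n.
  - by apply/nonincreasing_seqP => n; have [] := st n.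
have [p2' hp2] : exists p, forall n, (q n).2 <= p <= (q n).2 + T n.
  apply: nested_intervals => [||n]; last by rewrite lerDl.
  - by apply/nondecreasing_seqP => n; have [] := st n.
  - by apply/nonincreasing_seqP => n; have [] := st n.
pose p : C := Complex p1 p2'.
have [l dl] : exists l, cderive J p l.
  by apply: dJ; have [H _] := inv 0%N; apply: H; split.
(* The affine bound, multiplied by [4 ^+ n], is [4 * e * (s + t) ^+ 2], which becomes at most
   [c / 2]; the added 1 keeps the denominator positive for degenerate rectangles. *)
pose e := c / (8 * (s + t + 1) ^+ 2).
have st1 : 0 < s + t + 1 by lra.
have e0 : 0 < e by rewrite divr_gt0// mulr_gt0// exprn_gt0.
have [d d0 hd] := dl e e0.
have [n hn] : exists n, (s + t) / 2 ^+ n < d.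
  have := @cvg_geometric R (s + t) 2^-1.
  rewrite ger0_norm ?invr_ge0// invf_lt1// ltr1n => /(_ isT).
  move=> /cvgrPdist_lt /(_ d d0) [N _ /(_ N (leqnn N))].
  rewrite /= sub0r normrN ger0_norm; last by rewrite mulr_ge0 ?addr_ge0// exprn_ge0.
  by rewrite exprVn => ?; exists N.
have [IH1 IH2] := inv n.
have bnd : normc (rect_int J (q n).1 (q n).2 (S n) (T n)) <= 4 * e * (S n + T n) ^+ 2.
  apply: (@rect_int_affine_bound J _ _ _ _ p l) => //; first exact: ltW.
    by move=> z /IH1; exact: cJ.
  move=> z [hz1 hz2].
  have hzp : normc (z - p) <= S n + T n.
    apply: le_trans (normc_le_ReIm _) _.
    have := hp1 n; have := hp2 n.
    have -> : complex.Re (z - p) = complex.Re z - p1 by case: (z).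
    have -> : complex.Im (z - p) = complex.Im z - p2' by case: (z).
    by move=> hb ha; apply: lerD; rewrite ler_norml; lra.
  have := hd (z - p); rewrite subrKC => H; apply: le_trans (H _) _.
    by apply: le_lt_trans hzp _; rewrite /S /T -mulrDl.
  by rewrite ler_pM2l.
have := le_trans IH2 (ler_wpM2l (exprn_ge0 n (ltW (ltr0Sn R 3))) bnd).
rewrite /S /T -mulrDl expr_div_n -exprM mulnC exprM.
have -> : 2 ^+ 2 = 4 :> R by rewrite expr2; lra.
have q40 : 0 < 4 ^+ n :> R by rewrite exprn_gt0.
have -> : 4 ^+ n * (4 * e * ((s + t) ^+ 2 / 4 ^+ n)) = 4 * e * (s + t) ^+ 2.
  by field; rewrite gt_eqF.
have h2 : (s + t) ^+ 2 <= (s + t + 1) ^+ 2 by rewrite ler_sqr ?nnegrE; lra.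
have : 4 * e * (s + t) ^+ 2 <= 4 * e * (s + t + 1) ^+ 2 by rewrite ler_pM2l// mulr_gt0.
have -> : 4 * e * (s + t + 1) ^+ 2 = c / 2 by rewrite /e; field; rewrite gt_eqF.
lra.
Qed.

End Goursat.

(** * The complex exponential *)

Section ComplexExponential.
Variable R : realType.
Local Notation C := (Cplx R).

Definition cexp (z : C) : C :=
  (expR (complex.Re z))%:C%C * Complex (cos (complex.Im z)) (sin (complex.Im z)).

Lemma normc_cexp z : normc (cexp z) = expR (complex.Re z).
Proof.
rewrite /cexp normcM normc_real ger0_norm ?expR_ge0// /Normc.normc.
by rewrite cos2Dsin2 sqrtr1 mulr1.
Qed.

Lemma cexpD z w : cexp (z + w) = cexp z * cexp w.
Proof.
case: z w => a b [c d]; rewrite /cexp /= expRD cosD sinD.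
by apply: cplx_eq => /=; ring.
Qed.

Lemma real_derive_bound (f : R -> R) (x l e : R) : is_derive x 1 f l -> 0 < e ->
  exists2 d : R, 0 < d &
    forall h, `|h| < d -> `|f (x + h) - f x - l * h| <= e * `|h|.
Proof.
move=> [dfx <-] e0.
move/cvg_ex: (dfx) => [k hk].
have -> : 'D_1 f x = k by exact: cvg_lim hk.
move: hk => /cvgrPdist_le /(_ e e0).
rewrite near_withinE => /nbhs_ballP [d /= d0 H]; exists d => // h hd.
have [->|h0] := eqVneq h 0; first by rewrite addr0 subrr mulr0 subrr normr0 mulr0.
have := H h; rewrite /ball /= sub0r normrN => /(_ hd h0) hk.
have -> : f (x + h) - f x - k * h = - h * (k - h^-1 *: (f (h *: 1 + x) - f x)).
  rewrite scalerDr /GRing.scale /= mulr1 [h + x]addrC; field => //.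
by rewrite normrM normrN mulrC ler_wpM2r.
Qed.

Lemma cderive_cexp0 : cderive cexp 0 1.
Proof.
move=> e e0.
(* Real and imaginary parts of the remainder are at most [3 * r * normc z] each, together at most
   [e * normc z]; [r <= 1] is what gives [expR x <= 2]. *)
pose r := Num.min (e / 8) 1.
have r0 : 0 < r by rewrite lt_min ltr01 divr_gt0.
have r1 : r <= 1 by rewrite ge_min lexx orbT.
have re : r <= e / 8 by rewrite ge_min lexx.
have [d1 d10 h1] := real_derive_bound (is_derive_expR (0 : R)) r0.
have [d2 d20 h2] := real_derive_bound (is_derive_cos (0 : R)) r0.
have [d3 d30 h3] := real_derive_bound (is_derive_sin (0 : R)) r0.
exists (Num.min (Num.min d1 d2) (Num.min d3 (r / 2))).
  by rewrite !lt_min d10 d20 d30 divr_gt0.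
move=> z; rewrite !lt_min => /andP[/andP[z1 z2] /andP[z3 z4]].
rewrite add0r mul1r.
set x := complex.Re z; set y := complex.Im z.
have xz : `|x| <= normc z by exact: Re_le_normc.
have yz : `|y| <= normc z by exact: Im_le_normc.
move: (h1 x (le_lt_trans xz z1)) (h2 y (le_lt_trans yz z2)) (h3 y (le_lt_trans yz z3)).
rewrite !add0r expR0 cos0 sin0 oppr0 mul0r !mul1r !subr0 ?addr0 => ex cy sy.
have -> : cexp 0 = 1 by rewrite /cexp /= expR0 cos0 sin0; apply: cplx_eq => /=; ring.
have E1 : complex.Re (cexp z - 1 - z) = expR x * (cos y - 1) + (expR x - 1 - x).
  by rewrite /cexp /x /y; case: (z) => a b /=; ring.
have E2 : complex.Im (cexp z - 1 - z) = expR x * (sin y - y) + y * (expR x - 1).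
  by rewrite /cexp /x /y; case: (z) => a b /=; ring.
apply: le_trans (normc_le_ReIm _) _; rewrite E1 E2.
have n0 := normc_ge0 z.
have ex1 : `|expR x - 1| <= r.
  have -> : expR x - 1 = (expR x - 1 - x) + x by ring.
  apply: le_trans (ler_normD _ _) _.
  have : r * `|x| <= 1 * `|x| by apply: ler_wpM2r.
  by move: z4 xz ex; lra.
have ex2 : `|expR x| <= 2.
  by rewrite ger0_norm ?expR_ge0//; move: (ler_norm (expR x - 1)); lra.
have A1 : `|expR x * (cos y - 1)| <= 2 * (r * normc z).
  rewrite normrM; apply: ler_pM => //; apply: le_trans cy _.
  by rewrite ler_pM2l.
have A2 : `|expR x - 1 - x| <= r * normc z.
  by apply: le_trans ex _; rewrite ler_pM2l.
have A3 : `|expR x * (sin y - y)| <= 2 * (r * normc z).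
  rewrite normrM; apply: ler_pM => //; apply: le_trans sy _.
  by rewrite ler_pM2l.
have A4 : `|y * (expR x - 1)| <= r * normc z.
  by rewrite normrM mulrC; apply: ler_pM.
have B1 := ler_normD (expR x * (cos y - 1)) (expR x - 1 - x).
have B2 := ler_normD (expR x * (sin y - y)) (y * (expR x - 1)).
have : r * normc z <= e / 8 * normc z by apply: ler_wpM2r.
have : 0 <= e * normc z by rewrite mulr_ge0// ltW.
lra.
Qed.

Lemma cderive_cexp z : cderive cexp z (cexp z).
Proof.
have : cderive (fun w => cexp z * cexp (w - z)) z (cexp z * (1 * (1 - 0))).
  apply: cderiveZ; apply: cderive_comp.
    by apply: cderiveB; [exact: cderive_id|exact: cderive_cst].
  by rewrite subrr; exact: cderive_cexp0.
rewrite subr0 !mulr1; apply: cderive_ext => w.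
by rewrite -cexpD subrKC.
Qed.

End ComplexExponential.

(** * The maximum principle *)

Section MaximumPrinciple.
Variable R : realType.
Local Notation C := (Cplx R).
Implicit Types (f : C -> C) (a z w : C) (M r : R).

(** Taking n-th roots removes the constant [K] as [n] grows. *)
Lemma power_trick (K a M : R) : 0 <= M -> 0 <= a ->
  (forall n, a ^+ n <= K * M ^+ n) -> a <= M.
Proof.
move=> M0 a0 H; rewrite leNgt; apply/negP => Ma.
have a1 : 0 < a by apply: le_lt_trans Ma.
have := @cvg_geometric R K (M / a).
rewrite ger0_norm ?divr_ge0// ltr_pdivrMr// mul1r => /(_ Ma).
move=> /cvgrPdist_lt /(_ 1 ltr01) [N _ /(_ N (leqnn N))].
rewrite /= sub0r normrN => h.
have {}h := le_lt_trans (ler_norm _) h.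
have := H N; rewrite leNgt => /negP; apply.
by rewrite -[ltRHS]mul1r -ltr_pdivrMr ?exprn_gt0// -mulrA -expr_div_n.
Qed.

(** The composite of [f] with [cexp] is analytic on the closed left half plane with period [2 pi i].
    On a rectangle of height [2 pi] the horizontal sides cancel, so the integral over a vertical
    side is independent of its abscissa: it is at most [2 * M * T] on the imaginary axis and close
    to [f 0 * T] far to the left. *)
Lemma mean_value_bound f M : (forall z, normc z <= 1 -> exists l, cderive f z l) ->
  (forall z, normc z = 1 -> normc (f z) <= M) -> normc (f 0) <= 2 * M.
Proof.
move=> df fM.
pose J w := f (cexp w).
have dJ w : complex.Re w <= 0 -> exists l, cderive J w l.
  move=> hw; have [|l hl] := df (cexp w); first by rewrite normc_cexp expR_le1.
  by exists (l * cexp w); apply: cderive_comp hl; exact: cderive_cexp.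
have cJ w : complex.Re w <= 0 -> ccont J w by move=> /dJ[l]; exact: cderive_continuous.
have M0 : 0 <= M by apply: le_trans (normc_ge0 (f 1)) _; apply: fM; rewrite normc1.
pose T := 2 * pi : R.
have T0 : 0 < T by rewrite mulr_gt0// pi_gt0.
have per x : cexp (Complex x (0 + T)) = cexp (Complex x 0) :> C.
  by rewrite /cexp /= add0r /T mulr_natl cos2pi sin2pi cos0 sin0.
have VV s : 0 <= s -> vert J 0 T 0 = vert J 0 T (- s).
  move=> s0; have : rect_int J (- s) 0 s T = 0.
    apply: goursat => //; first exact: ltW.
    by move=> z [/andP[h1 h2] _]; apply: dJ; move: h2; rewrite addNr.
  rewrite /rect_int.
  have -> : horiz J (- s) s (0 + T) = horiz J (- s) s 0.
    by rewrite /horiz /J; congr cint; apply/funext => u; rewrite per.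
  rewrite subrr add0r addNr => /eqP; rewrite mulf_eq0 => /orP[|].
    by rewrite eq_complex /= oner_eq0 andbF.
  by rewrite subr_eq0 => /eqP.
have rcV s : 0 <= s -> rcont_on 0 (0 + T) (fun v => J (Complex (- s) v)).
  by move=> s0; apply: rcont_vert => v _; apply: cJ => /=; rewrite oppr_le0.
have B1 : normc (vert J 0 T 0) <= 2 * M * T.
  have h : normc (vert J 0 T 0 - 0 * ((0 + T - 0)%:C)%C) <= 2 * M * (0 + T - 0).
    apply: cint_near_cst; first lra.
      by have := rcV 0 (lexx 0); rewrite oppr0.
    by move=> v _; rewrite subr0; apply: fM; rewrite normc_cexp /= expR0.
  by move: h; rewrite mul0r subr0 add0r subr0.
apply/ler_addgt0Pr => e e0.
have [l hl] : exists l, cderive f 0 l by apply: df; rewrite normc0.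
have e2 : 0 < e / 2 by rewrite divr_gt0.
have [d d0 hd] := cderive_continuous hl e2.
(* With [expR (- s) < d], the side at abscissa [- s] is mapped by [cexp] into the disc where [f] is
   within [e / 2] of [f 0]. *)
pose s := Num.max 0 (1 - ln d).
have s0 : 0 <= s by rewrite le_max lexx.
have sd : expR (- s) < d.
  rewrite -[ltRHS](lnK d0) ltr_expR.
  have : 1 - ln d <= s by rewrite le_max lexx orbT.
  lra.
have B2 : normc (vert J 0 T (- s) - f 0 * ((0 + T - 0)%:C)%C) <= 2 * (e / 2) * (0 + T - 0).
  apply: cint_near_cst; [lra|exact: rcV|].
  move=> v _; apply: hd; rewrite subr0 normc_cexp //=.
move: B1 B2; rewrite (VV _ s0) add0r subr0 => B1 B2.
have : normc (f 0) * T <= (2 * M + e) * T.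
  have -> : normc (f 0) * T = normc (f 0 * (T%:C)%C) by rewrite normcM normc_real gtr0_norm.
  have := lerB_normcB (f 0 * (T%:C)%C) (vert J 0 T (- s)).
  rewrite normcBC; lra.
by rewrite ler_pM2r.
Qed.

(** For the powers [f ^+ n] the previous bound has the fixed factor 2, which [power_trick]
    removes. *)
Lemma mean_bound f M : (forall z, normc z <= 1 -> exists l, cderive f z l) ->
  (forall z, normc z = 1 -> normc (f z) <= M) -> normc (f 0) <= M.
Proof.
move=> df fM.
have M0 : 0 <= M by apply: le_trans (normc_ge0 (f 1)) _; apply: fM; rewrite normc1.
apply: (@power_trick 2) => //; first exact: normc_ge0.
move=> n; rewrite -normcX.
apply: (@mean_value_bound (fun z => f z ^+ n)).
  by move=> z /df[l hl]; exists (n%:R * f z ^+ n.-1 * l); exact: cderiveX.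
move=> z /fM h; rewrite normcX; apply: lerXn2r => //; rewrite nnegrE//.
exact: normc_ge0.
Qed.

(* Differentiability is only assumed off [p]; there the powers [f ^+ n] are
   multiplied by [z - p], whose influence vanishes as [n] grows. *)
Theorem maximum_principle f a r M p : 0 < r ->
  (forall z, normc (z - a) <= r -> z <> p -> exists l, cderive f z l) ->
  (normc (p - a) <= r -> ccont f p) ->
  (forall z, normc (z - a) = r -> normc (f z) <= M) ->
  forall z, z <> p -> normc (z - a) < r -> normc (f z) <= M.
Proof.
move=> r0 df cf fM z0 z0p hz0.
have M0 : 0 <= M.
  apply: le_trans (normc_ge0 (f (a + (r%:C)%C))) (fM _ _).
  by rewrite addrC addKr normc_real gtr0_norm.
have hzr : normc ((z0 - a) / (r%:C)%C : C) < 1.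
  by rewrite normcM normcV normc_real gtr0_norm// ltr_pdivrMr// mul1r.
set b : C := (z0 - a) / (r%:C)%C in hzr.
have rn0 : (r%:C)%C != 0 :> C by rewrite -normc_gt0 normc_real gtr0_norm.
(* [m] maps the unit disc to the disc of centre [a] and radius [r], circle to circle, and 0 to [z0];
   thus [mean_bound], an estimate at the centre, applies at [z0]. *)
pose m u := a + (r%:C)%C * blaschke b u.
have m0 : m 0 = z0 by rewrite /m blaschke0 /b; field.
have nm u : normc (m u - a) = r * normc (blaschke b u).
  by rewrite /m (addrC a) addrK normcM normc_real gtr0_norm.
have dm u : normc u <= 1 -> exists l, cderive m u l.
  move=> u1; eexists; apply: cderiveD; first exact: cderive_cst.
  by apply: cderiveZ; exact: cderive_blaschke.
have key g K : (forall z, normc (z - a) <= r -> exists l, cderive g z l) ->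
    (forall z, normc (z - a) = r -> normc (g z) <= K) -> normc (g z0) <= K.
  move=> dg gK; rewrite -m0; apply: (@mean_bound (fun u => g (m u))).
    move=> u u1; have [l hl] := dm u u1.
    have [|k hk] := dg (m u); first by rewrite nm ler_piMr ?(ltW r0) ?blaschke_le1.
    by exists (k * l); exact: cderive_comp hl hk.
  by move=> u u1; apply: gK; rewrite nm blaschke_eq1 ?mulr1.
have zp0 : 0 < normc (z0 - p) by rewrite normc_gt0 subr_eq0; apply/eqP.
(* The numerator bounds the factor [z - p] on the circle, the denominator is its modulus at [z0]. *)
apply: (@power_trick ((r + normc (p - a)) / normc (z0 - p))) => //; first exact: normc_ge0.
move=> n; rewrite mulrAC ler_pdivlMr// -normcX -normcM.
apply: (key (fun z => f z ^+ n * (z - p))).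
  move=> z hz; have [zp|/eqP zp] := eqVneq z p.
    exists (f p ^+ n); apply/cderive_quotient; exists (fun w => f w ^+ n).
    split; first 2 last.
    - by apply: cnearW => w; rewrite zp subrr mulr0 add0r.
    - by rewrite zp; apply: ccontX; apply: cf; rewrite -zp.
    - by rewrite zp.
  have [l hl] := df z hz zp.
  eexists; apply: cderiveM; first exact: cderiveX hl.
  by apply: cderiveB; [exact: cderive_id|exact: cderive_cst].
move=> z hz; rewrite normcM mulrC normcX; apply: ler_pM; rewrite ?exprn_ge0 ?normc_ge0//.
  by rewrite (le_trans (normc_distD a _ _))// hz lerD2l normcBC.
by apply: lerXn2r; rewrite ?nnegrE ?normc_ge0//; exact: fM.
Qed.

End MaximumPrinciple.

(** * Positive minima of the modulus on a circle *)

Section CircleMinimum.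
Variable R : realType.
Local Notation C := (Cplx R).

(** The upper ([s = 1]) and lower ([s = -1]) half circles as graphs over [[-1, 1]], to which the
    extreme value theorem for a real variable applies. *)
Let arc (s t : R) : C := Complex t (s * Num.sqrt (1 - t ^+ 2)).

Lemma rcont_arc (a : C) (r s t : R) : rcont (fun t => a + (r%:C)%C * arc s t) t.
Proof.
move=> e e0.
pose k := `|r| * (1 + `|s|) + 1.
have k0 : 0 < k by rewrite ltr_wpDl// mulr_ge0// addr_ge0.
have ek : 0 < e / k by rewrite divr_gt0.
have cs : {for t, continuous (fun t : R => Num.sqrt (1 - t ^+ 2))}.
  apply: (continuous_comp (f := fun t : R => 1 - t ^+ 2)); last exact: sqrt_continuous.
  by apply: cvgB; [exact: cvg_cst|exact: exprn_continuous].
have cs' : (fun t : R => Num.sqrt (1 - t ^+ 2)) x @[x --> t] --> Num.sqrt (1 - t ^+ 2).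
  exact: cs.
move/cvgrPdist_le : cs' => /(_ _ ek) /nbhs_ballP[d /= d0 hd].
exists (Num.min d (e / k)); first by rewrite lt_min d0.
move=> u; rewrite lt_min => /andP[ud ue].
have {hd} h := hd u; rewrite /ball /= distrC in h; move: (h ud); rewrite distrC => {}h.
rewrite [X in Normc.normc X](_ : _ = (r%:C)%C * (arc s u - arc s t) :> C); last by ring.
rewrite normcM normc_real.
have h2 : normc (arc s u - arc s t) <= (1 + `|s|) * (e / k).
  apply: le_trans (normc_le_ReIm _) _; rewrite mulrDl mul1r; apply: lerD.
    exact: ltW ue.
  rewrite /arc /= -mulrBr normrM.
  by apply: ler_wpM2l.
apply: le_trans (ler_wpM2l (normr_ge0 r) h2) _.
rewrite mulrA mulrCA ger_pMr// ler_pdivrMr// mul1r /k; lra.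
Qed.

Lemma circle_arc (z : C) : normc z = 1 -> exists2 t, -1 <= t <= 1 & z = arc 1 t \/ z = arc (-1) t.
Proof.
move=> z1; have h : complex.Re z ^+ 2 + complex.Im z ^+ 2 = 1.
  by rewrite -normc_sqr z1 expr1n.
exists (complex.Re z).
  by rewrite -ler_norml (le_trans (Re_le_normc z))// z1.
have E : 1 - complex.Re z ^+ 2 = complex.Im z ^+ 2 by lra.
rewrite /arc E sqrtr_sqr; case: (ger0P (complex.Im z)) => h0; [left|right].
  by apply: cplx_eq => /=; rewrite ?mul1r.
by apply: cplx_eq => /=; rewrite ?mulN1r ?opprK.
Qed.

Lemma circle_min (f : C -> C) (a : C) (r : R) : 0 < r ->
  (forall z, normc (z - a) = r -> ccont f z) ->
  (forall z, normc (z - a) = r -> f z != 0) ->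
  exists2 m : R, 0 < m & forall z, normc (z - a) = r -> m <= normc (f z).
Proof.
move=> r0 cf f0.
have narc s t : s ^+ 2 = 1 -> -1 <= t <= 1 -> normc (a + (r%:C)%C * arc s t - a) = r.
  move=> s1 /andP[t1 t2]; rewrite addrAC subrr add0r normcM normc_real gtr0_norm//.
  rewrite -[RHS]mulr1; congr (_ * _); apply/eqP.
  rewrite -(@eqrXn2 _ 2)// ?normc_ge0// normc_sqr /= exprMn sqr_sqrtr; last first.
    by rewrite subr_ge0 expr2; nra.
  by apply/eqP; rewrite s1; ring.
have H s : s ^+ 2 = 1 -> exists2 m : R, 0 < m &
    forall t, -1 <= t <= 1 -> m <= normc (f (a + (r%:C)%C * arc s t)).
  move=> s1.
  have h11 : -1 <= 1 :> R by lra.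
  have [|c c1 hc] := @EVT_min R (fun t => normc (f (a + (r%:C)%C * arc s t))) (-1) 1 h11.
    apply: within_real_continuous => t ht e e0.
    have [d d0 hd] := cf _ (narc s t s1 ht) e e0.
    have d2 : 0 < d / 2 by rewrite divr_gt0.
    have [d' d'0 hd'] := rcont_arc a r s t d2.
    exists d' => // u /hd' hu; apply: le_trans (hd _ _); last by apply: le_lt_trans hu _; lra.
    rewrite ler_norml; have := lerB_normcB (f (a + (r%:C)%C * arc s u)) (f (a + (r%:C)%C * arc s t)).
    have := lerB_normcB (f (a + (r%:C)%C * arc s t)) (f (a + (r%:C)%C * arc s u)).
    rewrite normcBC; lra.
  exists (normc (f (a + (r%:C)%C * arc s c))).
    by rewrite normc_gt0; apply: f0; apply: narc => //; move: c1; rewrite in_itv.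
  by move=> t ht; apply: hc; rewrite in_itv.
have [m1 m10 h1] : exists2 m : R, 0 < m &
    forall t, -1 <= t <= 1 -> m <= normc (f (a + (r%:C)%C * arc 1 t)).
  by apply: H; rewrite expr1n.
have [m2 m20 h2] : exists2 m : R, 0 < m &
    forall t, -1 <= t <= 1 -> m <= normc (f (a + (r%:C)%C * arc (-1) t)).
  by apply: H; rewrite sqrrN expr1n.
exists (Num.min m1 m2); first by rewrite lt_min m10.
move=> z zr; have rn0 : (r%:C)%C != 0 :> C by rewrite -normc_gt0 normc_real gtr0_norm.
have [|t ht ez] := @circle_arc ((z - a) / (r%:C)%C).
  by rewrite normcM normcV normc_real gtr0_norm// zr divff// gt_eqF.
have -> : z = a + (r%:C)%C * ((z - a) / (r%:C)%C) by field.
by case: ez => ->; rewrite ge_min; apply/orP; [left; exact: h1|right; exact: h2].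
Qed.

End CircleMinimum.

(** * Injective analytic functions and the Schwarz lemma *)

Section Automorphisms.
Variable R : realType.
Local Notation C := (Cplx R).
Implicit Types (f g phi : C -> C) (a z w : C).

Lemma Hol_cderive f z : Hol f -> normc z < 1 -> exists l, cderive f z l.
Proof. by move=> Hf z1; apply/derivable_cderive; exact: Hf. Qed.

Lemma minimum_principle f a r m : 0 < r ->
  (forall z, normc (z - a) <= r -> exists l, cderive f z l) ->
  (forall z, normc (z - a) <= r -> f z != 0) -> 0 < m ->
  (forall z, normc (z - a) = r -> m <= normc (f z)) -> m <= normc (f a).
Proof.
move=> r0 df f0 m0 fm.
have fa0 : 0 < normc (f a) by rewrite normc_gt0 f0// subrr normc0 ltW.
rewrite -[leLHS]invrK -[leRHS]invrK lef_pV2 ?posrE ?invr_gt0//.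
(* [maximum_principle] asks for an exceptional point; this one lies outside the closed disc. *)
pose p : C := a + ((2 * r)%:C)%C.
have hp : normc (p - a) = 2 * r.
  by rewrite /p addrAC subrr add0r normc_real gtr0_norm// mulr_gt0.
rewrite -normcV; apply: (@maximum_principle _ (fun z => (f z)^-1) a r _ p) => //.
- move=> z hz _; have [l hl] := df z hz.
  by eexists; apply: cderiveV hl _; exact: f0.
- by rewrite hp; lra.
- by move=> z hz; rewrite normcV lef_pV2 ?posrE ?fm// normc_gt0 f0// hz.
- by move=> E; move: hp; rewrite -E subrr normc0; lra.
- by rewrite subrr normc0.
Qed.

(** Injectivity gives [|f - f a| >= m > 0] on the circle. If some [w] within [m / 2] of [f a] were
    missed, [f - w] would have no zero, and the minimum principle would carry the bound [m / 2] from
    the circle to the centre. *)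
Lemma injective_open f a r : 0 < r -> (forall z, normc (z - a) <= r -> normc z < 1) ->
  (forall z, normc z < 1 -> exists l, cderive f z l) ->
  (forall z w, normc z < 1 -> normc w < 1 -> f z = f w -> z = w) ->
  exists2 d : R, 0 < d & forall w, normc (w - f a) < d ->
    exists2 z, normc (z - a) <= r & f z = w.
Proof.
move=> r0 rD df fi; have aD : normc a < 1 by apply: rD; rewrite subrr normc0 ltW.
have [m m0 hm] : exists2 m : R, 0 < m &
    forall z, normc (z - a) = r -> m <= normc (f z - f a).
  apply: (@circle_min _ (fun z => f z - f a)) => // z hz.
    apply: ccontD; last exact: ccont_cst.
    by have [|l hl] := df z; [apply: rD; rewrite hz|exact: cderive_continuous hl].
  rewrite subr_eq0; apply/eqP => E; have := fi z a; rewrite rD ?hz// => /(_ isT aD E) za.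
  by move: hz; rewrite za subrr normc0; lra.
exists (m / 2); first by rewrite divr_gt0.
move=> w hw; apply: contrapT => nz.
have m2 : 0 < m / 2 by rewrite divr_gt0.
have : m / 2 <= normc (f a - w).
  apply: (@minimum_principle (fun z => f z - w) a r) => //.
  - move=> z hz; have [l hl] := df z (rD _ hz).
    by eexists; apply: cderiveB hl (cderive_cst _ _).
  - by move=> z hz; rewrite subr_eq0; apply/eqP => E; apply: nz; exists z.
  - move=> z /hm h; have := lerB_normcB (f z - f a) (w - f a).
    have -> : f z - f a - (w - f a) = f z - w by ring.
    lra.
by rewrite normcBC; lra.
Qed.

(** A zero derivative survives conjugation, so where [f'] vanishes [|f - f a|^2] is differentiable
    too and the minimum principle can be applied to it. *)
Lemma cderive_conj0 f z : cderive f z 0 -> cderive (fun w => (f w)^*%C) z 0.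
Proof.
move=> H e e0; have [d d0 hd] := H e e0; exists d => // h /hd.
by rewrite !mul0r !subr0 -rmorphB normc_conj.
Qed.

(** Suppose [f'(a) = 0], and take [z] close to [a] with [f'(z)] nonzero. The quotient
    [(w - z) / (f w - f z)] extends continuously to [z] and is at most [4 * R0 / m] on the circle,
    hence also at [a]; but [f'(a) = 0] makes [|f a - f z|] too small compared with [|a - z|]. *)
Lemma injective_cderive_neq0 f a l : normc a < 1 ->
  (forall z, normc z < 1 -> exists l, cderive f z l) ->
  (forall z w, normc z < 1 -> normc w < 1 -> f z = f w -> z = w) ->
  cderive f a l -> l != 0.
Proof.
move=> aD df fi fa; apply/eqP => l0; rewrite {}l0 in fa.
pose R0 := (1 - normc a) / 2.
have R00 : 0 < R0 by rewrite divr_gt0// subr_gt0.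
have hD z : normc (z - a) <= R0 -> normc z < 1.
  move=> h; rewrite -(subrK a z); apply: le_lt_trans (ler_normcD _ _) _.
  by move: h; rewrite /R0; lra.
have min r : 0 < r -> r <= R0 -> exists2 m : R, 0 < m &
    forall z, normc (z - a) = r -> m <= normc (f z - f a).
  move=> r0 rR; apply: (@circle_min _ (fun z => f z - f a)) => // z hz.
    apply: ccontD; last exact: ccont_cst.
    by have [|k hl] := df z; [apply: hD; rewrite hz|exact: cderive_continuous hl].
  rewrite subr_eq0; apply/eqP => E; have := fi z a; rewrite hD ?hz// => /(_ isT aD E) za.
  by move: hz; rewrite za subrr normc0; lra.
have near_neq0 d : 0 < d -> exists z k, [/\ normc (z - a) < d, z != a, cderive f z k & k != 0].
  move=> d0; apply: contrapT => nz.
  pose r := Num.min (d / 2) R0.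
  have r0 : 0 < r by rewrite lt_min R00 divr_gt0.
  have rR : r <= R0 by rewrite ge_min lexx orbT.
  have rd : r < d by have : r <= d / 2 by [rewrite ge_min lexx|]; lra.
  have all0 z : normc (z - a) <= r -> cderive f z 0.
    move=> hz; have [->//|za] := eqVneq z a.
    have [k hk] := df z (hD z (le_trans hz rR)).
    have [<-//|k0] := eqVneq k 0; case: nz; exists z, k; split=> //.
    exact: le_lt_trans hz rd.
  have [m m0 hm] := min r r0 rR.
  (* If [f'] vanished on the whole disc, [1 + |f - f a|^2] would be analytic without zeros, at least
     [1 + m ^+ 2] on the circle but 1 at the centre. *)
  pose g z := 1 + (f z - f a) * ((f z - f a)^*)%C.
  have gE z : g z = ((1 + normc (f z - f a) ^+ 2)%:C)%C.
    by rewrite /g mul_conjE rmorphD rmorph1.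
  have gn z : normc (g z) = 1 + normc (f z - f a) ^+ 2.
    by rewrite gE normc_real ger0_norm// addr_ge0// exprn_ge0// normc_ge0.
  have dg z : normc (z - a) <= r -> exists l, cderive g z l.
    move=> /all0 hz.
    have h1 : cderive (fun w => f w - f a) z 0.
      by have := cderiveB hz (cderive_cst (f a) z); rewrite subrr.
    exists (0 + (0 * ((f z - f a)^*)%C + (f z - f a) * 0)).
    apply: cderiveD; first exact: cderive_cst.
    by apply: cderiveM => //; exact: cderive_conj0.
  have : 1 + m ^+ 2 <= normc (g a).
    apply: (minimum_principle r0 dg).
    - move=> z _; rewrite -normc_gt0 gn ltr_wpDr ?exprn_ge0 ?normc_ge0//.
    - by rewrite ltr_wpDr ?exprn_ge0// ltW.
    - move=> z /hm h; rewrite gn lerD2l; apply: lerXn2r => //; rewrite nnegrE ?normc_ge0//.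
      exact: ltW.
  rewrite gn subrr normc0 expr0n addr0.
  by have : 0 < m ^+ 2 by [rewrite exprn_gt0|]; lra.
have [m m0 hm] := min R0 R00 (lexx _).
(* Multiplied by the bound [4 * R0 / m] on the quotient, this tolerance gives 1/4, hence
   [|z - a| <= |z - a| / 4]. *)
have em : 0 < m / (16 * R0) by rewrite divr_gt0// mulr_gt0.
have [d1 d10 h1] := fa _ em.
have m2 : 0 < m / 2 by rewrite divr_gt0.
have [d2 d20 h2] := cderive_continuous fa m2.
have [|z [k [zd za fz k0]]] := near_neq0 (Num.min (Num.min d1 d2) R0).
  by rewrite !lt_min d10 d20.
move: zd; rewrite !lt_min => /andP[/andP[zd1 zd2] zR].
have zD : normc z < 1 by apply: hD; exact: ltW.
have {h1} := h1 (z - a) zd1; rewrite subrKC mul0r subr0 => h1.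
have {h2} h2 := h2 z zd2.
pose g w := if w == z then k^-1 else (w - z) / (f w - f z).
have fwz w : normc w < 1 -> w <> z -> f w - f z != 0.
  by move=> wD wz; rewrite subr_eq0; apply/eqP => /(fi _ _ wD zD).
have : normc (g a) <= 4 * R0 / m.
  apply: (@maximum_principle _ g a R0 _ z) => //.
  - move=> w hw wz.
    have wD := hD _ hw; have [lw hlw] := df w wD.
    have h3 : cderive (fun u => (u - z) / (f u - f z)) w
       ((1 - 0) / (f w - f z) + (w - z) * (- (lw - 0) / (f w - f z) ^+ 2)).
      apply: cderiveM.
        by apply: cderiveB; [exact: cderive_id|exact: cderive_cst].
      by apply: cderiveV; [apply: cderiveB hlw (cderive_cst _ _)|exact: fwz].
    eexists; apply: cderive_near h3.
    have wz0 : 0 < normc (w - z) by rewrite normc_gt0 subr_eq0; apply/eqP.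
    exists (normc (w - z)) => // u hu; rewrite /g ifF//; apply/negbTE/eqP => uz.
    by move: hu; rewrite uz normcBC ltxx.
  - move=> _; have /cderive_quotient[q [cq qz hq]] := fz.
    have q0 : q z != 0 by rewrite qz.
    apply: (@ccont_near _ (fun w => (q w)^-1)); last exact: ccontV.
    apply: cnearS (cnearI hq (ccont_neq0 cq q0)) => w [E hw].
    have qw0 : q w != 0.
      by rewrite -normc_gt0; apply: lt_le_trans hw; rewrite divr_gt0// normc_gt0.
    rewrite /g; case: eqP => [->|/eqP wz]; first by rewrite qz.
    have wz0 : w - z != 0 by rewrite subr_eq0.
    have -> : f w - f z = q w * (w - z) by rewrite E; ring.
    by rewrite invfM mulrCA divff// mulr1.
  - move=> w hw; have wz : w <> z by move=> E; move: zR; rewrite -E hw ltxx.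
    rewrite /g ifF; last exact/negbTE/eqP.
    have h3 : m / 2 <= normc (f w - f z).
      have := lerB_normcB (f w - f a) (f z - f a).
      have -> : f w - f a - (f z - f a) = f w - f z by ring.
      have := hm w hw; lra.
    have h4 : normc (w - z) <= 2 * R0.
      have := normc_distD a w z; rewrite hw normcBC => h5.
      by move: (ltW zR); rewrite normcBC (normcBC z a) in h5 *; lra.
    have pos : 0 < normc (f w - f z) by apply: lt_le_trans h3.
    rewrite normcM normcV ler_pdivrMr//.
    have -> : 4 * R0 / m * normc (f w - f z) = 2 * R0 * (normc (f w - f z) * 2 / m).
      by field; rewrite gt_eqF.
    apply: le_trans h4 _; rewrite -[leLHS]mulr1; apply: ler_wpM2l; first by lra.
    by rewrite ler_pdivlMr// mul1r; lra.
  - by move=> E; move: za; rewrite E eqxx.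
  - by rewrite subrr normc0.
have az : a != z by rewrite eq_sym.
rewrite /g (negbTE az) normcM normcV ler_pdivrMr; last first.
  by rewrite normc_gt0; apply: fwz => //; apply/eqP.
rewrite (normcBC (f a)) (normcBC a) => h3.
have zap : 0 < normc (z - a) by rewrite normc_gt0 subr_eq0.
have : normc (z - a) <= normc (z - a) / 4.
  apply: le_trans h3 _.
  have -> : normc (z - a) / 4 = 4 * R0 / m * (m / (16 * R0) * normc (z - a)).
    by field; rewrite !gt_eqF.
  by rewrite ler_pM2l// divr_gt0// mulr_gt0.
lra.
Qed.

(** The quotient [g w / w], with value [g'(0)] at 0, is continuous at 0. With 0 as exceptional
    point, the maximum principle on radius [r] bounds it by [r^-1], and [r] tends to 1. *)
Lemma schwarz g : (forall z, normc z < 1 -> exists l, cderive g z l) ->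
  (forall z, normc z < 1 -> normc (g z) <= 1) -> g 0 = 0 ->
  forall z, normc z < 1 -> normc (g z) <= normc z.
Proof.
move=> dg gD g0 z zD.
have [->|z0] := eqVneq z 0; first by rewrite g0.
have [l hl] : exists l, cderive g 0 l by apply: dg; rewrite normc0.
pose f w := if w == 0 then l else g w / w.
have key r : normc z < r -> r < 1 -> normc (f z) <= r^-1.
  move=> zr r1; have r0 : 0 < r by apply: le_lt_trans zr; exact: normc_ge0.
  apply: (@maximum_principle _ f 0 r _ 0) => //.
  - move=> w; rewrite subr0 => wr w0; have w0' : w != 0 by apply/eqP.
    have [|k hk] := dg w; first exact: le_lt_trans wr r1.
    eexists; apply: cderive_near (cderiveM hk (cderiveV (cderive_id w) w0')).
    exists (normc w); first by rewrite normc_gt0.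
    move=> u hu; rewrite /f ifF//; apply/negbTE/eqP => u0.
    by move: hu; rewrite u0 sub0r normcN ltxx.
  - move=> _ e e0; have [d d0 hd] := hl e e0; exists d => // w; rewrite subr0 => wd.
    rewrite /f eqxx; case: eqP => [_|/eqP w0]; first by rewrite subrr normc0 ltW.
    have := hd w wd; rewrite add0r g0 subr0.
    have -> : g w - l * w = (g w / w - l) * w by field.
    by rewrite normcM ler_pM2r// normc_gt0.
  - move=> w; rewrite subr0 => wr; rewrite /f ifF; last first.
      by apply/negbTE; rewrite -normc_gt0 wr.
    rewrite normcM normcV wr -[leRHS]mul1r ler_pM2r ?invr_gt0//.
    by apply: gD; rewrite wr.
  - exact/eqP.
  - by rewrite subr0.
have fz : normc (f z) = normc (g z) / normc z by rewrite /f (negbTE z0) normcM normcV.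
have nz0 : 0 < normc z by rewrite normc_gt0.
rewrite -[leRHS]mul1r -ler_pdivrMr// -fz.
apply/ler_addgt0Pr => e e0.
(* This radius lies strictly between [normc z] and 1 and satisfies [r^-1 <= 1 + e]. *)
pose r := Num.max ((1 + normc z) / 2) (1 + e)^-1.
have e1 : 0 < 1 + e by rewrite addr_gt0.
have r1 : r < 1 by rewrite gt_max invf_lt1// ltrDl e0 andbT; lra.
have zr : normc z < r by rewrite lt_max; apply/orP; left; lra.
apply: le_trans (key r zr r1) _.
rewrite -[leRHS]invrK lef_pV2 ?posrE ?invr_gt0//; last exact: lt_trans zr.
by rewrite le_max lexx orbT.
Qed.

Lemma schwarz_pick g : (forall z, normc z < 1 -> exists l, cderive g z l) ->
  (forall z, normc z < 1 -> normc (g z) < 1) ->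
  forall z a, normc z < 1 -> normc a < 1 ->
  normc (blaschke (g a) (g z)) <= normc (blaschke a z).
Proof.
move=> dg gD z a zD aD.
pose h u := blaschke (g a) (g (blaschke a u)).
have -> : blaschke (g a) (g z) = h (blaschke a z) by rewrite /h blaschkeK// ltW.
have gaD := gD _ aD.
apply: schwarz; last exact: blaschke_lt1.
- move=> u uD; have h1 := cderive_blaschke aD (ltW uD).
  have h2 := blaschke_lt1 aD uD.
  have [k hk] := dg _ h2; have h3 := cderive_blaschke gaD (ltW (gD _ h2)).
  eexists; apply: (cderive_comp (f := blaschke (g a)) _ h3).
  exact: cderive_comp h1 hk.
- by move=> u uD; apply: blaschke_le1 => //; apply/ltW/gD/blaschke_lt1.
- by rewrite /h blaschke0 blaschke_id.
Qed.

(** The difference quotient is [k] along the real axis and [- k] along the imaginary axis; [l]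
    cannot be within [|k| / 2] of both. *)
Lemma conj_not_cderive (k l : C) : k != 0 -> ~ cderive (fun w => k * (w^*)%C) 0 l.
Proof.
move=> k0 H; have kn : 0 < normc k by rewrite normc_gt0.
have e0 : 0 < normc k / 2 by rewrite divr_gt0.
have [d d0 hd] := H _ e0.
have d2 : 0 < d / 2 by rewrite divr_gt0.
have n1 : normc (((d / 2)%:C)%C : C) = d / 2 by rewrite normc_real gtr0_norm.
have n2 : normc (Complex 0 (d / 2) : C) = d / 2.
  by rewrite /Normc.normc /= expr0n add0r sqrtr_sqr gtr0_norm.
have := hd ((d / 2)%:C)%C; have := hd (Complex 0 (d / 2)).
rewrite n1 n2 !add0r conjc0 mulr0 !subr0 => h2 h1.
have {}h1 : normc (k - l) <= normc k / 2.
  have := h1 ltac:(lra); rewrite conjc_real -mulrBl normcM n1 ler_pM2r//.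
have {}h2 : normc (k + l) <= normc k / 2.
  have := h2 ltac:(lra).
  have -> : k * (Complex 0 (d / 2))^*%C - l * Complex 0 (d / 2) =
     - (k + l) * Complex 0 (d / 2) :> C.
    have -> : (Complex 0 (d / 2))^*%C = - Complex 0 (d / 2) :> C.
      by apply: cplx_eq => /=; rewrite ?oppr0.
    ring.
  by rewrite normcM normcN n2 ler_pM2r.
have := ler_normcD (k - l) (k + l).
have -> : k - l + (k + l) = 2%:R * k by ring.
rewrite normcM normc_nat; lra.
Qed.

End Automorphisms.

(** * Automorphisms of the disc are Blaschke factors composed with rotations *)

Section AutDisc.
Variable R : realType.
Local Notation C := (Cplx R).
Implicit Types (f g phi chi : C -> C) (a z w : C).

(** [injective_open] makes the inverse continuous; its slope is then the inverse of the slope of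
    [phi], nonzero by [injective_cderive_neq0]. *)
Lemma inverse_cderive phi chi : (forall z, normc z < 1 -> exists l, cderive phi z l) ->
  (forall z w, normc z < 1 -> normc w < 1 -> phi z = phi w -> z = w) ->
  (forall w, normc w < 1 -> normc (chi w) < 1) ->
  (forall w, normc w < 1 -> phi (chi w) = w) ->
  forall w, normc w < 1 -> exists l, cderive chi w l.
Proof.
move=> dphi iphi chiD phiK w wD; set a := chi w.
have aD : normc a < 1 by exact: chiD.
have [l hl] := dphi a aD.
have l0 := injective_cderive_neq0 aD dphi iphi hl.
have disc : cnear w (fun u => normc u < 1).
  exists (1 - normc w); first by rewrite subr_gt0.
  move=> u hu; rewrite -(subrK w u); apply: le_lt_trans (ler_normcD _ _) _; lra.
have cchi : ccont chi w.
  move=> e e0; pose r := Num.min e ((1 - normc a) / 2).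
  have r0 : 0 < r by rewrite lt_min e0 divr_gt0// subr_gt0.
  have re : r <= e by rewrite ge_min lexx.
  have ra : r <= (1 - normc a) / 2 by rewrite ge_min lexx orbT.
  have rD z : normc (z - a) <= r -> normc z < 1.
    move=> h; rewrite -(subrK a z); apply: le_lt_trans (ler_normcD _ _) _; lra.
  have [d d0 hd] := injective_open r0 rD dphi iphi.
  rewrite /a phiK// in hd.
  apply: cnearS (cnearI disc (ex_intro2 _ _ d d0 hd)) => u [uD [z zr zu]].
  have -> : chi u = z by apply: iphi; [exact: chiD|exact: rD|rewrite phiK].
  exact: le_trans zr re.
have [q [cq qa hq]] := proj1 (cderive_quotient _ _ _) hl.
exists l^-1; apply/cderive_quotient; exists (fun u => (q (chi u))^-1); split.
- by apply: ccontV; [exact: ccont_comp cchi cq|rewrite -/a qa].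
- by rewrite -/a qa.
- have q0 : q (chi w) != 0 by rewrite -/a qa.
  have := ccont_neq0 (ccont_comp cchi cq) q0.
  move=> /(cnearI (cnear_comp cchi hq)) /(cnearI disc).
  apply: cnearS => u [uD [E hu]].
  have qu0 : q (chi u) != 0.
    by rewrite -normc_gt0; apply: lt_le_trans hu; rewrite divr_gt0// normc_gt0.
  apply: (mulfI qu0); rewrite mulrDr mulVKf//.
  have -> : u - w = q (chi u) * (chi u - chi w).
    by move: E; rewrite !phiK// => E; apply/eqP; rewrite subr_eq addrC -E.
  by ring.
Qed.

Lemma AutP phi : Aut phi -> exists chi, [/\
  forall w, normc w < 1 -> exists l, cderive chi w l,
  forall w, normc w < 1 -> normc (chi w) < 1,
  forall w, normc w < 1 -> phi (chi w) = w &
  forall z, normc z < 1 -> normc (phi z) < 1 /\ chi (phi z) = z].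
Proof.
move=> [hol inj im].
have dphi z : normc z < 1 -> exists l, cderive phi z l by exact: Hol_cderive.
have sur w : exists z, normc w < 1 -> normc z < 1 /\ phi z = w.
  have [wD|wD] := boolP (normc w < 1); last by exists 0.
  have : (phi @` @unit_disc R) w by rewrite im.
  by move=> [z zD E]; exists z => _; split.
have [chi hchi] := choice sur.
have h1 w : normc w < 1 -> normc (chi w) < 1 by move=> /hchi[].
have h2 w : normc w < 1 -> phi (chi w) = w by move=> /hchi[].
have h3 z : normc z < 1 -> normc (phi z) < 1.
  by move=> zD; have : @unit_disc R (phi z) by [rewrite -im; exists z|].
exists chi; split=> //; first exact: inverse_cderive h2.
by move=> z zD; split; [exact: h3|apply: inj; rewrite /unit_disc /= ?h2 ?h1 ?h3].
Qed.

(** The moduli and the pseudo-hyperbolic distance determine [|1 - conj a z|], and expanding its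
    square isolates the real inner product. *)
Lemma blaschke_dist_conj a z a' z' : normc a < 1 -> normc z < 1 ->
  normc a' = normc a -> normc z' = normc z ->
  normc (blaschke a' z') = normc (blaschke a z) ->
  complex.Re ((a'^*)%C * z') = complex.Re ((a^*)%C * z).
Proof.
move=> aD zD ea ez E.
have a'D : normc a' < 1 by rewrite ea.
have z'D : normc z' < 1 by rewrite ez.
have h1 := blaschke_1Bnorm aD (ltW zD); have h2 := blaschke_1Bnorm a'D (ltW z'D).
rewrite E h1 ea ez in h2.
have pos : 0 < (1 - normc a ^+ 2) * (1 - normc z ^+ 2).
  by rewrite mulr_gt0// -normc_lt1P.
have d1 := blaschke_den_gt0 aD (ltW zD); have d2 := blaschke_den_gt0 a'D (ltW z'D).
have h3 : normc (1 - (a^*)%C * z) ^+ 2 = normc (1 - (a'^*)%C * z') ^+ 2.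
  by apply: invr_inj; apply: (mulfI (lt0r_neq0 pos)).
have expand (u v : C) : normc (1 - (u^*)%C * v) ^+ 2 =
    1 - 2 * complex.Re ((u^*)%C * v) + normc u ^+ 2 * normc v ^+ 2.
  by rewrite !normc_sqr; case: u v => u1 u2 [v1 v2] /=; ring.
move: h3; rewrite !expand ea ez; lra.
Qed.

(** [g] preserves real inner products on the disc. After a rotation it fixes 1/2, hence all real
    parts; the image of [i / 2] then leaves only the identity and conjugation, and conjugation is
    not differentiable at 0. *)
Lemma isometry_rotation g l : cderive g 0 l ->
  (forall z, normc z < 1 -> normc (g z) = normc z) ->
  (forall z a, normc z < 1 -> normc a < 1 ->
    normc (blaschke (g a) (g z)) = normc (blaschke a z)) ->
  exists2 k : C, normc k = 1 & forall z, normc z < 1 -> g z = k * z.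
Proof.
move=> dg gn giso.
have ip z a : normc z < 1 -> normc a < 1 ->
    complex.Re (((g a)^*)%C * g z) = complex.Re ((a^*)%C * z).
  by move=> zD aD; apply: blaschke_dist_conj; rewrite ?gn ?giso.
pose h : C := ((1 / 2)%:C)%C; pose k := 2%:R * g h.
have hn : normc h = 1 / 2 by rewrite normc_real gtr0_norm.
have hD : normc h < 1 by rewrite hn; lra.
have kn : normc k = 1 by rewrite normcM normc_nat gn// hn; lra.
have kk : (k^*)%C * k = 1 by rewrite mulrC mul_conjE kn expr1n.
pose f z := (k^*)%C * g z.
have fn z : normc z < 1 -> normc (f z) = normc z.
  by move=> zD; rewrite normcM normc_conj kn mul1r gn.
have gf z : g z = k * f z by rewrite /f mulrA (mulrC k) kk mul1r.
have fip z a : normc z < 1 -> normc a < 1 ->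
    complex.Re (((f a)^*)%C * f z) = complex.Re ((a^*)%C * z).
  move=> zD aD; rewrite -(ip z a zD aD) /f rmorphM /= conjcK; congr complex.Re.
  by rewrite mulrACA (mulrC k) kk mul1r.
have fh : f h = h.
  have : (k^*)%C * (2%:R * g h) = 1 by exact: kk.
  have e2 : 2%:R != 0 :> C by rewrite -normc_gt0 normc_nat.
  rewrite /f mulrCA => E; apply: (mulfI e2); rewrite E.
  by apply: cplx_eq => /=; lra.
have fRe z : normc z < 1 -> complex.Re (f z) = complex.Re z.
  move=> zD; have := fip z h zD hD; rewrite fh.
  by case: (f z) => u v; case: (z) => x y /=; lra.
have fIm z : normc z < 1 -> complex.Im (f z) ^+ 2 = complex.Im z ^+ 2.
  move=> zD; have : normc (f z) ^+ 2 = normc z ^+ 2 by rewrite fn.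
  by rewrite !normc_sqr fRe// => /addrI.
pose j : C := Complex 0 (1 / 2).
have jn : normc j = 1 / 2.
  by rewrite /Normc.normc /= expr0n add0r sqrtr_sqr gtr0_norm.
have jD : normc j < 1 by rewrite jn; lra.
have fjRe : complex.Re (f j) = 0 by rewrite fRe.
have fj z : normc z < 1 -> complex.Im (f j) * complex.Im (f z) = complex.Im z / 2.
  move=> zD; have := fip z j zD jD; move: fjRe.
  by case: (f j) (f z) => a b [u v]; case: (z) => x y /= ->; lra.
have : complex.Im (f j) ^+ 2 = (1 / 2) ^+ 2 by rewrite fIm.
move=> /eqP; rewrite eqf_sqr => /orP[|] /eqP fj2.
  exists k => // z zD; rewrite gf; congr (_ * _); apply: cplx_eq; first exact: fRe.
  by have := fj z zD; rewrite fj2; lra.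
exfalso; have k0 : k != 0 by rewrite -normc_gt0 kn.
apply: (@conj_not_cderive _ k l k0); apply: cderive_near dg.
exists 1 => // z; rewrite subr0 => zD; rewrite gf; congr (_ * _).
apply: cplx_eq; first by rewrite fRe//; case: (z).
by have := fj z zD; rewrite fj2; case: (z) => x y /=; lra.
Qed.

Theorem Aut_blaschke phi : Aut phi -> exists w k : C,
  [/\ normc w < 1, normc k = 1 & forall z, normc z < 1 -> phi z = blaschke w (k * z)].
Proof.
move=> Aphi; have [hol inj im] := Aphi; have [chi [dchi chiD phiK chiK]] := AutP Aphi.
have dphi z : normc z < 1 -> exists l, cderive phi z l by exact: Hol_cderive.
have phiD z : normc z < 1 -> normc (phi z) < 1 by move=> /chiK[].
(* Schwarz-Pick for [phi] gives one inequality, for its inverse [chi] the other. *)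
have iso z a : normc z < 1 -> normc a < 1 ->
    normc (blaschke (phi a) (phi z)) = normc (blaschke a z).
  move=> zD aD; apply/eqP; rewrite eq_le schwarz_pick//=.
  have := schwarz_pick dchi chiD (phiD z zD) (phiD a aD).
  by have [_ ->] := chiK z zD; have [_ ->] := chiK a aD.
have D0 : normc (0 : C) < 1 by rewrite normc0.
pose w := phi 0; have wD : normc w < 1 by exact: phiD.
have [l hl] := dphi 0 D0.
have [k kn hk] : exists2 k : C, normc k = 1 &
    forall z, normc z < 1 -> blaschke w (phi z) = k * z.
  apply: (@isometry_rotation (fun z => blaschke w (phi z))).
  - exact: cderive_comp hl (cderive_blaschke wD (ltW wD)).
  - move=> z zD; rewrite iso// /blaschke conjc0 mul0r subr0 divr1 sub0r.
    exact: normcN.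
  - by move=> z a zD aD; rewrite blaschke_blaschke ?phiD// iso.
exists w, k; split=> // z zD.
by rewrite -hk// blaschkeK// ltW// phiD.
Qed.

Lemma blaschke_Aut a : normc a < 1 -> Aut (blaschke a).
Proof.
move=> aD; split.
- move=> z zD; apply/derivable_cderive.
  by eexists; apply: cderive_blaschke => //; exact: ltW.
- move=> z w zD wD E; rewrite -(blaschkeK aD (ltW zD)) E.
  by rewrite blaschkeK// ltW.
- apply/seteqP; split=> [_ [z zD <-]|w wD]; first exact: blaschke_lt1.
  by exists (blaschke a w); [exact: blaschke_lt1|rewrite blaschkeK// ltW].
Qed.

End AutDisc.

(** * Changes of variables in the plane *)

Section LineSubstitution.
Local Open Scope ereal_scope.
Variable R : realType.
Local Notation mu := (@lebesgue_measure R).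

Let affine (a b : R) : measurableTypeR R -> measurableTypeR R := fun x => (a * x + b)%R.

Let measurable_affine a b : measurable_fun setT (affine a b).
Proof.
apply: measurable_funD; last exact: measurable_cst.
by apply: measurable_funM; [exact: measurable_cst|exact: measurable_id].
Qed.

(** Lebesgue measure is determined by its values on half-open intervals; for [a < 0] the preimage of
    []c, d]] is closed on the left instead of the right, with the same length. *)
Lemma lebesgue_measure_affine (a b : R) (A : set R) : (a != 0)%R -> measurable A ->
  mu A = `|a|%:E * pushforward mu (affine a b) A.
Proof.
move=> a0 mA.
have maf := measurable_affine a b.
pose nu : {measure set (measurableTypeR R) -> \bar R} :=
  mscale (NngNum (normr_ge0 a)) (pushforward mu (affine a b)).
rewrite -[RHS]/(nu maf A); apply: lebesgue_measure_unique => // _ [[c d]] _ <-.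
rewrite /nu /= /mscale /= /pushforward /=.
have [cd|dc] := ltP c d; last first.
  rewrite set_itv_ge -?leNgt ?bnd_simp// preimage_set0 !measure0 mule0//.
have [apos|aneg|a00] := ltgtP a 0%R; last by rewrite a00 eqxx in a0.
- have -> : affine a b @^-1` `]c, d]%classic = `[((d - b) / a)%R, ((c - b) / a)%R[%classic.
    apply/seteqP; split => x /=; rewrite /affine !in_itv /= => /andP[h1 h2]; apply/andP; split.
    + by rewrite ler_ndivrMr// mulrC lerBrDr.
    + by rewrite ltr_ndivlMr// mulrC ltrBlDr.
    + by rewrite -ltrBlDr mulrC -ltr_ndivlMr.
    + by rewrite -lerBrDr mulrC -ler_ndivrMr.
  rewrite !lebesgue_measure_itv /= !lte_fin cd ltr_ndivrMr// divfK ?lt_eqF//.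
  rewrite ltrD2r cd -EFinB -!EFinM; congr _%:E; rewrite ltr0_norm//.
  by field; rewrite lt_eqF.
- have -> : affine a b @^-1` `]c, d]%classic = `]((c - b) / a)%R, ((d - b) / a)%R]%classic.
    apply/seteqP; split => x /=; rewrite /affine !in_itv /= => /andP[h1 h2]; apply/andP; split.
    + by rewrite ltr_pdivrMr// mulrC ltrBlDr.
    + by rewrite ler_pdivlMr// mulrC lerBrDr.
    + by rewrite -ltrBlDr mulrC -ltr_pdivrMr.
    + by rewrite -lerBrDr mulrC -ler_pdivlMr.
  rewrite !lebesgue_measure_itv /= !lte_fin cd ltr_pM2r ?invr_gt0//.
  rewrite ltrD2r cd -EFinB -!EFinM; congr _%:E; rewrite gtr0_norm//.
  by field; rewrite gt_eqF.
Qed.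

Lemma integral_affine (a b : R) (f : R -> \bar R) : (a != 0)%R ->
  measurable_fun setT f -> (forall x, 0 <= f x) ->
  \int[mu]_x f (a * x + b)%R = (`|a|^-1)%:E * \int[mu]_x f x.
Proof.
move=> a0 mf f0.
have maf := measurable_affine a b.
pose nu : {measure set (measurableTypeR R) -> \bar R} :=
  mscale (NngNum (normr_ge0 a)) (pushforward mu (affine a b)).
have -> : \int[mu]_x f x = \int[nu maf]_x f x.
  by apply: eq_measure_integral => A mA _; exact: lebesgue_measure_affine.
rewrite /nu ge0_integral_mscale//= muleA -EFinM mulVf ?normr_eq0// mul1e.
by rewrite ge0_integral_pushforward.
Qed.

End LineSubstitution.

(** * Area under affine maps, inversion and Blaschke factors *)

Section PlaneSubstitution.
Local Open Scope ereal_scope.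
Variable R : realType.
Local Notation C := (Cplx R).
Local Notation mu := (@lebesgue_measure R).
Implicit Types (h f g : C -> \bar R) (z w c : C).

(** A named copy of the product measure, so that it can carry the structure of a sigma-finite
    measure for Tonelli's theorem on pairs of points of the plane. *)
Definition plane_measure : set (plane R) -> \bar R := (mu \x mu)%E.

HB.instance Definition _ := Measure.copy plane_measure (mu \x mu)%E.

Let plane_measure_sigma_finite : sigma_finite setT plane_measure.
Proof.
exists (fun n => `[(- n%:R)%R, n%:R%R]%classic `*` `[(- n%:R)%R, n%:R%R]%classic).
  apply/esym/seteqP; split => // -[x y] _.
  have H (u : R) n : (Num.truncn `|u| < n)%N -> (u \in `[(- n%:R)%R, n%:R%R]%R).
    move=> un; rewrite in_itv /= -ler_norml.
    by apply/ltW; apply: lt_le_trans (truncnS_gt _) _; rewrite ler_nat.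
  exists (maxn (Num.truncn `|x|) (Num.truncn `|y|)).+1 => //; split; apply: H.
    by rewrite ltnS leq_maxl.
  by rewrite ltnS leq_maxr.
move=> n; split; first by apply: measurableX; exact: measurable_itv.
rewrite /plane_measure product_measure1E//; try exact: measurable_itv.
rewrite /= !lebesgue_measure_itv /=; case: ifPn => _; last by rewrite mule0 ltry.
by rewrite -EFinB -EFinM ltry.
Qed.

HB.instance Definition _ := Measure_isSigmaFinite.Build _ _ _ plane_measure
  plane_measure_sigma_finite.

Definition cintegral h := \int[plane_measure]_p h (to_cplx p).

Lemma cintegral_xy h : cmeasurable h -> (forall z, 0 <= h z) ->
  cintegral h = \int[mu]_x \int[mu]_y h (Complex x y).
Proof.
move=> mh h0; rewrite /cintegral /plane_measure.
by rewrite (@fubini_tonelli1 _ _ _ _ _ mu mu (h \o @to_cplx R) mh (fun p => h0 _)).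
Qed.

Lemma cintegral_yx h : cmeasurable h -> (forall z, 0 <= h z) ->
  cintegral h = \int[mu]_y \int[mu]_x h (Complex x y).
Proof.
move=> mh h0; rewrite /cintegral /plane_measure.
have := @fubini_tonelli _ _ _ _ _ mu mu (h \o @to_cplx R) mh (fun p => h0 _).
by rewrite (@fubini_tonelli1 _ _ _ _ _ mu mu (h \o @to_cplx R) mh (fun p => h0 _)) => ->.
Qed.

Lemma measurable_cintegral_x h : cmeasurable h -> (forall z, 0 <= h z) ->
  measurable_fun setT (fun x => \int[mu]_y h (Complex x y)).
Proof.
move=> mh h0.
exact: (@measurable_fun_fubini_tonelli_F _ _ _ _ _ mu (h \o @to_cplx R) mh (fun p => h0 _)).
Qed.

Lemma measurable_cintegral_y h : cmeasurable h -> (forall z, 0 <= h z) ->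
  measurable_fun setT (fun y => \int[mu]_x h (Complex x y)).
Proof.
move=> mh h0.
exact: (@measurable_fun_fubini_tonelli_G _ _ _ _ _ mu (h \o @to_cplx R) mh (fun p => h0 _)).
Qed.

Lemma cmfun_Complex d (T : measurableType d) (f g : T -> R) :
  measurable_fun setT f -> measurable_fun setT g ->
  cmfun (fun x => Complex (f x) (g x) : C).
Proof. by []. Qed.

Lemma cmeasurable_comp_cmfun h (F : C -> C) : cmeasurable h ->
  cmfun (F \o @to_cplx R) -> cmeasurable (h \o F).
Proof. by move=> mh mF; exact: (cmeasurable_comp mh mF). Qed.

Lemma cintegral_shift h c : cmeasurable h -> (forall z, 0 <= h z) ->
  cintegral (fun z => h (z + c)%R) = cintegral h.
Proof.
move=> mh h0; case: c => c1 c2.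
have mhc : cmeasurable (fun z => h (z + Complex c1 c2)%R).
  apply: (cmeasurable_comp_cmfun (F := fun z => (z + Complex c1 c2)%R)) => //.
  by apply: cmfunD; [exact: cmfun_to_cplx|exact: cmfun_cst].
rewrite (cintegral_xy mhc (fun z => h0 _)) (cintegral_xy mh h0).
transitivity (\int[mu]_x \int[mu]_y h (Complex (1 * x + c1)%R y)).
  apply: eq_integral => x _.
  have mhx : measurable_fun setT (fun y => h (Complex (x + c1)%R y)).
    by apply: (cmeasurable_comp mh); apply: cmfun_Complex; [exact: measurable_cst|exact: measurable_id].
  rewrite mul1r.
  transitivity (\int[mu]_y h (Complex (x + c1)%R (1 * y + c2)%R)).
    by apply: eq_integral => y _; rewrite mul1r; congr h; apply: cplx_eq.
  rewrite (integral_affine c2 (oner_neq0 R) mhx)//.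
  by rewrite normr1 invr1 mul1e.
rewrite (integral_affine c1 (oner_neq0 R) (measurable_cintegral_x mh h0))//.
  by rewrite normr1 invr1 mul1e.
by move=> x; apply: integral_ge0.
Qed.

(** One coordinate at a time: an affine substitution in [x] for fixed [y], then one in [y] for fixed
    [x]. When the real part [p] vanishes, the coordinates are exchanged instead. *)
Lemma cintegral_mul h c : c != 0%R -> cmeasurable h -> (forall z, 0 <= h z) ->
  cintegral (fun z => h (c * z)%R) = (normc c ^- 2)%:E * cintegral h.
Proof.
move=> c0 mh h0.
have mhc : cmeasurable (fun z => h (c * z)%R).
  apply: (cmeasurable_comp_cmfun (F := fun z => (c * z)%R)) => //.
  by apply: cmfunM; [exact: cmfun_cst|exact: cmfun_to_cplx].
rewrite (cintegral_yx mhc (fun z => h0 _)) (cintegral_xy mh h0).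
have nc := normc_sqr c; have n0 : (normc c ^+ 2 != 0)%R by rewrite expf_neq0// normc_eq0.
case: c c0 mhc nc n0 => p q c0 mhc /= nc n0; rewrite nc in n0 *.
have mul y x : (Complex p q * Complex x y = Complex (p * x - q * y) (p * y + q * x) :> C)%R.
  by apply: cplx_eq => /=; ring.
have [p0|p0] := eqVneq p 0%R.
  have q0 : (q != 0)%R by apply: contraNneq n0 => ->; rewrite p0; apply/eqP; ring.
  transitivity (\int[mu]_y ((`|q|^-1)%:E * \int[mu]_v h (Complex (- q * y + 0)%R v))).
    apply: eq_integral => y _.
    have mhy : measurable_fun setT (fun v => h (Complex (- q * y + 0)%R v)).
      by apply: (cmeasurable_comp mh); apply: cmfun_Complex; [exact: measurable_cst|exact: measurable_id].
    rewrite -(integral_affine 0 q0 mhy)//; apply: eq_integral => x _.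
    by rewrite mul p0; congr (h (Complex _ _)); ring.
  have mi := measurable_cintegral_x mh h0.
  have q0' : (- q != 0)%R by rewrite oppr_eq0.
  have i0 x : 0 <= \int[mu]_y h (Complex x y) by exact: integral_ge0.
  have q00 : 0 <= (`|q|^-1)%:E by rewrite lee_fin invr_ge0.
  have mi' : measurable_fun setT (fun y : R => \int[mu]_v h (Complex (- q * y + 0)%R v)).
    apply: (measurableT_comp mi); apply: measurable_funD; last exact: measurable_cst.
    by apply: measurable_funM; [exact: measurable_cst|exact: measurable_id].
  rewrite (ge0_integralZl mu measurableT mi' (fun y _ => i0 _) q00).
  rewrite (integral_affine 0 q0' mi)// muleA -EFinM normrN -invfM -expr2 real_normK ?num_real//.
  by rewrite p0 expr0n /= add0r.
(* Substituting [u = p x - q y] turns [p y + q x] into [k y + (q / p) u]; the two scale factors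
   multiply to [p * k = p ^+ 2 + q ^+ 2]. *)
pose k := ((p ^+ 2 + q ^+ 2) / p)%R.
have k0 : (k != 0)%R by rewrite mulf_neq0// invr_eq0.
pose h' (z : C) := h (Complex (complex.Re z) (k * complex.Im z + q / p * complex.Re z)%R).
have mh' : cmeasurable h'.
  apply: (cmeasurable_comp mh); apply: cmfun_Complex; first exact: measurable_fst.
  apply: measurable_funD; apply: measurable_funM; try exact: measurable_cst.
    exact: measurable_snd.
  exact: measurable_fst.
transitivity (\int[mu]_y ((`|p|^-1)%:E * \int[mu]_x h' (Complex x y))).
  apply: eq_integral => y _.
  have mhy : measurable_fun setT (fun x => h' (Complex x y)).
    by apply: (cmeasurable_comp mh'); apply: cmfun_Complex; [exact: measurable_id|exact: measurable_cst].
  rewrite -(integral_affine (- (q * y))%R p0 mhy)// ?/h'//; apply: eq_integral => x _.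
  rewrite mul /=; congr (h (Complex _ _)); rewrite /k; field => //.
have h'0 z : 0 <= h' z by exact: h0.
have i0 y : 0 <= \int[mu]_x h' (Complex x y) by exact: integral_ge0.
have p00 : 0 <= (`|p|^-1)%:E by rewrite lee_fin invr_ge0.
rewrite (ge0_integralZl mu measurableT (measurable_cintegral_y mh' h'0) (fun y _ => i0 y) p00).
rewrite -(cintegral_yx mh' h'0) (cintegral_xy mh' h'0).
transitivity ((`|p|^-1)%:E * \int[mu]_x ((`|k|^-1)%:E * \int[mu]_y h (Complex x y))).
  congr (_ * _); apply: eq_integral => x _.
  have mhx : measurable_fun setT (fun y => h (Complex x y)).
    by apply: (cmeasurable_comp mh); apply: cmfun_Complex; [exact: measurable_cst|exact: measurable_id].
  by rewrite -(integral_affine (q / p * x)%R k0 mhx).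
have j0 x : 0 <= \int[mu]_y h (Complex x y) by exact: integral_ge0.
have k00 : 0 <= (`|k|^-1)%:E by rewrite lee_fin invr_ge0.
rewrite (ge0_integralZl mu measurableT (measurable_cintegral_x mh h0) (fun x _ => j0 x) k00).
rewrite muleA -EFinM -invfM -normrM; congr ((_^-1)%:E * _).
have -> : (p * k = p ^+ 2 + q ^+ 2)%R by rewrite /k; field.
by rewrite ger0_norm// addr_ge0 ?sqr_ge0.
Qed.

Lemma cintegral_tonelli (F : C -> C -> \bar R) :
  measurable_fun setT (fun pq : plane R * plane R => F (to_cplx pq.1) (to_cplx pq.2)) ->
  (forall z w, 0 <= F z w) ->
  cintegral (fun z => cintegral (F z)) = cintegral (fun w => cintegral (F^~ w)).
Proof.
move=> mF F0; rewrite /cintegral.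
pose f (pq : plane R * plane R) := F (to_cplx pq.1) (to_cplx pq.2).
have f0 pq : 0 <= f pq by exact: F0.
exact: (@fubini_tonelli _ _ _ _ _ plane_measure plane_measure f mF f0).
Qed.

Lemma eq_cintegral f g : f =1 g -> cintegral f = cintegral g.
Proof. by move=> fg; apply: eq_integral => p _; rewrite fg. Qed.

Lemma cintegralZl (k : \bar R) f : 0 <= k -> cmeasurable f -> (forall z, 0 <= f z) ->
  cintegral (fun z => k * f z) = k * cintegral f.
Proof. by move=> k0 mf f0; rewrite /cintegral ge0_integralZl. Qed.

Let wt z : \bar R := (normc z ^- 2)%:E.

Let wt_ge0 z : 0 <= wt z.
Proof. by rewrite lee_fin invr_ge0 exprn_ge0// normc_ge0. Qed.

Let wt0 : wt 0%R = 0. Proof. by rewrite /wt normc0 expr0n invr0. Qed.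

Let measurable_wt d (T : measurableType d) (F : T -> C) : cmfun F ->
  measurable_fun setT (fun x => wt (F x)).
Proof.
move=> mF; apply/measurable_EFinP; apply: measurable_fun_inv.
by apply: measurable_funX; exact: measurable_normc.
Qed.

Let haar g := cintegral (fun z => g z * wt z).

Let haar_mul g c : c != 0%R -> cmeasurable g -> (forall z, 0 <= g z) ->
  haar (fun z => g (c * z)%R) = haar g.
Proof.
move=> c0 mg g0.
have mgw : cmeasurable (fun z => g z * wt z).
  by apply: emeasurable_funM => //; apply: measurable_wt; exact: cmfun_to_cplx.
have gw0 z : 0 <= g z * wt z by rewrite mule_ge0.
have := cintegral_mul c0 mgw gw0.
have -> : cintegral (fun z => g (c * z)%R * wt (c * z)%R) =
    (normc c ^- 2)%:E * haar (fun z => g (c * z)%R).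
  rewrite /haar -cintegralZl//; first last.
  - by move=> z; rewrite mule_ge0.
  - apply: emeasurable_funM; last by apply: measurable_wt; exact: cmfun_to_cplx.
    apply: (cmeasurable_comp mg); apply: cmfunM; [exact: cmfun_cst|exact: cmfun_to_cplx].
  - by rewrite lee_fin invr_ge0 exprn_ge0// normc_ge0.
  apply: eq_cintegral => z; rewrite /wt normcM exprMn invfM EFinM; exact: muleCA.
have cn : (normc c ^- 2 != 0)%R by rewrite invr_eq0 expf_neq0// normc_eq0.
move=> /(congr1 (fun x => (normc c ^+ 2)%:E * x)).
rewrite !muleA -EFinM divff ?expf_neq0 ?normc_eq0// !mul1e.
by [].
Qed.

(* The measure [|z|^-2 dA] is a Haar measure of the multiplicative group, and a
   Haar measure of an abelian group is invariant under inversion: both sides,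
   multiplied by [haar f] with [haar f = 1], are the same double integral. *)
Let haar_inv g : cmeasurable g -> (forall z, 0 <= g z) ->
  haar (fun z => g z^-1%R) = haar g.
Proof.
move=> mg g0.
(* A unit square that avoids 0: the factor [|z|^2] in [f] cancels the Haar density, and [haar f] is
   the area 1. *)
pose box : set (plane R) := `[1%R, 2%R]%classic `*` `[0%R, 1%R]%classic.
have mbox : measurable box by apply: measurableX; exact: measurable_itv.
pose f z : \bar R := (normc z ^+ 2)%:E * (\1_box (of_cplx z))%:E.
have f0 z : 0 <= f z.
  by rewrite mule_ge0// lee_fin ?exprn_ge0 ?normc_ge0//.
have mf : cmeasurable f.
  apply: emeasurable_funM; apply/measurable_EFinP.
    by apply: measurable_funX; apply: measurable_normc; exact: cmfun_to_cplx.
  have -> : (fun x : plane R => \1_box (of_cplx (to_cplx x))) = \1_box :> (plane R -> R).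
    by apply/funext => p; rewrite to_cplxK.
  exact: measurable_indic.
have fwt z : f z * wt z = (\1_box (of_cplx z))%:E.
  rewrite /f /wt muleAC -EFinM; have [->|z0] := eqVneq z 0%R; last first.
    have n0 : (normc z ^+ 2 != 0)%R by rewrite expf_neq0// normc_eq0.
    by rewrite divff// mul1r.
  rewrite normc0 expr0n !mul0r indicE memNset// /box /= !in_itv /= => -[].
  by rewrite ler10.
have hf : haar f = 1.
  rewrite /haar (eq_cintegral fwt) /cintegral.
  transitivity (\int[plane_measure]_p (\1_box p)%:E).
    by apply: eq_integral => p _; rewrite to_cplxK.
  rewrite integral_indic// setIT /box /= /plane_measure product_measure1E//=.
  rewrite !lebesgue_measure_itv /= !lte_fin ltr01 ltr1n -!EFinB -EFinM.
  by congr _%:E; ring.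
have mw1 : measurable_fun setT (fun pq : plane R * plane R => wt (to_cplx pq.1)).
  by apply: (measurableT_comp (f := fun p => wt (to_cplx p))) => //; apply: measurable_wt; exact: cmfun_to_cplx.
have mw2 : measurable_fun setT (fun pq : plane R * plane R => wt (to_cplx pq.2)).
  by apply: (measurableT_comp (f := fun p => wt (to_cplx p))) => //; apply: measurable_wt; exact: cmfun_to_cplx.
have c1 : cmfun (fun pq : plane R * plane R => to_cplx pq.1).
  split => /=; first exact: (measurableT_comp measurable_fst measurable_fst).
  exact: (measurableT_comp measurable_snd measurable_fst).
have c2 : cmfun (fun pq : plane R * plane R => to_cplx pq.2).
  split => /=; first exact: (measurableT_comp measurable_fst measurable_snd).
  exact: (measurableT_comp measurable_snd measurable_snd).
have cz := cmfun_to_cplx R.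
have mgV : cmeasurable (fun z => g z^-1%R) by apply: (cmeasurable_comp mg); exact: cmfunV.
have mwt : cmeasurable wt by exact: measurable_wt.
(* Integrating over [y] first, and absorbing [x] by invariance, leaves the integral of [g x^-1]
   times [haar f]. *)
pose F x y := g x^-1%R * wt x * (f (x * y)%R * wt y).
have mF : measurable_fun setT (fun pq : plane R * plane R => F (to_cplx pq.1) (to_cplx pq.2)).
  apply: emeasurable_funM; apply: emeasurable_funM => //.
    by apply: (cmeasurable_comp mg); exact: cmfunV.
  by apply: (cmeasurable_comp mf); exact: cmfunM.
have F0 z w : 0 <= F z w by rewrite /F; do ?apply: mule_ge0 => //.
have E1 : haar (fun z => g z^-1%R) = cintegral (fun x => cintegral (F x)).
  apply: eq_cintegral => x; rewrite /F cintegralZl ?mule_ge0//; first last.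
  - by move=> z; rewrite mule_ge0.
  - apply: emeasurable_funM => //; apply: (cmeasurable_comp mf).
    by apply: cmfunM => //; exact: cmfun_cst.
  have [->|x0] := eqVneq x 0%R; first by rewrite wt0 mule0 mul0e.
  by rewrite -[X in _ = _ * X]/(haar (fun y => f (x * y)%R)) haar_mul// hf mule1.
(* This is [F] after the substitution [u = x y] at fixed [y]; integrating over [y] first now leaves
   [haar g] times [haar f]. *)
pose G y u := g (y / u)%R * f u * wt u * wt y.
have mG : measurable_fun setT (fun pq : plane R * plane R => G (to_cplx pq.1) (to_cplx pq.2)).
  apply: emeasurable_funM => //; apply: emeasurable_funM => //; apply: emeasurable_funM => //.
    by apply: (cmeasurable_comp mg); exact: cmfun_div.
  exact: (cmeasurable_comp mf).
have G0 z w : 0 <= G z w by rewrite /G; do ?apply: mule_ge0 => //.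
have E2 : cintegral (fun y => cintegral (F^~ y)) = cintegral (fun y => cintegral (G y)).
  apply: eq_cintegral => y.
  have mgf : cmeasurable (fun u => g (y / u)%R * f u).
    apply: emeasurable_funM => //; apply: (cmeasurable_comp mg).
    by apply: cmfun_div => //; exact: cmfun_cst.
  have [->|y0] := eqVneq y 0%R.
    rewrite (eq_cintegral (g := cst 0)); last by move=> x; rewrite /F wt0 !mule0.
    by apply: eq_cintegral => x; rewrite /G wt0 mule0.
  transitivity (wt y * haar (fun x => g (y / (y * x))%R * f (y * x)%R)).
    rewrite /haar -cintegralZl//; first last.
    - by move=> z; do ?apply: mule_ge0 => //.
    - apply: emeasurable_funM => //; apply: emeasurable_funM.
        apply: (cmeasurable_comp mg); apply: cmfun_div; first exact: cmfun_cst.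
        by apply: cmfunM => //; exact: cmfun_cst.
      by apply: (cmeasurable_comp mf); apply: cmfunM => //; exact: cmfun_cst.
    apply: eq_cintegral => x; rewrite /F.
    have [->|x0] := eqVneq x 0%R; first by rewrite wt0 !mule0 mul0e.
    have -> : (y / (y * x) = x^-1)%R by rewrite invfM mulrA divff// mul1r.
    rewrite (mulrC y x); move: (g _) (wt x) (f _) (wt y) => A B D E.
    by rewrite muleA muleC; congr (_ * _); rewrite muleAC.
  rewrite (haar_mul y0 mgf); last by move=> z; rewrite mule_ge0.
  rewrite /haar -cintegralZl//; first last.
  - by move=> z; do ?apply: mule_ge0 => //.
  - by apply: emeasurable_funM.
  by apply: eq_cintegral => x; rewrite /G muleC.
have E3 : cintegral (fun u => cintegral (G^~ u)) = haar g.
  have hg0 : 0 <= haar g by apply: integral_ge0 => p _; exact: mule_ge0.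
  have mfw : cmeasurable (fun u => f u * wt u) by exact: emeasurable_funM.
  have fw0 u : 0 <= f u * wt u by exact: mule_ge0.
  have E0 := cintegralZl hg0 mfw fw0.
  rewrite -[cintegral (fun u => f u * wt u)]/(haar f) hf mule1 in E0.
  rewrite -[RHS]E0.
  apply: eq_cintegral => u.
  have [->|u0] := eqVneq u 0%R.
    rewrite wt0 !mule0 (eq_cintegral (g := cst 0)).
      by rewrite /cintegral integral0.
    by move=> x; rewrite /G wt0 mule0 mul0e.
  have u0' : u^-1%R != 0%R by rewrite invr_eq0.
  have mgu : cmeasurable (fun y => g (u^-1 * y)%R * wt y).
    apply: emeasurable_funM => //; apply: (cmeasurable_comp mg).
    by apply: cmfunM => //; exact: cmfun_cst.
  have gu0 y : 0 <= g (u^-1 * y)%R * wt y by exact: mule_ge0.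
  have E4 := cintegralZl (fw0 u) mgu gu0.
  rewrite -(haar_mul u0' mg g0) muleC /haar -E4.
  apply: eq_cintegral => y; rewrite /G (mulrC y).
  move: (g _) (wt u) (f _) (wt y) => A B D E.
  by rewrite -!muleA muleCA; congr (_ * _); exact: muleCA.
by rewrite E1 (cintegral_tonelli mF F0) E2 (cintegral_tonelli mG G0) E3.
Qed.

(** Area is [|z|^2] times the Haar measure, so inversion has Jacobian [|z|^-4]. The condition at 0
    makes the identities pointwise, since [wt 0 = 0]. *)
Lemma cintegral_inv h : cmeasurable h -> (forall z, 0 <= h z) -> h 0%R = 0 ->
  cintegral (fun z => h z^-1%R * (normc z ^- 4)%:E) = cintegral h.
Proof.
move=> mh h0 h00.
pose g z := h z * (normc z ^+ 2)%:E.
have g0 z : 0 <= g z by rewrite mule_ge0// lee_fin exprn_ge0// normc_ge0.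
have mg : cmeasurable g.
  apply: emeasurable_funM => //; apply/measurable_EFinP.
  by apply: measurable_funX; apply: measurable_normc; exact: cmfun_to_cplx.
have n0 z : z != 0%R -> (normc z ^+ 2 != 0)%R by rewrite expf_eq0 normc_eq0.
have gw z : g z * wt z = h z.
  rewrite /g /wt -muleA -EFinM.
  have [->|z0] := eqVneq z 0%R; first by rewrite h00 mul0e.
  by rewrite divff ?n0// mule1.
have gVw z : g z^-1%R * wt z = h z^-1%R * (normc z ^- 4)%:E.
  by rewrite /g /wt -muleA -EFinM normcV exprVn -invfM -exprD.
rewrite -(eq_cintegral gw) -(eq_cintegral gVw).
exact: haar_inv mg g0.
Qed.

(** [blaschke a z = (1 - k / (1 - conj a z)) / conj a] with [k = 1 - |a|^2]: an affine map, an
    inversion and an affine map, each with its own rule. The weight on the left is the squared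
    modulus of the derivative. For [a = 0] the map is [- z]. *)
Lemma cintegral_blaschke h a : (normc a < 1)%R -> cmeasurable h -> (forall z, 0 <= h z) ->
  (forall z, (1 <= normc z)%R -> h z = 0) ->
  cintegral (fun z => h (blaschke a z) *
    (((1 - normc a ^+ 2) ^+ 2) * normc (1 - (a^*)%C * z)%R ^- 4)%R%:E) = cintegral h.
Proof.
move=> a1 mh h0 hD.
have cz := cmfun_to_cplx R.
have [->|an0] := eqVneq a 0%R.
  have N0 : ((-1)%R : C) != 0%R by rewrite oppr_eq0 oner_neq0.
  transitivity ((normc ((-1)%R : C) ^- 2)%:E * cintegral h); last first.
    by rewrite normcN normc1 expr1n invr1 mul1e.
  rewrite -(cintegral_mul N0 mh h0); apply: eq_cintegral => z.
  rewrite /blaschke conjc0 mul0r subr0 divr1 sub0r mulN1r normc0 normc1 expr0n.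
  by rewrite subr0 !expr1n invr1 mulr1 mule1.
pose k : C := (1 - (a^*)%C * a)%R.
have kE : normc k = (1 - normc a ^+ 2)%R.
  rewrite /k mulrC mul_conjE -[1%R in LHS]/((1%:C)%C : C) -rmorphB normc_real ger0_norm//.
  by rewrite -normc_le1P ltW.
have k0 : k != 0%R by rewrite -normc_gt0 kE -normc_lt1P.
have ca0 : (a^*)%C != 0%R :> C by rewrite conjc_eq0.
pose h1 (v : C) := h ((1 - k * v) / (a^*)%C)%R.
have mh1 : cmeasurable h1.
  apply: (cmeasurable_comp mh); apply: cmfun_div; last exact: cmfun_cst.
  by apply: cmfunB; [exact: cmfun_cst|apply: cmfunM => //; exact: cmfun_cst].
(* The zero required by [cintegral_inv]: here 0 corresponds to the point [1 / conj a] outside the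
   disc. *)
have h10 : h1 0%R = 0.
  rewrite /h1 mulr0 subr0 div1r; apply: hD.
  by rewrite normcV normc_conj invf_ge1 ?normc_gt0// ltW.
have h1ge v : 0 <= h1 v by exact: h0.
have S1 : cintegral h1 = (normc (k / (a^*)%C)%R ^- 2)%:E * cintegral h.
  have c0 : (- (k / (a^*)%C))%R != 0%R :> C by rewrite oppr_eq0 mulf_neq0// invr_eq0.
  have mh' : cmeasurable (fun z => h (z + (a^*)%C^-1)%R).
    by apply: (cmeasurable_comp mh); apply: cmfunD => //; exact: cmfun_cst.
  rewrite -(normcN (k / _)%R) -(cintegral_shift ((a^*)%C^-1)%R mh h0).
  rewrite -(cintegral_mul c0 mh' (fun z => h0 _)); apply: eq_cintegral => z.
  by rewrite /h1; congr h; ring.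
pose h2 (s : C) := h1 s^-1%R * (normc s ^- 4)%:E.
have mh2 : cmeasurable h2.
  apply: emeasurable_funM; first by apply: (cmeasurable_comp mh1); exact: cmfunV.
  apply/measurable_EFinP; apply: measurable_fun_inv; apply: measurable_funX.
  exact: measurable_normc.
have h2ge s : 0 <= h2 s.
  by rewrite mule_ge0// lee_fin invr_ge0 exprn_ge0// normc_ge0.
have S2 : cintegral h2 = cintegral h1 by exact: cintegral_inv.
have S3 : cintegral (fun z => h2 (1 - (a^*)%C * z)%R) = (normc a ^- 2)%:E * cintegral h2.
  have c0 : (- (a^*)%C)%R != 0%R :> C by rewrite oppr_eq0.
  have mh' : cmeasurable (fun z => h2 (z + 1)%R).
    by apply: (cmeasurable_comp mh2); apply: cmfunD => //; exact: cmfun_cst.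
  rewrite -(normc_conj a) -(normcN (a^*)%C) -(cintegral_shift 1%R mh2 h2ge).
  rewrite -(cintegral_mul c0 mh' (fun z => h2ge _)); apply: eq_cintegral => z.
  by congr h2; ring.
have na0 : (normc a != 0)%R by rewrite normc_eq0.
have nk0 : (normc k != 0)%R by rewrite normc_eq0.
transitivity ((normc k ^+ 2)%:E * cintegral (fun z => h2 (1 - (a^*)%C * z)%R)); last first.
  rewrite S3 S2 S1 normcM normcV normc_conj !muleA -!EFinM.
  rewrite [X in X%:E](_ : _ = 1%R) ?mul1e//.
  by field; rewrite nk0 na0.
have mh2' : cmeasurable (fun z => h2 (1 - (a^*)%C * z)%R).
  apply: (cmeasurable_comp mh2); apply: cmfunB; first exact: cmfun_cst.
  by apply: cmfunM => //; exact: cmfun_cst.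
have nk2 : 0 <= (normc k ^+ 2)%:E by rewrite lee_fin exprn_ge0// normc_ge0.
rewrite -(cintegralZl nk2 mh2' (fun z => h2ge _)).
apply: eq_cintegral => z; rewrite /h2 kE muleCA -EFinM.
have [den0|den0] := eqVneq (1 - (a^*)%C * z)%R 0%R.
  by rewrite den0 normc0 expr0n invr0 mulr0 !mule0.
congr (_ * _); rewrite /h1 /blaschke; congr h; rewrite /k.
by field; rewrite ca0.
Qed.

End PlaneSubstitution.

(** * Power series *)

Section PowerSeries.
Variable R : realType.
Local Notation C := (Cplx R).
Implicit Types (b c : nat -> C) (z w : C) (r q K : R).

Definition psum b N z : C := \sum_(0 <= n < N) b n * z ^+ n.

(** Radius of convergence at least 1, expressed by Cauchy estimates on all smaller radii, from which
    geometric tail bounds follow. *)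
Definition adm b := forall r, 0 < r < 1 -> exists K, forall n, normc (b n) * r ^+ n <= K.

Lemma psumS b N z : psum b N.+1 z = psum b N z + b N * z ^+ N.
Proof. by rewrite /psum big_nat_recr. Qed.

Lemma psum0 b z : psum b 0 z = 0.
Proof. by rewrite /psum big_geq. Qed.

Lemma psum_series b z : (fun N => psum b N z) = series (fun n => b n * z ^+ n).
Proof. by apply/funext => N. Qed.

Lemma geometric_tail q n m : 0 <= q < 1 -> \sum_(n <= i < n + m) q ^+ i <= q ^+ n / (1 - q).
Proof.
move=> /andP[q0 q1]; have q1' : 0 < 1 - q by rewrite subr_gt0.
rewrite ler_pdivlMr//.
have -> : (\sum_(n <= i < n + m) q ^+ i) * (1 - q) = q ^+ n - q ^+ (n + m).
  elim: m => [|m IH]; first by rewrite addn0 big_geq// mul0r subrr.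
  by rewrite addnS big_nat_recr ?leq_addr//= mulrDl IH exprS; ring.
by rewrite gerBl exprn_ge0.
Qed.

Lemma natmul_geometric q n : 0 <= q < 1 -> n%:R * q ^+ n <= (1 - q)^-1.
Proof.
move=> /andP[q0 q1].
have := @geometric_tail q 0 n; rewrite q0 q1 => /(_ isT); rewrite expr0 mul1r add0n.
apply: le_trans.
have -> : n%:R * q ^+ n = \sum_(0 <= i < n) q ^+ n.
  by rewrite sumr_const_nat subn0 mulr_natl.
rewrite big_nat_cond [leRHS]big_nat_cond; apply: ler_sum => i /andP[/andP[_ i_n] _].
by apply: ler_wiXn2l => //; [exact: ltW|exact: ltnW].
Qed.

Lemma geometric_small q K e : 0 <= q < 1 -> 0 < e ->
  exists N, forall n, (N <= n)%N -> K * q ^+ n <= e.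
Proof.
move=> /andP[q0 q1] e0.
have := @cvg_geometric R K q; rewrite ger0_norm// => /(_ q1).
move=> /cvgrPdist_lt /(_ e e0) [N _ H]; exists N => n /H.
by rewrite /= sub0r normrN => /ltW; apply: le_trans; exact: ler_norm.
Qed.

Lemma sum_cat_psum b z n m : psum b (n + m) z = psum b n z + \sum_(n <= i < n + m) b i * z ^+ i.
Proof. by rewrite /psum (big_cat_nat (n := n)) ?leq_addr. Qed.

Lemma psum_tail b z r q K n m : 0 < r -> 0 <= q < 1 -> normc z <= q * r ->
  (forall n, normc (b n) * r ^+ n <= K) ->
  normc (psum b (n + m) z - psum b n z) <= K * (q ^+ n / (1 - q)).
Proof.
move=> r0 q01 zq bK; have [q0 q1] := andP q01.
have K0 : 0 <= K by apply: le_trans (bK 0%N); rewrite mulr_ge0 ?normc_ge0 ?exprn_ge0 ?ltW.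
rewrite sum_cat_psum addrAC subrr add0r.
apply: le_trans (normc_sum _ _ _) _.
apply: le_trans (ler_wpM2l K0 (geometric_tail n m q01)).
rewrite mulr_sumr; apply: ler_sum => i _.
rewrite normcM normcX; apply: (@le_trans _ _ (normc (b i) * (q * r) ^+ i)).
  apply: ler_wpM2l; first exact: normc_ge0.
  by apply: lerXn2r; rewrite ?nnegrE ?normc_ge0// mulr_ge0// ltW.
rewrite exprMn mulrCA mulrC; apply: ler_wpM2r; first by rewrite exprn_ge0.
exact: bK.
Qed.

Lemma real_limit_exists (u B : nat -> R) :
  (forall n m, `|u (n + m)%N - u n| <= B n) -> exists l, forall n, `|u n - l| <= B n.
Proof.
move=> H.
have Hnm n m : u n - B n <= u m + B m.
  have B0 k : 0 <= B k by apply: le_trans (H k 0%N).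
  have h0 := B0 n; have h1 := B0 m.
  case: (leqP n m) => [nm|/ltnW nm].
    by have := H n (m - n)%N; rewrite subnKC// ler_norml; lra.
  by have := H m (n - m)%N; rewrite subnKC// ler_norml; lra.
pose A := range (fun n => u n - B n).
have hs : has_sup A.
  by split; [exists (u 0%N - B 0%N), 0%N|exists (u 0%N + B 0%N) => _ [n _ <-]].
exists (sup A) => n.
have h1 : u n - B n <= sup A by apply: (sup_upper_bound hs); exists n.
have h2 : sup A <= u n + B n.
  by apply: ge_sup; [exists (u 0%N - B 0%N), 0%N|move=> _ [m _ <-]].
by rewrite ler_norml; lra.
Qed.

Lemma complex_limit_exists (u : nat -> C) (B : nat -> R) :
  (forall n m, normc (u (n + m)%N - u n) <= B n) ->
  exists l, forall n, normc (u n - l) <= 2 * B n.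
Proof.
move=> H.
have [|l1 h1] := @real_limit_exists (fun n => complex.Re (u n)) B.
  by move=> n m; rewrite -raddfB; exact: le_trans (Re_le_normc (u (n + m)%N - u n)) (H n m).
have [|l2 h2] := @real_limit_exists (fun n => complex.Im (u n)) B.
  by move=> n m; rewrite -raddfB; exact: le_trans (Im_le_normc (u (n + m)%N - u n)) (H n m).
exists (Complex l1 l2) => n; apply: le_trans (normc_le_ReIm _) _.
have -> : complex.Re (u n - Complex l1 l2) = complex.Re (u n) - l1 by case: (u n).
have -> : complex.Im (u n - Complex l1 l2) = complex.Im (u n) - l2 by case: (u n).
by rewrite mulr2n mulrDl !mul1r lerD.
Qed.

Definition pseries b z : C := limn (series (fun n => b n * z ^+ n)).

Lemma cvg_cplxP (u : nat -> C) (l : C) : u @ \oo --> l <->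
  (forall e : R, 0 < e -> exists N, forall n, (N <= n)%N -> normc (u n - l) <= e).
Proof.
split=> [/cvg_normcP/cvgrPdist_le H e e0|H].
  have [N _ hN] := H e e0; exists N => n /hN.
  by rewrite /= sub0r normrN ger0_norm ?normc_ge0.
apply/cvg_normcP/cvgrPdist_le => e e0.
have [N hN] := H e e0; exists N => // n /hN.
by rewrite sub0r normrN ger0_norm ?normc_ge0.
Qed.

Lemma limn_unique (u : nat -> C) (l : C) : u @ \oo --> l -> limn u = l.
Proof. by move=> ul; apply: cvg_lim => //; exact: norm_hausdorff. Qed.

(* [q] and [r] are such that [|z| <= q r] and the coefficients are bounded by
   [K r^-n]: the tails are then dominated by those of a geometric series. *)
Lemma pseries_tail b z r q K : 0 < r -> 0 <= q < 1 -> normc z <= q * r ->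
  (forall n, normc (b n) * r ^+ n <= K) ->
  (psum b ^~ z) n @[n --> \oo] --> pseries b z /\
  forall n, normc (psum b n z - pseries b z) <= 2 * (K * (q ^+ n / (1 - q))).
Proof.
move=> r0 q01 zq bK; have [q0 q1] := andP q01.
have [l hl] := @complex_limit_exists (psum b ^~ z) _
  (fun n m => psum_tail n m r0 q01 zq bK).
have q1' : 0 < 1 - q by rewrite subr_gt0.
have cl : (psum b ^~ z) n @[n --> \oo] --> l.
  apply/cvg_cplxP => e e0.
  have [N hN] := geometric_small (2 * K / (1 - q)) q01 e0.
  exists N => n /hN h; apply: le_trans (hl n) _; apply: le_trans h.
  by rewrite le_eqVlt; apply/orP; left; apply/eqP; ring.
have -> : pseries b z = l by rewrite /pseries -psum_series; exact: limn_unique.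
by [].
Qed.

Lemma adm_radius b z : adm b -> normc z < 1 ->
  exists r q K, [/\ 0 < r < 1, 0 <= q < 1, normc z < q * r &
    forall n, normc (b n) * r ^+ n <= K].
Proof.
move=> ab z1.
pose s := (1 + normc z) / 2.
have z0 := normc_ge0 z.
have s01 : 0 < s < 1 by rewrite /s; lra.
pose r := (1 + s) / 2; have r01 : 0 < r < 1 by rewrite /r; lra.
have [K hK] := ab r r01.
have [r0 r1] := andP r01; have [s0 s1] := andP s01.
have sr : s < r by rewrite /r; lra.
exists r, (s / r), K; split=> //.
  apply/andP; split; first by rewrite divr_ge0// ltW.
  by rewrite ltr_pdivrMr// mul1r.
by rewrite divfK ?gt_eqF//; rewrite /s; lra.
Qed.

Lemma pseries_cvg b z : adm b -> normc z < 1 ->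
  (psum b ^~ z) n @[n --> \oo] --> pseries b z.
Proof.
move=> ab /(adm_radius ab)[r [q [K [/andP[r0 _] q01 /ltW zq bK]]]].
by have [] := pseries_tail r0 q01 zq bK.
Qed.

Lemma cvg_unique_cplx (u : nat -> C) (k l : C) : u @ \oo --> k -> u @ \oo --> l -> k = l.
Proof. by move=> /limn_unique <- /limn_unique <-. Qed.

Lemma ccont_uniform_limit (f : C -> C) z : (forall e : R, 0 < e -> exists p,
  ccont p z /\ cnear z (fun w => normc (f w - p w) <= e)) -> ccont f z.
Proof.
move=> H e e0; have e3 : 0 < e / 3 by rewrite divr_gt0.
have [p [cp hp]] := H _ e3.
apply: cnearS (cnearI hp (cp _ e3)) => w [h1 h2].
have h3 := cnear_refl hp.
have -> : f w - f z = (f w - p w) + (p w - p z) - (f z - p z) by ring.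
apply: le_trans (ler_normcB _ _) _; have := ler_normcD (f w - p w) (p w - p z); lra.
Qed.

Lemma ccont_sum (I : Type) (s : seq I) (F : I -> C -> C) z :
  (forall i, ccont (F i) z) -> ccont (fun w => \sum_(i <- s) F i w) z.
Proof.
move=> cF; elim: s => [|i s IH].
  apply: ccont_near (@ccont_cst R 0 z); apply: cnearW => w.
  by rewrite big_nil.
apply: ccont_near (ccontD (cF i) IH); apply: cnearW => w.
by rewrite big_cons.
Qed.

Definition dseq b n : C := n.+1%:R * b n.+1.

Lemma adm_dseq b : adm b -> adm (dseq b).
Proof.
move=> ab r /andP[r0 r1].
pose s := (1 + r) / 2; have s01 : 0 < s < 1 by rewrite /s; lra.
have [s0 _] := andP s01.
have [K hK] := ab s s01.
pose q := r / s.
have rs : r < s by rewrite /s; lra.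
have q01 : 0 <= q < 1.
  apply/andP; split; first by rewrite divr_ge0// ltW.
  by rewrite ltr_pdivrMr// mul1r.
have K0 : 0 <= K by apply: le_trans (hK 0%N); rewrite mulr_ge0 ?normc_ge0 ?exprn_ge0 ?ltW.
exists (K / s * ((1 - q)^-1 + (1 - q)^-1)) => n.
have rE : r ^+ n = q ^+ n * s ^+ n by rewrite -exprMn /q divfK// gt_eqF.
have h1 : normc (b n.+1) * s ^+ n <= K / s.
  by rewrite ler_pdivlMr// -mulrA -exprSr.
rewrite normcM normc_nat rE.
have -> : n.+1%:R * normc (b n.+1) * (q ^+ n * s ^+ n) =
   normc (b n.+1) * s ^+ n * (n%:R * q ^+ n + q ^+ n) by rewrite -natr1; ring.
have [q0 q1] := andP q01.
apply: ler_pM; rewrite ?mulr_ge0 ?addr_ge0 ?mulr_ge0 ?exprn_ge0 ?normc_ge0 ?(ltW s0)//.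
apply: lerD; first exact: natmul_geometric.
apply: (@le_trans _ _ 1); first by rewrite exprn_ile1// ltW.
by rewrite invf_ge1 ?subr_gt0// gerBl.
Qed.

(** The slope of [psum b N] between [z] and [w], with [w ^+ n - z ^+ n] divided by [w - z] as a
    polynomial, hence meaningful at [w = z] too. *)
Let qsum b N z w : C := \sum_(0 <= n < N) b n * \sum_(k < n) w ^+ (n.-1 - k) * z ^+ k.

Let qsumE b N z w : psum b N w - psum b N z = qsum b N z w * (w - z).
Proof.
rewrite /psum /qsum -sumrB mulr_suml; apply: eq_bigr => n _.
by rewrite -mulrBr subrXX (mulrC (w - z)) mulrA.
Qed.

Let quotient_limit_bound (A B S g h Q d : C) e : A - B = S * d ->
  normc (A - g) <= e / 3 -> normc (B - h) <= e / 3 -> normc ((S - Q) * d) <= e / 3 ->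
  normc (Q * d - (g - h)) <= e.
Proof.
move=> E h1 h2 h3.
have -> : Q * d - (g - h) = (A - g) - (B - h) - (S - Q) * d.
  by rewrite mulrBl -E; ring.
have := ler_normcB (A - g - (B - h)) ((S - Q) * d).
have := ler_normcB (A - g) (B - h); lra.
Qed.

(** Near [z] the slopes [qsum] of the partial sums are dominated by the derivative series at radius
    [s]. Their uniform limit [Q] is therefore continuous; it is the slope of the sum, and at [z] it
    equals the derivative series. *)
Lemma cderive_pseries b z : adm b -> normc z < 1 ->
  cderive (pseries b) z (pseries (dseq b) z).
Proof.
move=> ab z1.
have [r [q [K [/andP[r0 r1] q01 zq dK]]]] := adm_radius (adm_dseq ab) z1.
have [q0 q1] := andP q01.
pose s := q * r.
have q1' : 0 < 1 - q by rewrite subr_gt0.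
have s1 : s < 1 by rewrite /s; nra.
have s0 : 0 <= s by rewrite mulr_ge0// ltW.
have near_s : cnear z (fun w => normc w <= s).
  exists (s - normc z); first by rewrite subr_gt0.
  move=> w hw; rewrite -(subrK z w); apply: le_trans (ler_normcD _ _) _; lra.
have term n w : normc w <= s ->
    normc (b n.+1 * \sum_(k < n.+1) w ^+ (n - k) * z ^+ k) <= normc (dseq b n) * s ^+ n.
  move=> ws; rewrite /dseq !normcM normc_nat -mulrA mulrCA; apply: ler_wpM2l; first exact: normc_ge0.
  apply: le_trans (normc_sum _ _ _) _.
  have -> : n.+1%:R * s ^+ n = \sum_(k < n.+1) s ^+ n by rewrite sumr_const card_ord mulr_natl.
  apply: ler_sum => k _; rewrite normcM !normcX.
  have -> : s ^+ n = s ^+ (n - k) * s ^+ k by rewrite -exprD subnK// -ltnS.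
  by apply: ler_pM; rewrite ?exprn_ge0 ?normc_ge0//; apply: lerXn2r;
    rewrite ?nnegrE ?normc_ge0//; exact: ltW.
have qtail w n m : normc w <= s ->
    normc (qsum b (n + m).+1 z w - qsum b n.+1 z w) <= K * (q ^+ n / (1 - q)).
  move=> ws.
  have -> : qsum b (n + m).+1 z w - qsum b n.+1 z w =
     \sum_(n <= i < n + m) b i.+1 * \sum_(k < i.+1) w ^+ (i - k) * z ^+ k.
    rewrite /qsum (big_cat_nat (n := n.+1) (p := (n + m).+1)) ?ltnS ?leq_addr//=.
    by rewrite addrAC subrr add0r big_add1.
  apply: le_trans (normc_sum _ _ _) _.
  have K0 : 0 <= K by apply: le_trans (dK 0%N); rewrite mulr_ge0 ?normc_ge0 ?exprn_ge0 ?ltW.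
  apply: le_trans (ler_wpM2l K0 (geometric_tail n m q01)).
  rewrite mulr_sumr; apply: ler_sum => i _; apply: le_trans (term i w ws) _.
  rewrite /s exprMn mulrCA mulrC; apply: ler_wpM2r; first by rewrite exprn_ge0.
  exact: dK.
pose Q w := limn (fun n => qsum b n.+1 z w).
have hQ w : normc w <= s -> (fun n => qsum b n.+1 z w) @ \oo --> Q w /\
    forall n, normc (qsum b n.+1 z w - Q w) <= 2 * (K * (q ^+ n / (1 - q))).
  move=> ws.
  have [l hl] := @complex_limit_exists (fun n => qsum b n.+1 z w) _ (fun n m => qtail w n m ws).
  have cl : (fun n => qsum b n.+1 z w) @ \oo --> l.
    apply/cvg_cplxP => e e0.
    have [N hN] := geometric_small (2 * K / (1 - q)) q01 e0.
    exists N => n /hN h; apply: le_trans (hl n) _; apply: le_trans h.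
    by rewrite le_eqVlt; apply/orP; left; apply/eqP; ring.
  have -> : Q w = l by exact: limn_unique.
  by [].
apply/cderive_quotient; exists Q; split.
- apply: ccont_uniform_limit => e e0.
  have [N hN] := geometric_small (2 * K / (1 - q)) q01 e0.
  exists (qsum b N.+1 z); split.
    apply: ccont_sum => n; apply: ccontM; first exact: ccont_cst.
    apply: ccont_sum => k; apply: ccontM; last exact: ccont_cst.
    by apply: ccontX; exact: ccont_id.
  apply: cnearS near_s => w ws; have [_ h] := hQ w ws.
  rewrite normcBC; apply: le_trans (h N) _; apply: le_trans (hN N (leqnn _)).
  by rewrite le_eqVlt; apply/orP; left; apply/eqP; ring.
- have [h _] := hQ z (ltW zq).
  apply: (cvg_unique_cplx h).
  have -> : (fun n => qsum b n.+1 z z) = (fun n => psum (dseq b) n z).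
    apply/funext => n; rewrite /qsum /psum big_nat_recl// big_ord0 mulr0 add0r.
    apply: eq_bigr => i _; rewrite (eq_bigr (fun=> z ^+ i)) => [|k _].
      by rewrite sumr_const card_ord /dseq -mulr_natl; ring.
    by rewrite -exprD /= subnK// -ltnS.
  exact: pseries_cvg (adm_dseq ab) z1.
- apply: cnearS near_s => w ws; have w1 : normc w < 1 by apply: le_lt_trans s1.
  have h1 := pseries_cvg ab w1; have h2 := pseries_cvg ab z1.
  have [h3 _] := hQ w ws.
  suff -> : Q w * (w - z) = pseries b w - pseries b z by rewrite subrKC.
  apply/eqP; rewrite -subr_eq0 -normc_eq0 eq_le normc_ge0 andbT.
  apply/ler_addgt0Pr => e e0; rewrite add0r.
  have W0 : 0 < normc (w - z) + 1 by rewrite ltr_wpDl ?normc_ge0.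
  have e3 : 0 < e / 3 by rewrite divr_gt0.
  have e3' : 0 < e / 3 / (normc (w - z) + 1) by rewrite divr_gt0.
  have [N1 k1] := proj1 (cvg_cplxP _ _) h1 _ e3.
  have [N2 k2] := proj1 (cvg_cplxP _ _) h2 _ e3.
  have [N3 k3] := proj1 (cvg_cplxP _ _) h3 _ e3'.
  pose n := maxn N1 (maxn N2 N3).
  have n1 : (N1 <= n.+1)%N by rewrite leqW// leq_maxl.
  have n2 : (N2 <= n.+1)%N by rewrite leqW// leq_max leq_maxl orbT.
  have n3 : (N3 <= n)%N by rewrite !leq_max leqnn !orbT.
  move: {k1 k2 k3}(k1 _ n1) (k2 _ n2) (k3 _ n3) => k1 k2 k3.
  have k4 : normc ((qsum b n.+1 z w - Q w) * (w - z)) <= e / 3.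
    rewrite normcM -[leRHS](divfK (lt0r_neq0 W0)); apply: ler_pM; rewrite ?normc_ge0//.
    by rewrite lerDl.
  exact: (@quotient_limit_bound _ _ _ _ _ _ _ _ (qsumE b n.+1 z w) k1 k2 k4).
Qed.

End PowerSeries.

(** * Primitive roots of unity of order a power of 2 *)

Section RootsOfUnity.
Variable R : realType.
Local Notation C := (Cplx R).

(** For order [2 ^ m.+1], iterated square roots give [u ^+ (2 ^ m) = -1]. A smaller [d] is [2 ^ s]
    times an odd number, and raising [u ^+ d] to the power [2 ^ (m - s)] gives an odd power of
    -1. *)
Lemma dyadic_root m : exists2 u : C, normc u = 1 &
  u ^+ (2 ^ m) = 1 /\ forall d, (0 < d < 2 ^ m)%N -> u ^+ d != 1.
Proof.
have n21 : (2 : C) != 0 by rewrite -normc_gt0 normc_nat.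
have half k : exists u : C, u ^+ (2 ^ k) = -1.
  elim: k => [|k [u hu]]; first by exists (-1); rewrite expr1.
  by exists (sqrtc u); rewrite expnS exprM sqr_sqrtc.
case: m => [|m].
  by exists 1; [exact: normc1|split=> [|[|d]]; rewrite ?expr1n// expn0 ltnS ltn0 andbF].
have [u hu] := half m; exists u.
  apply/eqP; rewrite -(@eqrXn2 _ (2 ^ m))// ?normc_ge0 ?expn_gt0//.
  by rewrite expr1n -normcX hu normcN normc1.
split; first by rewrite expnS mulnC exprM hu expr2 mulrNN mulr1.
move=> d /andP[d0 dm]; apply/eqP => ud.
have [od cop dE] := pfactor_coprime (isT : prime 2) d0.
set s := logn 2 d in dE.
have o0 : (0 < od)%N by case: od cop dE d0 => // _ -> ; rewrite mul0n.
have sm : (s <= m)%N.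
  by rewrite -ltnS -(ltn_exp2l _ _ (isT : 1 < 2)%N) (leq_ltn_trans _ dm)// dE leq_pmull.
have : u ^+ (d * 2 ^ (m - s)) = 1 by rewrite exprM ud expr1n.
rewrite dE -mulnA -expnD subnKC// mulnC exprM hu.
rewrite -signr_odd; rewrite coprime2n in cop; rewrite cop expr1 => E.
have : normc (1 - -1 : C) = 0 by rewrite E subrr normc0.
rewrite opprK -[1 + 1]/(2%:R) normc_nat => /eqP; by rewrite pnatr_eq0.
Qed.

Lemma dyadic_roots : exists us : nat -> C, forall m, normc (us m) = 1 /\
  (us m ^+ (2 ^ m) = 1 /\ forall d, (0 < d < 2 ^ m)%N -> us m ^+ d != 1).
Proof.
have H m : exists u : C, normc u = 1 /\
    (u ^+ (2 ^ m) = 1 /\ forall d, (0 < d < 2 ^ m)%N -> u ^+ d != 1).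
  by have [u u1 hu] := dyadic_root m; exists u.
by have [us hus] := choice H; exists us.
Qed.

End RootsOfUnity.

(** * Fatou's lemma and Parseval's identity for radial weights *)

Section WeightedFatou.
Local Open Scope ereal_scope.
Variable R : realType.
Local Notation C := (Cplx R).
Implicit Types (a : C -> R) (w : C -> \bar R).

Lemma limn_einf_ge (u : nat -> \bar R) (x : \bar R) :
  (exists N, forall n, (N <= n)%N -> x <= u n) -> x <= limn_einf u.
Proof.
move=> [N hN]; rewrite limn_einf_lim.
have -> : limn (einfs u) = ereal_sup (range (einfs u)).
  by apply/cvg_lim => //; exact: cvg_einfs_sup.
apply: (@le_trans _ _ (einfs u N)); last by apply: ereal_sup_ubound; exists N.
by apply: le_ereal_inf_tmp => _ [n /= Nn <-]; exact: hN.
Qed.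

Lemma limn_einf_le (u : nat -> \bar R) (x : \bar R) :
  (forall n, u n <= x) -> limn_einf u <= x.
Proof.
move=> H; rewrite limn_einf_lim; apply: lime_le; first exact: is_cvg_einfs.
apply: nearW => n; apply: le_trans (H n).
by apply: ereal_inf_lbound; exists n => /=.
Qed.

Lemma cintegral_le (f g : C -> \bar R) : cmeasurable f -> cmeasurable g ->
  (forall z, 0 <= f z) -> (forall z, f z <= g z) -> cintegral f <= cintegral g.
Proof. by move=> mf mg f0 fg; apply: ge0_le_integral. Qed.

(** Fatou's lemma uses only eventual lower bounds, and only where the weight is nonzero. Where the
    weight is [+oo] and [a z > 0], it is enough that [a_ n z] stays above [a z / 2]. *)
Lemma weighted_fatou (a_ : nat -> C -> R) a w (M : \bar R) :
  (forall n, cmeasurable (fun z => (a_ n z)%:E * w z)) ->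
  cmeasurable (fun z => (a z)%:E * w z) ->
  (forall n z, 0 <= a_ n z)%R -> (forall z, 0 <= a z)%R -> (forall z, 0 <= w z) ->
  (forall z, w z != 0 -> forall e : R, (0 < e)%R ->
    exists N, forall n, (N <= n)%N -> (a z - e <= a_ n z)%R) ->
  (forall n, cintegral (fun z => (a_ n z)%:E * w z) <= M) ->
  cintegral (fun z => (a z)%:E * w z) <= M.
Proof.
move=> ma_ ma a_0 a0 w0 lim HM.
have f0 n z : 0 <= (a_ n z)%:E * w z by rewrite mule_ge0// lee_fin.
have key z : (a z)%:E * w z <= limn_einf (fun n => (a_ n z)%:E * w z).
  have [wz|wz] := eqVneq (w z) 0.
    by rewrite wz mule0; apply: limn_einf_ge; exists 0%N => n _; rewrite mule0.
  have {}lim := lim z wz.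
  have := w0 z; move: wz; case: (w z) => [r| |//] wz r0.
    apply/lee_addgt0Pr => e e0.
    rewrite lee_fin in r0; have r1 : (0 < r)%R by rewrite lt_neqAle r0 andbT eq_sym -eqe.
    have er : (0 < e / r)%R by rewrite divr_gt0.
    have [N hN] := lim _ er.
    rewrite -leeBlDr//; apply: limn_einf_ge; exists N => n /hN h.
    rewrite -!EFinM -EFinB lee_fin; move: h; rewrite lerBlDr -lerBlDl => h.
    have : ((a z - a_ n z) * r <= e)%R by rewrite -ler_pdivlMr.
    by rewrite mulrBl; lra.
  have := a0 z; rewrite le_eqVlt => /predU1P[<-|az].
    by rewrite mul0e; apply: limn_einf_ge; exists 0%N => n _; rewrite mule_ge0// lee_fin.
  have a2 : (0 < a z / 2)%R by rewrite divr_gt0.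
  have [N hN] := lim _ a2.
  apply: limn_einf_ge; exists N => n /hN h.
  by rewrite [leRHS]gt0_muley ?leey// lte_fin; lra.
have mlim : measurable_fun setT (fun p : plane R =>
    limn_einf (fun n => (a_ n (to_cplx p))%:E * w (to_cplx p))).
  rewrite /limn_einf; apply: measurableT_comp => //.
  apply: (measurable_fun_limn_esup (f := fun n (p : plane R) => - ((a_ n (to_cplx p))%:E * w (to_cplx p)))).
  by move=> n; apply: measurableT_comp => //; exact: ma_.
apply: (@le_trans _ _ (\int[@plane_measure R]_p
    limn_einf (fun n => (a_ n (to_cplx p))%:E * w (to_cplx p)))).
  apply: ge0_le_integral => //.
  by move=> p _; rewrite mule_ge0// lee_fin.
apply: le_trans (fatou _ _ _ _) _ => //.
exact: limn_einf_le.
Qed.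

(** Convergence is known on the disc only; cutting [a] off to 0 outside leaves the product
    unchanged, as the weight vanishes there. *)
Lemma cmeasurable_disc_limit (a_ : nat -> C -> R) a w :
  (forall n, measurable_fun setT (a_ n \o @to_cplx R)) -> cmeasurable w ->
  (forall z, (1 <= normc z)%R -> w z = 0) ->
  (forall z, (normc z < 1)%R -> a_ ^~ z @ \oo --> a z) ->
  cmeasurable (fun z => (a z)%:E * w z).
Proof.
move=> ma_ mw wD lim.
pose a' z : R := if (normc z < 1)%R then a z else 0%R.
have -> : (fun z => (a z)%:E * w z) = (fun z => (a' z)%:E * w z).
  apply/funext => z; rewrite /a'; case: ltP => // /wD ->.
  by rewrite !mule0.
apply: emeasurable_funM => //; apply/measurable_EFinP.
have mD : measurable_fun setT (fun p : plane R => (normc (to_cplx p) < 1)%R).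
  by apply: measurable_fun_ltr; [apply: measurable_normc; exact: cmfun_to_cplx|exact: measurable_cst].
apply: (measurable_fun_cvg (h := fun n (p : plane R) =>
    if (normc (to_cplx p) < 1)%R then a_ n (to_cplx p) else 0%R)).
  move=> n; apply: measurable_fun_ifT => //; exact: ma_.
move=> p _ /=; rewrite /a'; case: ltP => h; first exact: lim.
exact: cvg_cst.
Qed.

End WeightedFatou.

Section Parseval.
Local Open Scope ereal_scope.
Variable R : realType.
Local Notation C := (Cplx R).
Implicit Types (b : nat -> C) (u z : C) (w : C -> \bar R) (g : C -> C).

(** The mean of [|psum b N|^2] over the circle through [z]. *)
Definition ssum b N z : R := (\sum_(0 <= n < N) normc (b n) ^+ 2 * normc z ^+ (2 * n))%R.

(** A discrete circle mean of [|g|^2], taken with [u] an N-th root of unity. *)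
Definition mean u N g z : R := ((\sum_(k < N) normc (g (u ^+ k * z)%R) ^+ 2) / N%:R)%R.

Definition radial_weight w := [/\ cmeasurable w, forall z, 0 <= w z,
  forall u z, normc u = 1%R -> w (u * z)%R = w z &
  forall z, (1 <= normc z)%R -> w z = 0].

Local Open Scope ring_scope.

Lemma root_sum (x : C) N : x ^+ N = 1 -> x != 1 -> \sum_(k < N) x ^+ k = 0.
Proof.
move=> xN x1; have := subrX1 x N; rewrite xN subrr => /esym/eqP.
by rewrite mulf_eq0 subr_eq0 (negbTE x1) => /eqP.
Qed.

Lemma ssum_ge0 b N z : 0 <= ssum b N z.
Proof. by apply: sumr_ge0 => n _; rewrite mulr_ge0// exprn_ge0// normc_ge0. Qed.

Lemma ssum_le b N M z : (N <= M)%N -> ssum b N z <= ssum b M z.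
Proof.
move=> NM; rewrite /ssum (big_cat_nat (n := N) (p := M))//= lerDl.
by apply: sumr_ge0 => n _; rewrite mulr_ge0// exprn_ge0// normc_ge0.
Qed.

(* The average over the rotations by an N-th root of unity cancels the cross
   terms of [|psum b N|^2]. *)
Lemma mean_psum u N b z : normc u = 1 -> u ^+ N = 1 ->
  (forall d, (0 < d < N)%N -> u ^+ d != 1) -> (0 < N)%N ->
  mean u N (psum b N) z = ssum b N z.
Proof.
move=> u1 uN ud N0; have N0' : N%:R != 0 :> R by rewrite pnatr_eq0 -lt0n.
have uu : u * (u^*)%C = 1 by rewrite mul_conjE u1 expr1n.
pose x (i j : nat) := u ^+ i * (u^*)%C ^+ j.
have xN i j : x i j ^+ N = 1.
  rewrite /x exprMn -!exprM !(mulnC _ N) !exprM uN expr1n mul1r.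
  by rewrite -rmorphXn uN rmorph1 expr1n.
have xne i j : (i < N)%N -> (j < N)%N -> i != j -> x i j != 1.
  move=> iN jN; rewrite /x neq_ltn => /orP[ij|ij].
    rewrite -(subnK (ltnW ij)) exprD mulrCA -exprMn uu expr1n mulr1.
    have := ud (j - i)%N; rewrite subn_gt0 ij (leq_ltn_trans (leq_subr _ _) jN) => /(_ isT).
    by apply: contra => /eqP E; rewrite -(inj_eq (can_inj (@conjcK R))) rmorphXn rmorph1 E.
  rewrite -(subnK (ltnW ij)) exprD -mulrA -exprMn uu expr1n mulr1.
  by apply: ud; rewrite subn_gt0 ij (leq_ltn_trans (leq_subr _ _) iN).
apply: (mulIf N0'); rewrite /mean divfK//.
apply: (@complexI R); rewrite rmorph_sum /=.
pose t i := b i * z ^+ i.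
have E k : ((normc (psum b N (u ^+ k * z)) ^+ 2)%:C)%C =
    \sum_(i < N) \sum_(j < N) t i * ((t j)^*)%C * x i j ^+ k :> C.
  rewrite -mul_conjE /psum big_mkord rmorph_sum /= mulr_suml; apply: eq_bigr => i _.
  rewrite mulr_sumr; apply: eq_bigr => j _.
  rewrite /t /x !exprMn !conj_mul !conj_exp -!exprM !(mulnC k).
  by move: (u ^+ _) (z ^+ _) ((u^*)%C ^+ _) ((z^*)%C ^+ _) => *; ring.
rewrite (eq_bigr _ (fun (k : 'I_N) _ => E k)) exchange_big /=.
rewrite /ssum big_mkord mulr_suml rmorph_sum /=; apply: eq_bigr => i _.
rewrite exchange_big /= (bigD1 i)//= [X in _ + X]big1 => [|j ji].
  rewrite addr0 -mulr_sumr (eq_bigr (fun=> 1)) => [|k _].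
    rewrite sumr_const card_ord mul_conjE /t normcM normcX exprMn -exprM mulnC.
    by rewrite [in RHS]rmorphM /= -(rmorph_nat (real_complex R)).
  by rewrite /x -exprMn uu !expr1n.
by rewrite -mulr_sumr root_sum ?mulr0//; apply: xne => //; rewrite eq_sym.
Qed.

Lemma sqr_normc_lower (x y : C) (G d : R) : normc x <= G -> normc (x - y) <= d ->
  normc x ^+ 2 - 2 * G * d <= normc y ^+ 2.
Proof.
move=> xG xyd; have x0 := normc_ge0 x; have y0 := normc_ge0 y.
have h := lerB_normcB x (x - y); rewrite opprB subrKC in h.
have d0 : 0 <= d by apply: le_trans xyd; exact: normc_ge0.
have h2 : normc x - d <= normc y by lra.
have : normc x * d <= G * d by apply: ler_wpM2r.
have : 0 <= G * d by rewrite mulr_ge0// (le_trans x0).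
have [xd|dx] := leP (normc x) d.
  have : normc x * normc x <= normc x * d by apply: ler_wpM2l.
  have : 0 <= normc y ^+ 2 by rewrite exprn_ge0.
  rewrite !expr2; lra.
have : (normc x - d) ^+ 2 <= normc y ^+ 2 by apply: lerXn2r; rewrite ?nnegrE//; lra.
have : 0 <= d ^+ 2 by rewrite exprn_ge0.
have -> : (normc x - d) ^+ 2 = normc x ^+ 2 - 2 * (normc x * d) + d ^+ 2 by ring.
lra.
Qed.

Lemma psum_bounds b z : adm b -> normc z < 1 -> exists2 G : R, 0 < G &
  (forall v N, normc v <= normc z -> normc (psum b N v) <= G /\ normc (pseries b v) <= G) /\
  forall e, 0 < e -> exists N0, forall N v, (N0 <= N)%N -> normc v <= normc z ->
    normc (psum b N v - pseries b v) <= e.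
Proof.
move=> ab z1; have [r [q [K [/andP[r0 r1] q01 /ltW zq bK]]]] := adm_radius ab z1.
have [q0 q1] := andP q01; have q1' : 0 < 1 - q by rewrite subr_gt0.
have K0 : 0 <= K by apply: le_trans (bK 0%N); rewrite mulr_ge0 ?normc_ge0 ?exprn_ge0 ?ltW.
have vq v : normc v <= normc z -> normc v <= q * r by move=> /le_trans; apply.
have KQ : 0 <= K * (q ^+ 0 / (1 - q)).
  by rewrite expr0 div1r mulr_ge0// invr_ge0 ltW.
exists (3 * (K * (q ^+ 0 / (1 - q))) + 1); first lra.
split=> [v N /vq vqr|e e0].
  have h1 := psum_tail 0 N r0 q01 vqr bK; rewrite psum0 subr0 add0n in h1.
  have [_ h2] := pseries_tail r0 q01 vqr bK; move: (h2 0%N); rewrite psum0 sub0r normcN.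
  by split; lra.
have [N0 hN0] := geometric_small (2 * K / (1 - q)) q01 e0.
exists N0 => N v /hN0 h /vq vqr; have [_ h2] := pseries_tail r0 q01 vqr bK.
apply: le_trans (h2 N) _; apply: le_trans h.
by rewrite le_eqVlt; apply/orP; left; apply/eqP; ring.
Qed.

(** Over the [2 ^ m] roots the mean of [|psum b (2 ^ m)|^2] is exactly [ssum]; replacing the partial
    sum by the series costs at most [e], because convergence is uniform on the circle. *)
Lemma mean_lower_bound b z (us : nat -> C) M e : adm b -> normc z < 1 ->
  (forall m, normc (us m) = 1 /\ (us m ^+ (2 ^ m) = 1 /\
    forall d, (0 < d < 2 ^ m)%N -> us m ^+ d != 1)) -> 0 < e ->
  exists N, forall m, (N <= m)%N ->
    ssum b M z - e <= mean (us m) (2 ^ m) (pseries b) z.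
Proof.
move=> ab z1 hus e0.
have [G G0 [hG hN]] := psum_bounds ab z1.
have eG : 0 < e / (2 * G) by rewrite divr_gt0// mulr_gt0.
have [N1 hN1] := hN _ eG.
exists (maxn N1 M) => m; rewrite geq_max => /andP[N1m Mm].
have [u1 [um ud]] := hus m.
have m2 : (m <= 2 ^ m)%N by rewrite ltnW// ltn_expl.
have p0 : (0 < 2 ^ m)%N by rewrite expn_gt0.
have p0' : 0 < (2 ^ m)%:R :> R by rewrite ltr0n.
apply: (@le_trans _ _ (ssum b (2 ^ m) z - e)).
  by rewrite lerB// ssum_le// (leq_trans Mm).
rewrite -(mean_psum b z u1 um ud p0) /mean ler_pdivlMr// mulrBl divfK ?gt_eqF//.
have -> : e * (2 ^ m)%:R = \sum_(k < 2 ^ m) e by rewrite sumr_const card_ord mulr_natr.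
rewrite -sumrB; apply: ler_sum => k _.
have nv : normc (us m ^+ k * z) <= normc z by rewrite normcM normcX u1 expr1n mul1r.
have -> : e = 2 * G * (e / (2 * G)) by field; rewrite gt_eqF.
apply: sqr_normc_lower; first by have [] := hG _ (2 ^ m)%N nv.
by apply: hN1 => //; exact: leq_trans m2.
Qed.

(** On the circle of radius 1/2 the means of the zero function bound every [ssum], and with it each
    of its nonnegative terms. *)
Lemma pseries_eq0 b : adm b -> (forall z, normc z < 1 -> pseries b z = 0) -> forall n, b n = 0.
Proof.
move=> ab b0 n.
have [us hus] := dyadic_roots R.
pose z : C := ((2^-1)%:C)%C.
have nz : normc z = 2^-1 by rewrite normc_real gtr0_norm.
have z1 : normc z < 1 by rewrite nz; lra.
have h : ssum b n.+1 z <= 0.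
  apply/ler_addgt0Pr => e e0; rewrite add0r.
  have [N /(_ N (leqnn N))] := mean_lower_bound n.+1 ab z1 hus e0.
  rewrite /mean big1 => [|k _]; first by rewrite mul0r; lra.
  rewrite b0 ?normc0 ?expr0n//; have [u1 _] := hus N.
  by rewrite normcM normcX u1 expr1n mul1r.
have : normc (b n) ^+ 2 * normc z ^+ (2 * n) <= 0.
  apply: le_trans h; rewrite /ssum big_nat_recr//= lerDr.
  by apply: sumr_ge0 => i _; rewrite mulr_ge0// exprn_ge0// normc_ge0.
rewrite nz pmulr_lle0 ?exprn_gt0// => h2; apply/eqP; rewrite -normc_eq0 -sqrf_eq0.
by rewrite eq_le h2 sqr_ge0.
Qed.

Lemma cmfun_psum b N : cmfun (psum b N \o @to_cplx R).
Proof.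
apply: cmfun_sum => n; apply: cmfunM; first exact: cmfun_cst.
by apply: cmfunX; exact: cmfun_to_cplx.
Qed.

Lemma measurable_sqr_psum b N : measurable_fun setT ((fun z => normc (psum b N z) ^+ 2) \o @to_cplx R).
Proof. by apply: measurable_funX; apply: measurable_normc; exact: cmfun_psum. Qed.

Lemma sqr_psum_cvg b z : adm b -> normc z < 1 ->
  (normc (psum b N z) ^+ 2) @[N --> \oo] --> normc (pseries b z) ^+ 2.
Proof.
move=> ab z1; have [G G0 [hG hN]] := psum_bounds ab z1.
apply/cvgrPdist_le => e e0.
have eG : 0 < e / (2 * G) by rewrite divr_gt0// mulr_gt0.
have [N1 hN1] := hN _ eG.
exists N1 => // N /= Nn; have h := hN1 N z Nn (lexx _).
have [h1 h2] := hG z N (lexx _).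
have E : 2 * G * (e / (2 * G)) = e by field; rewrite gt_eqF.
have := sqr_normc_lower h1 h; rewrite normcBC in h.
have := sqr_normc_lower h2 h; rewrite E ler_norml; lra.
Qed.

Lemma cmeasurable_pseries b w : adm b -> radial_weight w ->
  cmeasurable (fun z => (normc (pseries b z) ^+ 2)%:E * w z)%E.
Proof.
move=> ab [mw w0 _ wD].
apply: (cmeasurable_disc_limit (a_ := fun N z => normc (psum b N z) ^+ 2)) => //.
  by move=> n; exact: measurable_sqr_psum.
by move=> z z1; exact: sqr_psum_cvg.
Qed.

Lemma cintegral_mean g w u N : radial_weight w -> normc u = 1 -> (0 < N)%N ->
  cmeasurable (fun z => (normc (g z) ^+ 2)%:E * w z)%E ->
  (cintegral (fun z => (mean u N g z)%:E * w z) =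
   cintegral (fun z => (normc (g z) ^+ 2)%:E * w z))%E.
Proof.
move=> [mw w0 wrad wD] u1 N0 mg.
pose h z : \bar R := ((normc (g z) ^+ 2)%:E * w z)%E.
have h0 z : (0 <= h z)%E by rewrite mule_ge0// lee_fin exprn_ge0// normc_ge0.
have uk k : normc (u ^+ k) = 1 by rewrite normcX u1 expr1n.
have uk0 k : u ^+ k != 0 by rewrite -normc_gt0 uk.
have Ni0 : 0 <= N%:R^-1 :> R by rewrite invr_ge0.
have mhk k : cmeasurable (fun z => h (u ^+ k * z)).
  apply: (cmeasurable_comp mg); apply: cmfunM; [exact: cmfun_cst|exact: cmfun_to_cplx].
have -> : (fun z => (mean u N g z)%:E * w z)%E =
    (fun z => \sum_(k < N) (N%:R^-1)%:E * h (u ^+ k * z)%R)%E.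
  apply/funext => z; rewrite /mean mulrC mulr_sumr -sumEFin ge0_sume_distrl; last first.
    by move=> k _; rewrite lee_fin mulr_ge0// exprn_ge0// normc_ge0.
  by apply: eq_bigr => k _; rewrite /h wrad// EFinM muleA.
rewrite /cintegral ge0_integral_sum//; last 2 first.
- by move=> k; apply: measurable_funeM; exact: (mhk k).
- by move=> k p _; apply: mule_ge0 => //; rewrite lee_fin.
rewrite (eq_bigr (fun=> (N%:R^-1)%:E * cintegral h)%E) => [|k _]; last first.
  rewrite -[LHS]/(cintegral (fun z => ((N%:R^-1)%:E * h (u ^+ k * z)%R)%E)).
  rewrite (cintegralZl _ (mhk k) (fun z => h0 _)) ?lee_fin//.
  by rewrite (cintegral_mul (uk0 k) mg h0) uk expr1n invr1 mul1e.
rewrite -ge0_sume_distrl; last by move=> k _; rewrite lee_fin.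
by rewrite sumEFin sumr_const card_ord -(mulr_natr (N%:R^-1)) mulVf ?mul1e// pnatr_eq0 -lt0n.
Qed.

Lemma cmeasurable_ssum b w N : radial_weight w -> cmeasurable (fun z => (ssum b N z)%:E * w z)%E.
Proof.
move=> [mw _ _ _]; apply: emeasurable_funM => //; apply/measurable_EFinP.
apply: measurable_sum => n; apply: measurable_funM; first exact: measurable_cst.
by apply: measurable_funX; apply: measurable_normc; exact: cmfun_to_cplx.
Qed.

(** One half of Parseval's identity. As the weight is radial, replacing [|pseries b|^2] by its root
    means keeps the integral, and Fatou's lemma applies because these means eventually exceed
    [ssum b N - e]. *)
Lemma parseval_ge b w N : adm b -> radial_weight w ->
  (cintegral (fun z => (ssum b N z)%:E * w z) <=
   cintegral (fun z => (normc (pseries b z) ^+ 2)%:E * w z))%E.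
Proof.
move=> ab rw; have [mw w0 wrad wD] := rw.
have [us hus] := dyadic_roots R.
have mg := cmeasurable_pseries ab rw.
have p0 m : (0 < 2 ^ m)%N by rewrite expn_gt0.
apply: (weighted_fatou (a_ := fun m z => mean (us m) (2 ^ m) (pseries b) z)) => //.
- move=> m.
  have -> : (fun z => (mean (us m) (2 ^ m) (pseries b) z)%:E * w z)%E =
    (fun z => \sum_(k < 2 ^ m) ((2 ^ m)%:R^-1)%:E *
      ((normc (pseries b (us m ^+ k * z)%R) ^+ 2)%R%:E * w (us m ^+ k * z)%R))%E.
    apply/funext => z; rewrite /mean mulrC mulr_sumr -sumEFin ge0_sume_distrl; last first.
      by move=> k _; rewrite lee_fin mulr_ge0// exprn_ge0// normc_ge0.
    apply: eq_bigr => k _; rewrite wrad ?EFinM ?muleA//.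
    by have [u1 _] := hus m; rewrite normcX u1 expr1n.
  apply: emeasurable_sum => k; apply: measurable_funeM.
  apply: (cmeasurable_comp mg); apply: cmfunM; [exact: cmfun_cst|exact: cmfun_to_cplx].
- exact: cmeasurable_ssum.
- move=> m z; rewrite /mean divr_ge0//; apply: sumr_ge0 => k _.
  by rewrite exprn_ge0// normc_ge0.
- by move=> z; exact: ssum_ge0.
- move=> z wz e e0; apply: mean_lower_bound => //.
  by rewrite ltNge; apply/negP => /wD wz0; rewrite wz0 eqxx in wz.
- by move=> m; have [u1 _] := hus m; rewrite cintegral_mean.
Qed.

(** The other half: Fatou's lemma along partial sums of [2 ^ m] terms, whose weighted integrals
    equal those of [ssum] by [mean_psum]. *)
Lemma parseval_le b w (M : \bar R) : adm b -> radial_weight w ->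
  (forall N, (cintegral (fun z => (ssum b N z)%:E * w z) <= M)%E) ->
  (cintegral (fun z => (normc (pseries b z) ^+ 2)%:E * w z) <= M)%E.
Proof.
move=> ab rw HM; have [mw w0 wrad wD] := rw.
have p0 m : (0 < 2 ^ m)%N by rewrite expn_gt0.
have mp N : cmeasurable (fun z => (normc (psum b N z) ^+ 2)%:E * w z)%E.
  by apply: emeasurable_funM => //; apply/measurable_EFinP; exact: measurable_sqr_psum.
apply: (weighted_fatou (a_ := fun m z => normc (psum b (2 ^ m) z) ^+ 2)) => //.
- exact: cmeasurable_pseries.
- by move=> m z; rewrite exprn_ge0// normc_ge0.
- by move=> z; rewrite exprn_ge0// normc_ge0.
- move=> z wz e e0.
  have z1 : normc z < 1 by rewrite ltNge; apply/negP => /wD wz0; rewrite wz0 eqxx in wz.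
  have /cvgrPdist_le /(_ e e0) [N _ hN] := sqr_psum_cvg ab z1.
  exists N => n Nn; have m2 : (n <= 2 ^ n)%N by rewrite ltnW// ltn_expl.
  by have := hN _ (leq_trans Nn m2); rewrite /= ler_norml; lra.
- move=> m; have [u u1 [um ud]] := dyadic_root R m.
  rewrite -(cintegral_mean rw u1 (p0 m) (mp _)).
  apply: le_trans (HM (2 ^ m)%N); rewrite le_eqVlt; apply/orP; left; apply/eqP.
  by apply: eq_cintegral => z; rewrite mean_psum.
Qed.

End Parseval.

(** * Moments of the Green function *)

Section Layer.
Variable R : realType.
Local Notation C := (Cplx R).
Local Notation mu := (@lebesgue_measure R).
Implicit Types (z : C) (k f F : R -> R) (n : nat).

Lemma integral_oo_derive f F (a b : R) : a < b ->
  (forall x, a <= x <= b -> is_derive x 1 F (f x)) ->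
  (forall x, a <= x <= b -> {for x, continuous f}) ->
  (\int[mu]_(x in `]a, b[) (f x)%:E = (F b - F a)%:E)%E.
Proof.
move=> ab dF cf.
have cw : {within `[a, b], continuous f}.
  by apply: continuous_in_subspaceT => x; rewrite inE /= in_itv /= => /cf.
have cF x : a <= x <= b -> {for x, continuous F}.
  by move=> /dF h; apply: differentiable_continuous; apply/derivable1_diffP; exact: ex_derive.
have mf : measurable_fun `]a, b[ (fun x => (f x)%:E).
  apply/measurable_EFinP; apply: subspace_continuous_measurable_fun => //.
  by apply: continuous_in_subspaceT => x; rewrite inE /= in_itv /= => /andP[ax xb]; apply: cf; rewrite !ltW.
have := @integral_itv_bndoo R a b (EFin \o f) true false mf; rewrite /= => <-.
rewrite (@continuous_FTC2 _ f F) ?EFinB//.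
- split.
  + move=> x; rewrite in_itv /= => /andP[ax xb].
    by have h : is_derive x 1 F (f x) by apply: dF; rewrite !ltW.
  + by apply: cvg_at_right_filter; apply: cF; rewrite lexx ltW.
  + by apply: cvg_at_left_filter; apply: cF; rewrite lexx ltW.
- move=> x; rewrite in_itv /= => /andP[ax xb].
  have h : is_derive x 1 F (f x) by apply: dF; rewrite !ltW.
  by rewrite derive1E derive_val.
Qed.

Lemma integral_oo_exprn (a c : R) n : 0 <= a < 1 ->
  (\int[mu]_(x in `]a, 1%R[) (c * `|x| ^+ n)%:E = (c / n.+1%:R * (1 - a ^+ n.+1))%:E)%E.
Proof.
move=> /andP[a0 a1].
have dF (x : R) : a <= x <= 1 ->
    is_derive x 1 (fun x : R => c / n.+1%:R * x ^+ n.+1) (c * x ^+ n).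
  move=> _; have h := @is_deriveX _ _ id n.+1 x 1 1 (is_derive_id x 1).
  have hx : is_derive x 1 (fun x : R => x ^+ n.+1) (n.+1%:R * x ^+ n).
    move: h; rewrite /GRing.scale /= mulr1.
    have -> : (id ^+ n.+1 : R -> R) = (fun x : R => x ^+ n.+1); last exact.
    by apply: funext => y; elim: (n.+1) => [|m IH]; rewrite ?expr0 ?exprS -?IH.
  have := is_deriveZ (c / n.+1%:R) hx.
  rewrite /GRing.scale /=.
  by have -> : c / n.+1%:R * (n.+1%:R * x ^+ n) = c * x ^+ n by rewrite mulrA divfK ?pnatr_eq0.
have cf (x : R) : a <= x <= 1 -> {for x, continuous (fun x : R => c * x ^+ n)}.
  move=> _; apply: cvgM; first exact: cvg_cst.
  exact: exprn_continuous.
have := integral_oo_derive a1 dF cf; rewrite expr1n -mulrBr => <-.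
apply: eq_integral => x; rewrite inE /= in_itv /= => /andP[ax _].
by rewrite ger0_norm//; apply: le_trans a0 _; exact: ltW.
Qed.

Lemma integral_oo_inv (a : R) : 0 < a < 1 ->
  (\int[mu]_(x in `]a, 1%R[) (`|x|^-1)%:E = (- ln a)%:E)%E.
Proof.
move=> /andP[a0 a1].
have dF (x : R) : a <= x <= 1 -> is_derive x 1 (@ln R) (x^-1).
  by move=> /andP[ax _]; apply: is_derive1_ln; exact: lt_le_trans ax.
have cf (x : R) : a <= x <= 1 -> {for x, continuous (fun x : R => x^-1)}.
  by move=> /andP[ax _]; apply: inv_continuous; rewrite gt_eqF//; exact: lt_le_trans ax.
have := integral_oo_derive a1 dF cf; rewrite ln1 sub0r => <-.
apply: eq_integral => x; rewrite inE /= in_itv /= => /andP[ax _].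
by rewrite ger0_norm//; apply: ltW; exact: lt_trans ax.
Qed.

Lemma integral_oo_inv0 : (\int[mu]_(x in `]0%R, 1%R[) (`|x|^-1)%:E = +oo)%E.
Proof.
have mi : measurable_fun setT (fun x : R => (`|x|^-1)%:E).
  by apply/measurable_EFinP; apply: measurable_fun_inv; exact: normr_measurable.
have i0 : (0 <= \int[mu]_(x in `]0%R, 1%R[) (`|x|^-1)%:E)%E.
  by apply: integral_ge0 => x _; rewrite lee_fin.
have lb a : 0 < a < 1 -> ((- ln a)%:E <= \int[mu]_(x in `]0%R, 1%R[) (`|x|^-1)%:E)%E.
  move=> a01; rewrite -integral_oo_inv//; case/andP: a01 => a0 _.
  apply: ge0_subset_integral => //; first exact: measurable_funTS.
  by move=> x /=; rewrite !in_itv /= => /andP[ax ->]; rewrite (lt_trans a0).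
move: i0 lb; case: (integral _ _ _) => [r r0 lb| //|//].
rewrite lee_fin in r0.
have h : 0 < expR (- (r + 1)) < 1 by rewrite expR_gt0 expR_lt1; lra.
by have := lb _ h; rewrite expRK lee_fin => ?; exfalso; lra.
Qed.

Definition disc_power n z : \bar R := if normc z < 1 then (normc z ^+ (2 * n))%:E else 0.

Lemma cmeasurable_disc_power n : cmeasurable (disc_power n).
Proof.
have mn : measurable_fun setT (fun p => normc (@to_cplx R p)).
  by apply: measurable_normc; exact: cmfun_to_cplx.
apply: measurable_fun_ifT.
- by apply: measurable_fun_ltr => //; exact: measurable_cst.
- by apply/measurable_EFinP; apply: measurable_funX.
- exact: measurable_cst.
Qed.

Lemma disc_power_ge0 n z : (0 <= disc_power n z)%E.
Proof. by rewrite /disc_power; case: ifP => // _; rewrite lee_fin exprn_ge0// normc_ge0. Qed.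

Lemma cintegral_dilate n (u : R) : 0 < u ->
  (cintegral (fun z => if (normc z ^+ 2 < u)%R then (normc z ^+ (2 * n))%:E else 0) =
   (u ^+ n.+1)%:E * cintegral (disc_power n))%E.
Proof.
move=> u0; pose s := Num.sqrt u; have s0 : 0 < s by rewrite sqrtr_gt0.
have su : s ^+ 2 = u by rewrite sqr_sqrtr// ltW.
pose c : C := (s^-1)%:C%C.
have nc : normc c = s^-1 by rewrite normc_real ger0_norm// invr_ge0 ltW.
have c0 : c != 0 by rewrite -normc_gt0 nc invr_gt0.
have := cintegral_mul c0 (cmeasurable_disc_power n) (disc_power_ge0 n).
rewrite nc exprVn invrK su => /(congr1 (fun x => (u ^+ n)%:E * x)%E).
rewrite muleA -EFinM -exprSr => <-.
rewrite -cintegralZl; last 3 first.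
- by rewrite lee_fin exprn_ge0// ltW.
- apply: (cmeasurable_comp (cmeasurable_disc_power n)); apply: cmfunM; [exact: cmfun_cst|exact: cmfun_to_cplx].
- by move=> z; exact: disc_power_ge0.
apply: eq_cintegral => z; rewrite /disc_power normcM nc.
have -> : (s^-1 * normc z < 1) = (normc z ^+ 2 < u).
  by rewrite mulrC ltr_pdivrMr// mul1r -su ltr_pXn2r// nnegrE ?normc_ge0 ?ltW.
case: ifP => _; last by rewrite mule0.
by rewrite -EFinM exprMn exprVn !exprM su mulVKf// expf_neq0// gt_eqF.
Qed.

(** Tonelli over the pairs with [|z|^2 < u < 1]: for fixed [u] the integral over the disc of radius
    [sqrt u] scales like [u ^+ n.+1]. *)
Lemma layer_cake k n : measurable_fun setT k -> (forall u, 0 <= k u) ->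
  (cintegral (fun z => (normc z ^+ (2 * n))%:E * \int[mu]_(u in `](normc z ^+ 2)%R, 1%R[) (k u)%:E) =
   (\int[mu]_(u in `]0%R, 1%R[) (k u * u ^+ n.+1)%:E) * cintegral (disc_power n))%E.
Proof.
move=> mk k0.
pose f (q : plane R * measurableTypeR R) : \bar R :=
  if (normc (to_cplx q.1) ^+ 2 < q.2) && (q.2 < 1)
  then (normc (to_cplx q.1) ^+ (2 * n) * k q.2)%:E else 0%E.
have f0 q : (0 <= f q)%E.
  by rewrite /f; case: ifP => // _; rewrite lee_fin mulr_ge0// exprn_ge0// normc_ge0.
have mn : measurable_fun setT (fun q : plane R * measurableTypeR R => normc (to_cplx q.1)).
  apply: measurable_normc; apply: cmfun_Complex.
    exact: (measurableT_comp measurable_fst measurable_fst).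
  exact: (measurableT_comp measurable_snd measurable_fst).
have mf : measurable_fun setT f.
  apply: measurable_fun_ifT.
  - apply: measurable_and; apply: measurable_fun_ltr => //; first exact: measurable_funX.
  - apply/measurable_EFinP; apply: measurable_funM; first exact: measurable_funX.
    exact: (measurableT_comp mk measurable_snd).
  - exact: measurable_cst.
have := @fubini_tonelli _ _ _ _ _ (@plane_measure R) mu f mf f0.
have -> : (\int[@plane_measure R]_p \int[mu]_u f (p, u) =
  cintegral (fun z => (normc z ^+ (2 * n))%:E * \int[mu]_(u in `](normc z ^+ 2)%R, 1%R[) (k u)%:E))%E.
  apply: eq_integral => p _; rewrite -ge0_integralZl//=; last 3 first.
  - by apply/measurable_EFinP; exact: measurable_funTS.
  - by move=> u _; rewrite lee_fin.
  - by rewrite lee_fin exprn_ge0// normc_ge0.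
  rewrite [RHS]integral_mkcond; apply: eq_integral => u _; rewrite patchE /f /= mem_setE in_itv /=.
  by case: ifP.
move=> ->.
have mg : measurable_fun (`]0%R, 1%R[ : set (measurableTypeR R)) (fun u : R => (k u * u ^+ n.+1)%:E).
  by apply/measurable_EFinP; apply: measurable_funTS; apply: measurable_funM => //; exact: exprn_measurable.
have g0 (u : R) : ([set` `]0%R, 1%R[] u -> 0 <= (k u * u ^+ n.+1)%:E)%E.
  by rewrite /= in_itv /= => /andP[u0 _]; rewrite lee_fin mulr_ge0// exprn_ge0// ltW.
have m0 : (0 <= cintegral (disc_power n))%E by apply: integral_ge0 => p _; exact: disc_power_ge0.
rewrite muleC -(ge0_integralZl mu (measurable_itv _) mg g0 m0).
rewrite [RHS]integral_mkcond; apply: eq_integral => u _; rewrite patchE mem_setE in_itv /=.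
have [u0|u0] := ltP 0 u; last first.
  rewrite /= integral0_eq// => p _; rewrite /f /= ifF//; apply/negP => /andP[h _].
  by move: (lt_le_trans h u0); rewrite ltNge sqr_ge0.
have [u1|u1] /= := ltP u 1; last first.
  by rewrite integral0_eq// => p _; rewrite /f /= [X in _ && X]ltNge u1 andbF.
rewrite EFinM [RHS]muleC -muleA -cintegral_dilate//.
rewrite -cintegralZl ?lee_fin//; last 2 first.
- apply: measurable_fun_ifT.
  + apply: measurable_fun_ltr; last exact: measurable_cst.
    by apply: measurable_funX; apply: measurable_normc; exact: cmfun_to_cplx.
  + apply/measurable_EFinP; apply: measurable_funX.
    by apply: measurable_normc; exact: cmfun_to_cplx.
  + exact: measurable_cst.
- by move=> z; case: ifP => // _; rewrite lee_fin exprn_ge0// normc_ge0.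
apply: eq_integral => p _; rewrite /f /= u1 andbT.
by case: ifP => _; rewrite ?mule0// EFinM muleC.
Qed.

Lemma cintegral_disc_fin : (cintegral (disc_power 0) < +oo)%E.
Proof.
set I : set (measurableTypeR R) := `[(-1)%R, 1%R]%classic.
have mI : measurable I by exact: measurable_itv.
have mB : measurable (I `*` I) by exact: measurableX.
apply: (@le_lt_trans _ _ (\int[@plane_measure R]_p (\1_(I `*` I) p)%:E)%E); last first.
  have -> : (\int[@plane_measure R]_p (\1_(I `*` I) p)%:E = (mu \x mu) (I `*` I))%E by rewrite integral_indic// setIT.
  rewrite product_measure1E// /I /= !lebesgue_measure_itv /=.
  by case: ifPn => _; rewrite ?mule0 ?ltry// -EFinB -EFinM ltry.
rewrite /cintegral; apply: ge0_le_integral => //.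
- by move=> p _; exact: disc_power_ge0.
- exact: cmeasurable_disc_power.
- by apply/measurable_EFinP; exact: measurable_indic.
move=> p _; rewrite /disc_power /= expr0; case: ifPn => [p1|_]; last by rewrite lee_fin.
rewrite lee_fin indicE mem_set//.
have hx := Re_le_normc (to_cplx p); have hy := Im_le_normc (to_cplx p).
split; rewrite /I /= in_itv /= -ler_norml; apply/ltW.
  exact: le_lt_trans hx p1.
exact: le_lt_trans hy p1.
Qed.

Let disc_mass : exists2 v : R, 0 <= v & cintegral (disc_power 0) = v%:E.
Proof.
have := cintegral_disc_fin; have : (0 <= cintegral (disc_power 0))%E.
  by apply: integral_ge0 => p _; exact: disc_power_ge0.
by case: (cintegral _) => // v v0 _; exists v.
Qed.

(** [layer_cake 0] with [k u = (m + 1) |u|^m] integrates [1 - |z|^(2 (m + 1))] to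
    [(m + 1) / (m + 2)] times the area of the disc. The area being finite, the moment follows by
    subtraction. *)
Lemma cintegral_disc_power n :
  (n.+1%:R%:E * cintegral (disc_power n) = cintegral (disc_power 0))%E.
Proof.
have [v v0 vE] := disc_mass.
case: n => [|m]; first by rewrite mul1e.
have mk : measurable_fun setT (fun u : R => m.+1%:R * `|u| ^+ m).
  by apply: measurable_funM => //; apply: measurable_funX; exact: normr_measurable.
have k0 (u : R) : 0 <= m.+1%:R * `|u| ^+ m by rewrite mulr_ge0// exprn_ge0.
have := layer_cake 0 mk k0.
have -> : (\int[mu]_(u in `]0%R, 1%R[) (m.+1%:R * `|u| ^+ m * u ^+ 1)%:E = (m.+1%:R / m.+2%:R)%:E)%E.
  have h01 : ((0 : R) <= 0) && ((0 : R) < 1) by rewrite lexx ltr01.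
  have := integral_oo_exprn m.+1%:R m.+1 h01; rewrite expr0n subr0 mulr1 => <-.
  apply: eq_integral => u; rewrite inE /= in_itv /= => /andP[u0 _].
  by rewrite ger0_norm ?ltW// expr1 exprSr mulrA.
move=> E.
have : (cintegral (fun z => (normc z ^+ (2 * 0))%:E *
    \int[mu]_(u in `](normc z ^+ 2)%R, 1%R[) (m.+1%:R * `|u| ^+ m)%:E) + cintegral (disc_power m.+1) =
    cintegral (disc_power 0))%E.
  have D z : ((normc z ^+ (2 * 0))%:E *
    \int[mu]_(u in `](normc z ^+ 2)%R, 1%R[) (m.+1%:R * `|u| ^+ m)%:E =
    if (normc z < 1)%R then (1 - normc z ^+ (2 * m.+1))%:E else 0)%E.
    rewrite expr0 mul1e; case: ifPn => z1.
      by rewrite integral_oo_exprn ?divff ?mul1r ?exprM ?pnatr_eq0// sqr_ge0 expr_lt1// normc_ge0.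
    rewrite set_itv_ge ?integral_set0// bnd_simp -leNgt.
    by rewrite exprn_ege1// leNgt.
  rewrite (eq_cintegral D) /cintegral -ge0_integralD//; last 4 first.
  - move=> p _; case: ifPn => // z1; rewrite lee_fin subr_ge0 exprn_ile1 ?normc_ge0// ltW//.
  - apply: measurable_fun_ifT.
    + apply: measurable_fun_ltr; last exact: measurable_cst.
      by apply: measurable_normc; exact: cmfun_to_cplx.
    + apply/measurable_EFinP; apply: measurable_funB => //; apply: measurable_funX.
      by apply: measurable_normc; exact: cmfun_to_cplx.
    + exact: measurable_cst.
  - by move=> p _; exact: disc_power_ge0.
  - exact: cmeasurable_disc_power.
  apply: eq_integral => p _; rewrite /disc_power; case: ifPn => _; last by rewrite adde0.
  by rewrite -EFinD subrK muln0 expr0.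
rewrite E vE -EFinM; case: (cintegral _) => [x| |] //.
rewrite -!EFinM -EFinD => -[h]; congr EFin; rewrite -[in RHS]h.
have m2 : m.+2%:R != 0 :> R by rewrite pnatr_eq0.
have -> : x = v - m.+1%:R / m.+2%:R * v by rewrite -[in X in X - _]h; ring.
have -> : m.+1%:R = m.+2%:R - 1 :> R by rewrite -(natr1 m.+1) addrK.
by field.
Qed.

Lemma measurable_green d (T : measurableType d) (F G : T -> C) : cmfun F -> cmfun G ->
  measurable_fun setT (fun x => green (F x) (G x)).
Proof.
move=> mF mG; apply: measurable_fun_ifT.
- exact: measurable_ceq.
- exact: measurable_cst.
- apply/measurable_EFinP; apply: (measurableT_comp (@measurable_ln R)).
  apply: measurable_funX; apply: measurable_normc; apply: cmfun_div; last exact: cmfunB.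
  by apply: cmfunB; [exact: cmfun_cst|apply: cmfunM => //; exact: cmfun_conj].
Qed.

Definition green0 z : \bar R := if normc z < 1 then green z 0 else 0%E.

(** This is the form of [log 1/|z|^2] to which [layer_cake] applies. It includes the pole, where the
    integral diverges, and the outside of the disc, where the interval is empty. *)
Lemma green0E z : green0 z = (\int[mu]_(u in `](normc z ^+ 2)%R, 1%R[) (`|u|^-1)%:E)%E.
Proof.
rewrite /green0; case: ifPn => z1; last first.
  rewrite set_itv_ge ?integral_set0// bnd_simp -leNgt.
  by rewrite exprn_ege1// leNgt.
rewrite /green; case: eqP => [->|/eqP z0]; first by rewrite normc0 expr0n integral_oo_inv0.
rewrite integral_oo_inv; last by rewrite exprn_gt0 ?normc_gt0// expr_lt1// normc_ge0.
by rewrite conjc0 mul0r subr0 subr0 div1r normcV exprVn lnV// posrE exprn_gt0// normc_gt0.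
Qed.

Lemma green0_ge0 z : (0 <= green0 z)%E.
Proof. by rewrite green0E; apply: integral_ge0 => u _; rewrite lee_fin. Qed.

Lemma radial_green0 : radial_weight green0.
Proof.
split.
- apply: measurable_fun_ifT.
  + apply: measurable_fun_ltr; last exact: measurable_cst.
    by apply: measurable_normc; exact: cmfun_to_cplx.
  + by apply: measurable_green; [exact: cmfun_to_cplx|exact: cmfun_cst].
  + exact: measurable_cst.
- exact: green0_ge0.
- by move=> u z u1; rewrite !green0E normcM u1 mul1r.
- by move=> z z1; rewrite /green0 ltNge z1.
Qed.

(** The Littlewood-Paley formula for the monomial [z^(n+1)]: one factor [1 / (n + 1)] comes from the
    integral of [u^n], another from the moment, so all these monomials have the same energy. *)
Lemma cintegral_green0 n :
  (cintegral (fun z => ((n.+1%:R * normc z ^+ n) ^+ 2)%:E * green0 z) = cintegral (disc_power 0))%E.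
Proof.
have mk : measurable_fun setT (fun u : R => `|u|^-1).
  by apply: measurable_fun_inv; exact: normr_measurable.
have k0 (u : R) : 0 <= `|u|^-1 by rewrite invr_ge0.
have := layer_cake n mk k0.
have -> : (\int[mu]_(u in `]0%R, 1%R[) (`|u|^-1 * u ^+ n.+1)%:E = (n.+1%:R^-1)%:E)%E.
  have h01 : ((0 : R) <= 0) && ((0 : R) < 1) by rewrite lexx ltr01.
  have := integral_oo_exprn 1 n h01; rewrite expr0n subr0 mulr1 div1r => <-.
  apply: eq_integral => u; rewrite inE /= in_itv /= => /andP[u0 _].
  by rewrite ger0_norm ?ltW// mul1r exprS mulKf// gt_eqF.
move=> E; rewrite -(cintegral_disc_power n).
have -> : (n.+1%:R%:E * cintegral (disc_power n) =
  (n.+1%:R ^+ 2)%:E * ((n.+1%:R^-1)%:E * cintegral (disc_power n)))%E.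
  by rewrite muleA -EFinM; congr (_%:E * _)%E; rewrite expr2 mulfK ?pnatr_eq0.
rewrite -E -cintegralZl ?lee_fin ?sqr_ge0//; last 2 first.
- under [X in cmeasurable X]eq_fun do rewrite -green0E.
  have [mg _ _ _] := radial_green0; apply: emeasurable_funM => //.
  apply/measurable_EFinP; apply: measurable_funX.
  by apply: measurable_normc; exact: cmfun_to_cplx.
- by move=> z; rewrite mule_ge0 ?lee_fin ?exprn_ge0 ?normc_ge0// -green0E green0_ge0.
by apply: eq_cintegral => z; rewrite -green0E muleA -EFinM exprMn -exprM mulnC.
Qed.

End Layer.

(** * Multiplication by z increases the weighted Dirichlet integral *)

Section BlaschkeCoefficients.
Variable R : realType.
Local Notation C := (Cplx R).
Implicit Types (a z : C) (b c p : nat -> C).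

(** For [q < 1] this is the decay of coefficients of functions analytic beyond the closed disc, such
    as a polynomial in [blaschke a] when [|a| < q]. *)
Definition geomdecay (q : R) b := exists K, forall n, normc (b n) <= K * q ^+ n.

Lemma geomdecay_ge0 q b K : (forall n, normc (b n) <= K * q ^+ n) -> 0 <= K.
Proof. by move=> /(_ 0%N); rewrite expr0 mulr1; apply: le_trans; exact: normc_ge0. Qed.

Lemma geomdecay_adm q b : 0 <= q <= 1 -> geomdecay q b -> adm b.
Proof.
move=> /andP[q0 q1] [K hK] r /andP[r0 r1]; exists K => n.
have K0 := geomdecay_ge0 hK.
have h : normc (b n) * r ^+ n <= K * q ^+ n * r ^+ n by rewrite ler_wpM2r ?hK// exprn_ge0// ltW.
apply: le_trans h _.
by rewrite -mulrA -exprMn ler_piMr// exprn_ile1 ?mulr_ge0 ?mulr_ile1// ltW.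
Qed.

(** A relation between partial sums passes to the limit; the term in [psum b N] accommodates
    multiplication by [z], which lags one index behind. *)
Lemma pseries_linear b c z (x y t : C) : adm b -> normc z < 1 ->
  (forall N, psum c N.+1 z = x + y * psum b N.+1 z + t * psum b N z) ->
  pseries c z = x + (y + t) * pseries b z.
Proof.
move=> ab z1 h; set l := pseries b z.
have /cvg_cplxP hb := pseries_cvg ab z1.
apply: limn_unique; rewrite -psum_series; apply/cvg_cplxP => e e0.
set k := normc y + normc t + 1.
have k0 : 0 < k by rewrite ltr_wpDl// addr_ge0// normc_ge0.
have [N hN] := hb _ (divr_gt0 e0 k0).
exists N.+1 => -[//|n] Nn; rewrite h.
have -> : x + y * psum b n.+1 z + t * psum b n z - (x + (y + t) * l) =
  y * (psum b n.+1 z - l) + t * (psum b n z - l) :> C by ring.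
apply: le_trans (ler_normcD _ _) _; rewrite !normcM.
have h1 := hN n.+1 (leq_trans Nn (leqnSn _)).
have h2 := hN n Nn.
have h3 : normc y * normc (psum b n.+1 z - l) <= normc y * (e / k).
  by rewrite ler_wpM2l ?normc_ge0.
have h4 : normc t * normc (psum b n z - l) <= normc t * (e / k).
  by rewrite ler_wpM2l ?normc_ge0.
apply: le_trans (lerD h3 h4) _; rewrite -mulrDl mulrCA ler_piMr ?ltW//.
by rewrite ltr_pdivrMr// mul1r /k ltrDl.
Qed.

Definition shift p n : C := if n is m.+1 then p m else 0.

Lemma psum_shift p (x y : C) z N :
  psum (fun n => x * p n + y * shift p n) N.+1 z = x * psum p N.+1 z + y * z * psum p N z.
Proof.
elim: N => [|N IH]; first by rewrite !psumS !psum0 /= mulr0 addr0 !add0r !expr0; ring.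
rewrite psumS IH (psumS p N.+1) (psumS p N) /= exprS; ring.
Qed.

Lemma psum_recl p N z : psum p N.+1 z = p 0%N + z * psum (fun n => p n.+1) N z.
Proof.
elim: N => [|N IH]; first by rewrite psumS !psum0 expr0; ring.
by rewrite psumS IH psumS exprS; ring.
Qed.

Lemma geomdecay_shift q p (x y : C) : 0 < q -> geomdecay q p ->
  geomdecay q (fun n => x * p n + y * shift p n).
Proof.
move=> q0 [K hK]; exists (normc x * K + normc y * K / q) => n.
apply: le_trans (ler_normcD _ _) _; rewrite !normcM mulrDl; apply: lerD.
  by rewrite -mulrA ler_wpM2l ?normc_ge0.
rewrite -!mulrA ler_wpM2l ?normc_ge0//.
have K0 := geomdecay_ge0 hK.
case: n => [|n] /=; last by rewrite exprS mulKf ?gt_eqF.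
by rewrite normc0 mulr_ge0// mulr_ge0 ?invr_ge0 ?exprn_ge0// ltW.
Qed.

(** Division of the power series by [1 - conj a z], whose zero lies outside the disc of radius
    [1 / q]. *)
Lemma geomdecay_div q b a : normc a < q -> geomdecay q b ->
  exists2 p, geomdecay q p & forall n, b n = p n - (a^*)%C * shift p n.
Proof.
move=> aq [K hK].
have q0 : 0 < q by apply: le_lt_trans aq; exact: normc_ge0.
pose p := fix p n := b n + (a^*)%C * (if n is m.+1 then p m else 0).
exists p; last by case=> [|n] /=; ring.
(* This constant [X] solves [K q + |a| X = X q], which closes the induction. *)
exists (K * q / (q - normc a)).
have K0 := geomdecay_ge0 hK.
have qa : 0 < q - normc a by rewrite subr_gt0.
elim=> [|n IH].
  rewrite /= mulr0 addr0; apply: le_trans (hK 0%N) _; rewrite !expr0 !mulr1.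
  by rewrite ler_pdivlMr// ler_wpM2l// lerBlDr lerDl normc_ge0.
rewrite [p _]/=; apply: le_trans (ler_normcD _ _) _; rewrite normcM normc_conj.
have h : normc a * normc (p n) <= normc a * (K * q / (q - normc a) * q ^+ n).
  by rewrite ler_wpM2l ?normc_ge0.
apply: le_trans (lerD (hK n.+1) h) _.
rewrite exprS le_eqVlt; apply/orP; left; apply/eqP.
by field; rewrite gt_eqF.
Qed.

(** Divide by [1 - conj a z], then multiply by [a - z]. One sequence [p] expresses the coefficients
    before and after, as [blaschke_coef_telescope] requires. *)
Lemma pseries_mul_blaschke a q b : normc a < q -> q <= 1 -> geomdecay q b ->
  exists p, [/\ geomdecay q p, forall n, b n = p n - (a^*)%C * shift p n &
    forall z, normc z < 1 ->
      pseries (fun n => a * p n - shift p n) z = blaschke a z * pseries b z].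
Proof.
move=> aq q1 db; have [p dp pb] := geomdecay_div aq db.
have q0 : 0 < q by apply: le_lt_trans aq; exact: normc_ge0.
have ap : adm p by apply: geomdecay_adm dp; rewrite (ltW q0).
exists p; split=> // z z1.
have -> : pseries b z = 0 + (1 + - (a^*)%C * z) * pseries p z.
  apply: pseries_linear => // N.
  have -> : b = (fun n => 1 * p n + - (a^*)%C * shift p n).
    by apply/funext => n; rewrite pb mul1r mulNr.
  by rewrite psum_shift add0r.
have -> : pseries (fun n => a * p n - shift p n) z = 0 + (a + -1 * z) * pseries p z.
  apply: pseries_linear => // N.
  have -> : (fun n => a * p n - shift p n) = (fun n => a * p n + -1 * shift p n).
    by apply/funext => n; rewrite mulN1r.
  by rewrite psum_shift add0r.
rewrite /blaschke !add0r !mulNr mul1r.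
have h : 1 - (a^*)%C * z != 0 by rewrite blaschke_den_neq0 ?(lt_le_trans aq)// ltW.
by rewrite mulrA mulfVK.
Qed.

(** Horner's scheme: a polynomial is its constant term plus [z] times a shorter one, and
    multiplication by [blaschke a] keeps the decay. *)
Lemma geomdecay_poly_blaschke a q N p : normc a < q -> q <= 1 ->
  exists2 b, geomdecay q b & forall z, normc z < 1 -> pseries b z = psum p N (blaschke a z).
Proof.
move=> aq q1; have q0 : 0 < q by apply: le_lt_trans aq; exact: normc_ge0.
elim: N p => [|N IH] p.
  have d0 : geomdecay q (fun=> 0) by exists 0 => n; rewrite normc0 mul0r.
  exists (fun=> 0) => // z z1; rewrite psum0.
  have a0 : adm (fun=> 0 : C) by apply: geomdecay_adm d0; rewrite (ltW q0).
  rewrite (@pseries_linear _ _ z 0 0 0 a0 z1) ?addr0 ?mul0r ?addr0// => n.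
  by rewrite !mul0r !addr0 /psum big1// => i _; rewrite mul0r.
have [b db hb] := IH (fun n => p n.+1).
have [t [dt tb ht]] := pseries_mul_blaschke aq q1 db.
pose c n := a * t n - shift t n.
have dc : geomdecay q c.
  have := geomdecay_shift a (-1) q0 dt; congr (geomdecay q _).
  by apply/funext => n; rewrite /c mulN1r.
exists (fun n => c n + (n == 0%N)%:R * p 0%N).
  case: dc => K hK; exists (K + normc (p 0%N)) => n; apply: le_trans (ler_normcD _ _) _.
  rewrite mulrDl lerD// normcM normc_nat; case: n => [|n]; first by rewrite mul1r expr0 mulr1.
  by rewrite mul0r mulr_ge0 ?normc_ge0// exprn_ge0// ltW.
move=> z z1; rewrite psum_recl -hb// -ht//.
have ac : adm c by apply: geomdecay_adm dc; rewrite (ltW q0).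
have -> : pseries (fun n => c n + (n == 0%N)%:R * p 0%N) z = p 0%N + (1 + 0) * pseries c z; last by rewrite addr0 mul1r.
apply: pseries_linear => //.
elim=> [|n IHn]; first by rewrite !psumS !psum0 expr0 /=; ring.
by rewrite psumS IHn (psumS c n.+1) /= mulr0n !mul0r; ring.
Qed.

(** The coefficient form of the fact that [1 - conj a z] and [a - z] have equal modulus on the
    circle. The two extra terms come from the truncation and from the omitted constant
    coefficients. *)
Lemma blaschke_coef_telescope a p N :
  \sum_(n < N) normc (p n.+1 - (a^*)%C * p n) ^+ 2 =
  \sum_(n < N) normc (a * p n.+1 - p n) ^+ 2 +
    (1 - normc a ^+ 2) * (normc (p N) ^+ 2 - normc (p 0%N) ^+ 2).
Proof.
elim: N => [|N IH]; first by rewrite !big_ord0 subrr mulr0 addr0.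
rewrite !big_ord_recr /= IH.
have -> : normc (p N.+1 - (a^*)%C * p N) ^+ 2 = normc (a * p N.+1 - p N) ^+ 2 +
  (1 - normc a ^+ 2) * (normc (p N.+1) ^+ 2 - normc (p N) ^+ 2).
  clear IH; rewrite !normc_sqr; case: a (p N.+1) (p N) => a1 a2 [x1 x2] [y1 y2] /=; ring.
ring.
Qed.

End BlaschkeCoefficients.

(** * Conformal invariance of the Green function and the comparison of P with zP *)

Section GreenInvariance.
Variable R : realType.
Local Notation C := (Cplx R).
Implicit Types (a z w : C) (b c p : nat -> C).

(** The Green function as a function of the pseudo-hyperbolic distance alone, which reduces its
    invariance to [blaschke_blaschke]. *)
Definition green_profile (r : R) : \bar R := if r == 0 then +oo%E else (- ln (r ^+ 2))%:E.

Lemma greenE w z : normc w < 1 -> normc z < 1 ->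
  green z w = green_profile (normc (blaschke w z)).
Proof.
move=> w1 z1; have d0 := blaschke_den_neq0 w1 (ltW z1).
rewrite /green /green_profile normc_eq0 /blaschke mulf_eq0 invr_eq0 (negbTE d0) orbF.
rewrite subr_eq0 eq_sym; case: eqP => // /eqP wz; congr EFin.
rewrite !normcM !normcV (normcBC z w) -lnV; last first.
  by rewrite posrE exprn_gt0// divr_gt0// normc_gt0// subr_eq0.
by rewrite -exprVn invf_div.
Qed.

Lemma green_ge0 w z : normc w < 1 -> normc z < 1 -> (0 <= green z w)%E.
Proof.
move=> w1 z1; rewrite greenE// /green_profile; case: eqP => // _.
rewrite lee_fin oppr_ge0 ln_le0// exprn_ile1 ?normc_ge0//.
by apply: blaschke_le1 => //; exact: ltW.
Qed.

Lemma green_blaschke a w z : normc a < 1 -> normc w < 1 -> normc z < 1 ->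
  green (blaschke a z) (blaschke a w) = green z w.
Proof. by move=> a1 w1 z1; rewrite !greenE ?blaschke_blaschke ?blaschke_lt1. Qed.

Lemma green_rotation (u : C) w z : normc u = 1 -> normc w < 1 -> normc z < 1 ->
  green (u * z) (u * w) = green z w.
Proof.
move=> u1 w1 z1; rewrite !greenE ?normcM ?u1 ?mul1r//; congr green_profile.
have E : ((u * w)^*)%C * (u * z) = (w^*)%C * z :> C.
  have -> : ((u * w)^*)%C * (u * z) = (u * (u^*)%C) * ((w^*)%C * z) :> C.
    by rewrite conj_mul; ring.
  by rewrite mul_conjE u1 expr1n mul1r.
by rewrite /blaschke E -mulrBr normcM u1 mul1r.
Qed.

Definition greenD z w : \bar R := if normc z < 1 then green z w else 0%E.

Lemma blaschke_ge1 a z : normc a < 1 -> 1 <= normc z -> 1 - (a^*)%C * z != 0 ->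
  1 <= normc (blaschke a z).
Proof.
move=> a1 z1 d0; rewrite /blaschke normcM normcV ler_pdivlMr ?normc_gt0// mul1r.
rewrite -(@ler_sqr _) ?nnegrE ?normc_ge0// -subr_le0 blaschke_normE.
have h1 : normc a ^+ 2 <= 1 by rewrite exprn_ile1 ?normc_ge0// ltW.
have h2 : 1 <= normc z ^+ 2 by rewrite exprn_ege1.
nra.
Qed.

Definition dblaschke a z : C := ((normc a ^+ 2 - 1)%:C)%C / (1 - (a^*)%C * z) ^+ 2.

Lemma normc_dblaschke a z :
  normc (dblaschke a z) ^+ 2 = (1 - normc a ^+ 2) ^+ 2 * normc (1 - (a^*)%C * z) ^- 4.
Proof.
rewrite /dblaschke normcM normcV normcX normc_real exprMn real_normK ?num_real//.
by rewrite -exprVn -exprM exprVn -sqrrN opprB.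
Qed.

Lemma cintegral_blaschke_deriv a (g : C -> C) (w : C -> \bar R) : normc a < 1 ->
  cmeasurable (fun z => (normc (g z) ^+ 2)%:E * w z)%E -> (forall z, 0 <= w z)%E ->
  (forall z, 1 <= normc z -> w z = 0%E) ->
  cintegral (fun z => (normc (g (blaschke a z) * dblaschke a z) ^+ 2)%:E * w (blaschke a z))%E =
  cintegral (fun z => (normc (g z) ^+ 2)%:E * w z)%E.
Proof.
move=> a1 mg w0 wD; rewrite -[RHS](cintegral_blaschke a1 mg); last 2 first.
- by move=> z; rewrite mule_ge0// lee_fin sqr_ge0.
- by move=> z z1; rewrite wD// mule0.
apply: eq_cintegral => z; rewrite normcM exprMn normc_dblaschke EFinM -!muleA.
by congr (_ * _)%E; rewrite muleC.
Qed.

Lemma cmeasurable_greenD w : cmeasurable (greenD^~ w).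
Proof.
apply: measurable_fun_ifT.
- apply: measurable_fun_ltr; last exact: measurable_cst.
  by apply: measurable_normc; exact: cmfun_to_cplx.
- by apply: measurable_green; [exact: cmfun_to_cplx|exact: cmfun_cst].
- exact: measurable_cst.
Qed.

Lemma greenD_ge0 w z : normc w < 1 -> (0 <= greenD z w)%E.
Proof. by move=> w1; rewrite /greenD; case: ifP => // z1; exact: green_ge0. Qed.

Lemma cintegral_greenD a (g : C -> C) : normc a < 1 -> cmfun (g \o @to_cplx R) ->
  cintegral (fun z => (normc (g z) ^+ 2)%:E * greenD z a)%E =
  cintegral (fun z => (normc (g (blaschke a z) * dblaschke a z) ^+ 2)%:E * green0 z)%E.
Proof.
move=> a1 mg; rewrite -(@cintegral_blaschke_deriv a g)//; last 3 first.
- apply: emeasurable_funM; last exact: cmeasurable_greenD.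
  by apply/measurable_EFinP; apply: measurable_funX; exact: measurable_normc.
- by move=> z; exact: greenD_ge0.
- by move=> z z1; rewrite /greenD ltNge z1.
apply: eq_cintegral => z; have [z1|z1] := ltP (normc z) 1.
  rewrite /greenD /green0 blaschke_lt1// z1; congr (_ * _)%E.
  rewrite !greenE ?normc0 ?blaschke_lt1// blaschkeK ?ltW//; congr green_profile.
  by rewrite /blaschke sub0r conjc0 mul0r subr0 divr1 normcN.
have -> : green0 z = 0%E by rewrite /green0 ltNge z1.
(* Outside the disc either [blaschke a z] is outside too, or [z] is the pole of [blaschke a], where
   division by 0 makes [dblaschke a z] vanish. *)
rewrite mule0; have [d0|d0] := eqVneq (1 - (a^*)%C * z) 0.
  by rewrite /dblaschke d0 expr0n invr0 !mulr0 normc0 expr0n mul0e.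
by rewrite /greenD ltNge blaschke_ge1// mule0.
Qed.

Lemma cintegral_ssum_green0 b N :
  cintegral (fun z => (ssum (dseq b) N z)%:E * green0 z)%E =
  ((\sum_(n < N) normc (b n.+1) ^+ 2)%:E * cintegral (@disc_power R 0))%E.
Proof.
rewrite /ssum.
have -> : (fun z => ((\sum_(0 <= n < N) normc (dseq b n) ^+ 2 * normc z ^+ (2 * n))%:E * green0 z)%E) =
  (fun z => \sum_(n < N) ((normc (b n.+1) ^+ 2)%:E * (((n.+1%:R * normc z ^+ n) ^+ 2)%:E * green0 z)))%E.
  apply/funext => z; rewrite big_mkord -sumEFin ge0_sume_distrl; last first.
    by move=> n _; rewrite lee_fin mulr_ge0// ?sqr_ge0// exprn_ge0// normc_ge0.
  apply: eq_bigr => n _; rewrite muleA -EFinM; congr (_%:E * _)%E.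
  by rewrite /dseq normcM normc_nat !exprMn -exprM (mulnC n); ring.
have [mw w0 _ _] := radial_green0 R.
have mn n : cmeasurable (fun z => ((n.+1%:R * normc z ^+ n) ^+ 2)%:E * green0 z)%E.
  apply: emeasurable_funM => //; apply/measurable_EFinP; apply: measurable_funX.
  apply: measurable_funM; first exact: measurable_cst.
  by apply: measurable_funX; apply: measurable_normc; exact: cmfun_to_cplx.
have p0 n z : (0 <= ((n.+1%:R * normc z ^+ n) ^+ 2)%:E * green0 z)%E.
  by rewrite mule_ge0// lee_fin sqr_ge0.
rewrite [LHS]/cintegral ge0_integral_sum//; last 2 first.
- by move=> n; apply: measurable_funeM; exact: mn.
- by move=> n p _; apply: mule_ge0; [rewrite lee_fin sqr_ge0|exact: p0].
rewrite -sumEFin ge0_sume_distrl; last by move=> n _; rewrite lee_fin sqr_ge0.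
apply: eq_bigr => n _; rewrite -(cintegral_green0 R n).
have b0 : (0 <= (normc (b n.+1) ^+ 2)%:E)%E by rewrite lee_fin sqr_ge0.
exact: (cintegralZl b0 (mn n) (p0 n)).
Qed.

(** By Parseval for [green0], both integrals are the area of the disc times the sum of the squared
    moduli of the coefficients of positive index; the slack [e] is there to absorb a truncation
    error. *)
Lemma dirichlet_le b c : adm b -> adm c ->
  (forall N e, 0 < e -> exists M, \sum_(n < N) normc (b n.+1) ^+ 2 <=
    \sum_(n < M) normc (c n.+1) ^+ 2 + e) ->
  (cintegral (fun z => (normc (pseries (dseq b) z) ^+ 2)%:E * green0 z) <=
   cintegral (fun z => (normc (pseries (dseq c) z) ^+ 2)%:E * green0 z))%E.
Proof.
move=> /adm_dseq ab /adm_dseq ac H; apply: parseval_le => //; first exact: radial_green0.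
move=> N; rewrite cintegral_ssum_green0.
have := cintegral_disc_fin R; have : (0 <= cintegral (@disc_power R 0))%E.
  by apply: integral_ge0 => p _; exact: disc_power_ge0.
case V : (cintegral (@disc_power R 0)) => [v| |] // v0 _; rewrite lee_fin in v0.
apply/lee_addgt0Pr => e e0.
have v1 : 0 < v + 1 by rewrite ltr_wpDl.
have [M hM] := H N _ (divr_gt0 e0 v1).
have := parseval_ge M ac (radial_green0 R).
rewrite cintegral_ssum_green0 V => h; apply: le_trans (leeD2r e%:E h).
rewrite -!EFinM -EFinD lee_fin; apply: le_trans (ler_wpM2r v0 hM) _.
rewrite mulrDl lerD2l mulrAC ler_pdivrMr// ler_pM2l//; lra.
Qed.

Lemma cderive_psum p N z : cderive (psum p N.+1) z (psum (dseq p) N z).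
Proof.
elim: N => [|N IH].
  rewrite psum0; apply: cderive_ext (cderive_cst (p 0%N) z) => w.
  by rewrite psumS psum0 expr0 mulr1 add0r.
have h := cderiveD IH (cderiveZ (p N.+1) (cderiveX N.+1 (cderive_id z))).
have -> : psum (dseq p) N.+1 z = psum (dseq p) N z + p N.+1 * (N.+1%:R * z ^+ N * 1).
  by rewrite psumS /dseq; ring.
by apply: cderive_ext h => w; rewrite (psumS p N.+1).
Qed.

Lemma pseries_dseq_comp b p N a z : adm b -> normc a < 1 -> normc z < 1 ->
  (forall z, normc z < 1 -> pseries b z = psum p N.+1 (blaschke a z)) ->
  pseries (dseq b) z = psum (dseq p) N (blaschke a z) * dblaschke a z.
Proof.
move=> ab a1 z1 H; have hb := cderive_pseries ab z1.
have hd := cderive_comp (cderive_blaschke a1 (ltW z1)) (cderive_psum p N (blaschke a z)).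
apply: cderive_uniq hb _; apply: cderive_near hd.
have z0 : 0 < 1 - normc z by rewrite subr_gt0.
exists (1 - normc z) => // w wz; rewrite H//.
have := ler_normcD z (w - z); rewrite subrKC; lra.
Qed.

(** With the pole moved to 0, the integrands belong to [b], the series of the polynomial composed
    with [blaschke a], and to [c], that of [blaschke a] times it. Telescoping leaves
    [(1 - |a|^2) (|t M'|^2 - |t 0|^2)], whose first term is at most [e] and whose second has the
    right sign. *)
Lemma poly_green_le p N a : normc a < 1 ->
  (cintegral (fun z => (normc (psum (dseq p) N z) ^+ 2)%:E * greenD z a) <=
   cintegral (fun z => (normc (psum (dseq (shift p)) N.+1 z) ^+ 2)%:E * greenD z a))%E.
Proof.
move=> a1; set q := (1 + normc a) / 2.
have [aq q1] : normc a < q /\ q < 1.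
  by rewrite ltr_pdivlMr// ltr_pdivrMr//; split; lra.
have q0 : 0 < q by apply: le_lt_trans aq; exact: normc_ge0.
have q01 : 0 <= q <= 1 by rewrite !ltW.
have [b db hb] := geomdecay_poly_blaschke N.+1 p aq (ltW q1).
have [t [dt tb ht]] := pseries_mul_blaschke aq (ltW q1) db.
have ab := geomdecay_adm q01 db.
set c := fun n => _ in ht.
have dc : geomdecay q c.
  have := geomdecay_shift a (-1) q0 dt; congr (geomdecay q _).
  by apply/funext => n; rewrite /c mulN1r.
have ac := geomdecay_adm q01 dc.
rewrite (cintegral_greenD a1 (cmfun_psum (dseq p) N)).
rewrite (cintegral_greenD a1 (cmfun_psum (dseq (shift p)) N.+1)).
have hc z : normc z < 1 -> pseries c z = psum (shift p) N.+2 (blaschke a z).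
  move=> z1; rewrite ht// hb//.
  have := psum_shift p 0 1 (blaschke a z) N.+1; rewrite mul0r add0r mul1r => <-.
  by congr psum; apply/funext => n; rewrite mul0r mul1r add0r.
have := @dirichlet_le b c ab ac; have E (f g : C -> C) :
    (forall z, normc z < 1 -> f z = g z) ->
    cintegral (fun z => (normc (f z) ^+ 2)%:E * green0 z)%E =
    cintegral (fun z => (normc (g z) ^+ 2)%:E * green0 z)%E.
  move=> fg; apply: eq_cintegral => z; have [z1|z1] := ltP (normc z) 1; first by rewrite fg.
  by rewrite /green0 ltNge z1 !mule0.
rewrite (E _ _ (fun z (z1 : normc z < 1) => pseries_dseq_comp ab a1 z1 hb)).
rewrite (E _ _ (fun z (z1 : normc z < 1) => pseries_dseq_comp ac a1 z1 hc)).
apply=> N' e e0; case: dt => K hK.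
have qq : 0 <= q < 1 by rewrite ltW.
have [M hM] := geometric_small (K ^+ 2) qq e0.
exists (maxn N' M); set M' := maxn _ _.
have s : \sum_(n < N') normc (b n.+1) ^+ 2 <= \sum_(n < M') normc (b n.+1) ^+ 2.
  rewrite -!(big_mkord predT (fun n => normc (b n.+1) ^+ 2)).
  rewrite (@big_cat_nat _ _ _ N' _ M')//= ?leq_maxl// lerDl.
  by apply: sumr_ge0 => n _; exact: sqr_ge0.
apply: le_trans s _.
under eq_bigr do rewrite tb /=.
rewrite blaschke_coef_telescope lerD2l.
have tM : normc (t M') ^+ 2 <= e.
  apply: le_trans _ (hM M' (leq_maxr _ _)).
  have h : normc (t M') ^+ 2 <= (K * q ^+ M') ^+ 2 by rewrite ler_sqr ?nnegrE ?normc_ge0 ?(le_trans (normc_ge0 _) (hK _)).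
  apply: le_trans h _; rewrite exprMn ler_wpM2l ?sqr_ge0// expr2.
  by rewrite ler_piMr ?exprn_ge0 ?(ltW q0)// exprn_ile1 ?(ltW q0) ?(ltW q1).
have h1 : 0 <= normc a ^+ 2 <= 1 by rewrite sqr_ge0 exprn_ile1 ?normc_ge0// ltW.
have h2 : 0 <= normc (t 0%N) ^+ 2 := sqr_ge0 _.
have h3 : 0 <= normc (t M') ^+ 2 := sqr_ge0 _.
case/andP: h1; nra.
Qed.

End GreenInvariance.

(** * The restriction of the measure to the disc *)

Section DiscRestriction.
Variable R : realType.
Local Notation C := (Cplx R).
Variable mu : {measure set (plane R) -> \bar R}.
Local Notation D := (@plane_disc R).

(** By Markov's inequality the set where [1 - |z|^2] is at least [1 / (n + 1)] has finite mass. The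
    alternative [d p <= 0] in [S n] adds the complement of the disc, which the restricted measure
    does not charge. *)
Lemma disc_restriction_sigma_finite :
  (\int[mu]_(p in D) (1 - normc (to_cplx p) ^+ 2)%R%:E < +oo)%E ->
  sigma_finite setT (mrestr mu (@measurable_plane_disc R)).
Proof.
move=> mu_fin; pose d p := 1 - normc (@to_cplx R p) ^+ 2.
have md : measurable_fun setT d.
  apply: measurable_funB; first exact: measurable_cst.
  by apply: measurable_funX; apply: measurable_normc; exact: cmfun_to_cplx.
pose S n := [set p : plane R | d p <= 0 \/ n.+1%:R^-1 <= d p].
have mS n : measurable (S n).
  have -> : S n = (d @^-1` `]-oo, 0%R]) `|` (d @^-1` `[n.+1%:R^-1, +oo[).
    by apply/seteqP; split=> p /=; rewrite !in_itv /= andbT.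
  apply: measurableU; rewrite -[X in measurable X]setTI; apply: md => //; exact: measurable_itv.
exists S.
  apply/esym/seteqP; split=> // p _.
  have [d0|d0] := leP (d p) 0; first by exists 0%N => //; left.
  exists (Num.truncn (d p)^-1) => //; right.
  by rewrite invf_ple ?posrE// ltW// truncnS_gt.
move=> n; split=> //; rewrite /mrestr.
have mSD : measurable (S n `&` D) by apply: measurableI => //; exact: measurable_plane_disc.
have d_ge0 p : D p -> 0 <= d p.
  by move=> p1; rewrite subr_ge0 exprn_ile1 ?normc_ge0// ltW.
have : ((n.+1%:R^-1)%:E * mu (S n `&` D) < +oo)%E.
  apply: le_lt_trans mu_fin; rewrite -integral_cst//.
  apply: (@le_trans _ _ (\int[mu]_(p in S n `&` D) (d p)%:E)%E).
    apply: ge0_le_integral => //.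
    - by move=> p _; rewrite lee_fin invr_ge0.
    - by apply/measurable_EFinP; exact: measurable_funTS.
    - move=> p [[d0|h] Dp]; rewrite lee_fin//.
      have : normc (to_cplx p) < 1 := Dp; by rewrite normc_lt1P -/(d p) ltNge d0.
  apply: ge0_subset_integral => //; first exact: measurable_plane_disc.
  - by apply/measurable_EFinP; exact: measurable_funTS.
move=> h; rewrite ltey; apply/eqP => E; move: h.
by rewrite E muleC gt0_mulye ?ltxx// lte_fin.
Qed.

Lemma disc_restriction :
  (\int[mu]_(p in D) (1 - normc (to_cplx p) ^+ 2)%R%:E < +oo)%E ->
  exists nu : {sigma_finite_measure set (plane R) -> \bar R},
    forall A, nu A = mu (A `&` D).
Proof.
move=> /disc_restriction_sigma_finite sf.
pose nu : {sigma_finite_measure set (plane R) -> \bar R} :=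
  HB.pack (mrestr mu (@measurable_plane_disc R)) (Measure_isSigmaFinite.Build _ _ _ _ sf).
by exists nu.
Qed.

End DiscRestriction.

(** * Superpositions of Green functions *)

Section Potential.
Variable R : realType.
Local Notation C := (Cplx R).
Variable nu : {sigma_finite_measure set (plane R) -> \bar R}.
Implicit Types (z w a : C) (phi g : C -> C).

(** The map acts on the pole [w] and not on [z], so that [pot phi] is a superposition of Green
    functions of [z], to which [poly_green_le] applies pole by pole. *)
Definition kern phi z w : \bar R := if normc w < 1 then greenD z (phi w) else 0%E.

Definition pot phi z : \bar R := (\int[nu]_p kern phi z (to_cplx p))%E.

Definition disc_map phi := cmfun (phi \o @to_cplx R) /\
  forall w, normc w < 1 -> normc (phi w) < 1.

Lemma kern_ge0 phi z w : disc_map phi -> (0 <= kern phi z w)%E.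
Proof.
by move=> [_ h]; rewrite /kern; case: ifP => // w1; apply: greenD_ge0; exact: h.
Qed.

Lemma measurable_kern phi : disc_map phi ->
  measurable_fun setT (fun q : plane R * plane R => kern phi (to_cplx q.1) (to_cplx q.2)).
Proof.
move=> [[mr mi] _].
have m1 : cmfun (fun q : plane R * plane R => to_cplx q.1).
  apply: cmfun_Complex; first exact: (measurableT_comp measurable_fst measurable_fst).
  exact: (measurableT_comp measurable_snd measurable_fst).
have m2 : cmfun (fun q : plane R * plane R => to_cplx q.2).
  apply: cmfun_Complex; first exact: (measurableT_comp measurable_fst measurable_snd).
  exact: (measurableT_comp measurable_snd measurable_snd).
have m3 : cmfun (fun q : plane R * plane R => phi (to_cplx q.2)).
  by split; [exact: (measurableT_comp mr measurable_snd)|exact: (measurableT_comp mi measurable_snd)].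
apply: measurable_fun_ifT.
- by apply: measurable_fun_ltr; [exact: measurable_normc|exact: measurable_cst].
- apply: measurable_fun_ifT.
  + by apply: measurable_fun_ltr; [exact: measurable_normc|exact: measurable_cst].
  + exact: measurable_green.
  + exact: measurable_cst.
- exact: measurable_cst.
Qed.

Lemma pot_ge0 phi z : disc_map phi -> (0 <= pot phi z)%E.
Proof. by move=> h; apply: integral_ge0 => p _; exact: kern_ge0. Qed.

Lemma cmeasurable_pot phi : disc_map phi -> cmeasurable (pot phi).
Proof.
move=> h.
exact: (@measurable_fun_fubini_tonelli_F _ _ _ _ _ nu _ (measurable_kern h) (fun q => kern_ge0 _ _ h)).
Qed.

Lemma cintegral_pot phi g : disc_map phi -> cmfun (g \o @to_cplx R) ->
  cintegral (fun z => (normc (g z) ^+ 2)%:E * pot phi z)%E =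
  (\int[nu]_p cintegral (fun z => (normc (g z) ^+ 2)%:E * kern phi z (to_cplx p)))%E.
Proof.
move=> h mg; have mk := measurable_kern h.
pose f (q : plane R * plane R) := ((normc (g (to_cplx q.1)) ^+ 2)%:E * kern phi (to_cplx q.1) (to_cplx q.2))%E.
have f0 q : (0 <= f q)%E by apply: mule_ge0; [rewrite lee_fin sqr_ge0|exact: kern_ge0].
have mf : measurable_fun setT f.
  apply: emeasurable_funM => //; apply/measurable_EFinP; apply: measurable_funX.
  exact: (measurableT_comp (measurable_normc mg) measurable_fst).
rewrite -[RHS](@fubini_tonelli _ _ _ _ _ (@plane_measure R) nu f mf f0).
apply: eq_integral => p _; rewrite /f /pot /=.
have mkp : measurable_fun setT (fun q : plane R => kern phi (to_cplx p) (to_cplx q)).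
  exact: (measurableT_comp mk (@measurable_pair1 _ _ _ _ p)).
rewrite (ge0_integralZl nu measurableT mkp)//.
- by move=> q _; exact: kern_ge0.
- by rewrite lee_fin sqr_ge0.
Qed.

Lemma pot_poly_le phi p N : disc_map phi ->
  (cintegral (fun z => (normc (psum (dseq p) N z) ^+ 2)%:E * pot phi z) <=
   cintegral (fun z => (normc (psum (dseq (shift p)) N.+1 z) ^+ 2)%:E * pot phi z))%E.
Proof.
move=> h; rewrite (cintegral_pot h (cmfun_psum (dseq p) N)).
rewrite (cintegral_pot h (cmfun_psum (dseq (shift p)) N.+1)).
have mt (b : nat -> C) M : measurable_fun setT (fun q : plane R =>
    cintegral (fun z => (normc (psum b M z) ^+ 2)%:E * kern phi z (to_cplx q))%E).
  pose f (q : plane R * plane R) := ((normc (psum b M (to_cplx q.1)) ^+ 2)%:E * kern phi (to_cplx q.1) (to_cplx q.2))%E.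
  apply: (@measurable_fun_fubini_tonelli_G _ _ _ _ _ (@plane_measure R) f).
    apply: emeasurable_funM; last exact: measurable_kern.
    apply/measurable_EFinP; apply: measurable_funX.
    exact: (measurableT_comp (measurable_normc (cmfun_psum b M)) measurable_fst).
  by move=> q; apply: mule_ge0; [rewrite lee_fin sqr_ge0|exact: kern_ge0].
have t0 (b : nat -> C) M (q : plane R) :
    (0 <= cintegral (fun z => (normc (psum b M z) ^+ 2)%:E * kern phi z (to_cplx q)))%E.
  by apply: integral_ge0 => p' _; apply: mule_ge0; [rewrite lee_fin sqr_ge0|exact: kern_ge0].
apply: ge0_le_integral; [exact: measurableT|by move=> q _; exact: t0|exact: mt|exact: mt|].
move=> q _; have [q1|q1] := ltP (normc (to_cplx q)) 1.
  under eq_cintegral do rewrite /kern q1.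
  under [leRHS]eq_cintegral do rewrite /kern q1.
  by apply: poly_green_le; case: h => _; apply.
have k0 z : kern phi z (to_cplx q) = 0%E by rewrite /kern ltNge q1.
by rewrite /cintegral !integral0_eq// => p' _; rewrite k0 mule0.
Qed.

End Potential.

(** * The weights obtained from U by automorphisms *)

Section DirichletWeights.
Variable R : realType.
Local Notation C := (Cplx R).
Local Notation D := (@plane_disc R).
Variable mu : {measure set (plane R) -> \bar R}.
Implicit Types (z w a : C) (phi g : C -> C).

(** Extension by 0 turns integrals over the disc into integrals over the plane, where the
    substitution rules are stated. *)
Definition UD phi z : \bar R := if normc z < 1 then U mu (phi z) else 0%E.

Lemma disc_map_id : disc_map (id : C -> C).
Proof. by split=> //; exact: cmfun_to_cplx. Qed.

Lemma disc_map_blaschke a : normc a < 1 -> disc_map (blaschke a).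
Proof.
move=> a1; split; last by move=> w; exact: blaschke_lt1.
apply: cmfun_div; first by apply: cmfunB; [exact: cmfun_cst|exact: cmfun_to_cplx].
apply: cmfunB; first exact: cmfun_cst.
by apply: cmfunM; [exact: cmfun_cst|exact: cmfun_to_cplx].
Qed.

Hypothesis mu_fin : (\int[mu]_(p in D) (1 - normc (to_cplx p) ^+ 2)%R%:E < +oo)%E.

(** Since [blaschke a] is an involution that leaves [green] invariant, [green (blaschke a z) w =
    green z (blaschke a w)]: the automorphism moves to the pole. *)
Lemma disc_potential : exists nu : {sigma_finite_measure set (plane R) -> \bar R},
  [/\ forall A, nu A = mu (A `&` D), UD id = pot nu id &
      forall a, normc a < 1 -> UD (blaschke a) = pot nu (blaschke a)].
Proof.
have [nu nuE] := disc_restriction mu_fin.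
have integral_nu (f : plane R -> \bar R) : (forall p, ~ D p -> f p = 0%E) ->
    (\int[nu]_p f p = \int[mu]_(p in D) f p)%E.
  move=> f0; transitivity (\int[nu]_(p in D) f p)%E.
    rewrite [RHS]integral_mkcond; apply: eq_integral => p _; rewrite patchE.
    by case: ifPn => //; rewrite notin_setE => /f0.
  apply: eq_measure_integral.
  by move=> A mA AD; have := nuE A; rewrite setIidl.
have E phi psi : disc_map psi -> (forall z w, normc z < 1 -> normc w < 1 ->
    green (phi z) w = green z (psi w)) -> UD phi = pot nu psi.
  move=> hpsi phipsi; apply/funext => z; rewrite /UD /pot.
  case: ifPn => z1; last first.
    rewrite integral0_eq// => p _; rewrite /kern /greenD (negbTE z1).
    by case: ifP.
  rewrite integral_nu; last first.
    by move=> p Dp; rewrite /kern ifN//; apply/negP.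
  apply: eq_integral => p; rewrite inE => p1.
  have p1' : normc (to_cplx p) < 1 := p1.
  by rewrite /kern p1' /greenD z1 phipsi.
exists nu; split=> //; first by apply: E => //; exact: disc_map_id.
move=> a a1; apply: E; first exact: disc_map_blaschke.
move=> z w z1 w1; rewrite -[in LHS](blaschkeK a1 (ltW w1)) green_blaschke//.
exact: blaschke_lt1.
Qed.

Lemma UD_ge0 a z : normc a < 1 -> (0 <= UD (blaschke a) z)%E.
Proof.
move=> a1; have [nu [_ _ E]] := disc_potential; rewrite (E _ a1); apply: pot_ge0.
exact: disc_map_blaschke.
Qed.

Lemma cmeasurable_UD a : normc a < 1 -> cmeasurable (UD (blaschke a)).
Proof.
move=> a1; have [nu [_ _ E]] := disc_potential; rewrite (E _ a1); apply: cmeasurable_pot.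
exact: disc_map_blaschke.
Qed.

Lemma UD_poly_le a p N : normc a < 1 ->
  (cintegral (fun z => (normc (psum (dseq p) N z) ^+ 2)%:E * UD (blaschke a) z) <=
   cintegral (fun z => (normc (psum (dseq (shift p)) N.+1 z) ^+ 2)%:E * UD (blaschke a) z))%E.
Proof.
move=> a1; have [nu [_ _ E]] := disc_potential; rewrite (E _ a1); apply: pot_poly_le.
exact: disc_map_blaschke.
Qed.

Hypothesis mu_radial : radial mu.

Lemma radial_UD : radial_weight (UD id).
Proof.
have [nu [nuE UE _]] := disc_potential.
have hid := disc_map_id.
split.
- by rewrite UE; apply: cmeasurable_pot.
- by move=> z; rewrite UE; exact: pot_ge0.
- move=> u z u1; rewrite UE /pot.
  have mrot : measurable_fun setT (rotation u).
    have [mr mi] : cmfun (fun p => u * @to_cplx R p) by apply: cmfunM; [exact: cmfun_cst|exact: cmfun_to_cplx].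
    exact: measurable_fun_pair mr mi.
  have rotE p : to_cplx (rotation u p) = u * to_cplx p by rewrite /to_cplx /= -cplxE.
  have mk : measurable_fun setT (fun q : plane R => kern id (u * z) (to_cplx q)).
    have := measurableT_comp (measurable_kern hid) (@measurable_pair1 _ _ _ _ (of_cplx (u * z))).
    by rewrite /comp /=; under eq_fun do rewrite of_cplxK.
  have k0 (q : plane R) : (0 <= kern id (u * z) (to_cplx q))%E by exact: kern_ge0.
  (* Radiality speaks of subsets of the disc only; intersecting with the disc extends it to all
     Borel sets for [nu]. *)
  have H A : measurable A -> nu A = nu (rotation u @^-1` A).
    move=> mA; rewrite !nuE.
    rewrite -(mu_radial u1 (measurableI _ _ mA (@measurable_plane_disc R))); last by move=> p [].
    congr (mu _); apply/seteqP; split=> p [Ap Dp]; split=> //.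
      by move: Dp; rewrite /plane_disc /unit_disc /= rotE normcM u1 mul1r.
    by move: Dp; rewrite /plane_disc /unit_disc /= rotE normcM u1 mul1r.
  transitivity (\int[pushforward nu (rotation u)]_p kern id (u * z) (to_cplx p))%E.
    by apply: eq_measure_integral => A mA _; exact: H.
  rewrite ge0_integral_pushforward//.
  apply: eq_integral => p _; rewrite /= rotE /kern /greenD !normcM u1 !mul1r.
  by case: ifP => // p1; case: ifP => // z1; exact: green_rotation.
- by move=> z z1; rewrite /UD ltNge z1.
Qed.

Lemma U_rotation u z : normc u = 1 -> normc z < 1 -> U mu (u * z) = U mu z.
Proof.
move=> u1 z1; have [_ _ /(_ u z u1) + _] := radial_UD.
by rewrite /UD normcM u1 mul1r z1.
Qed.

(** In [blaschke w (k * z) = k * blaschke (conj k * w) z] the rotation has moved to the outside,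
    where the radial [U] does not see it. *)
Lemma Aut_U phi : Aut phi -> exists2 a, normc a < 1 & UD phi = UD (blaschke a).
Proof.
move=> /Aut_blaschke [w [k [w1 k1 E]]]; exists ((k^*)%C * w).
  by rewrite normcM normc_conj k1 mul1r.
apply/funext => z; rewrite /UD; case: ifP => // z1; rewrite E//.
have kk : k * (k^*)%C = 1 by rewrite mul_conjE k1 expr1n.
have -> : blaschke w (k * z) = k * blaschke ((k^*)%C * w) z.
  have E1 : k * ((k^*)%C * w - z) = w - k * z by rewrite mulrBr mulrA kk mul1r.
  rewrite /blaschke conj_mul conjcK [RHS]mulrA E1.
  by congr (_ / (1 - _)); rewrite !mulrA (mulrC k).
apply: U_rotation => //; apply: blaschke_lt1 => //.
by rewrite normcM normc_conj k1 mul1r.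
Qed.

Lemma cintegral_UD_cov (w1 w2 : C -> \bar R) a g : normc a < 1 ->
  cmeasurable (fun z => (normc (g z) ^+ 2)%:E * w1 z)%E -> (forall z, 0 <= w1 z)%E ->
  (forall z, 1 <= normc z -> w1 z = 0%E) -> (forall z, 1 <= normc z -> w2 z = 0%E) ->
  (forall z, normc z < 1 -> w2 z = w1 (blaschke a z)) ->
  cintegral (fun z => (normc (g (blaschke a z) * dblaschke a z) ^+ 2)%:E * w2 z)%E =
  cintegral (fun z => (normc (g z) ^+ 2)%:E * w1 z)%E.
Proof.
move=> a1 mg w10 w1D w2D w12; rewrite -(cintegral_blaschke_deriv a1 mg w10 w1D).
apply: eq_cintegral => z; have [z1|z1] := ltP (normc z) 1; first by rewrite w12.
rewrite w2D// mule0; have [d0|d0] := eqVneq (1 - (a^*)%C * z) 0.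
  by rewrite /dblaschke d0 expr0n invr0 !mulr0 normc0 expr0n mul0e.
by rewrite w1D ?mule0// blaschke_ge1.
Qed.

Lemma cintegral_UD_blaschke a g : normc a < 1 ->
  cmeasurable (fun z => (normc (g z) ^+ 2)%:E * UD (blaschke a) z)%E ->
  cintegral (fun z => (normc (g (blaschke a z) * dblaschke a z) ^+ 2)%:E * UD id z)%E =
  cintegral (fun z => (normc (g z) ^+ 2)%:E * UD (blaschke a) z)%E.
Proof.
move=> a1 mg; apply: cintegral_UD_cov => //.
- by move=> z; exact: UD_ge0.
- by move=> z z1; rewrite /UD ltNge z1.
- by move=> z z1; rewrite /UD ltNge z1.
- by move=> z z1; rewrite /UD z1 blaschke_lt1// blaschkeK// ltW.
Qed.

Lemma integral_area (c : C -> R) phi : (forall z, 0 <= c z) ->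
  (forall z, 0 <= UD phi z)%E -> cmeasurable (fun z => (c z)%:E * UD phi z)%E ->
  (\int[@area R]_(p in D) ((c (to_cplx p))%:E * U mu (phi (to_cplx p))) =
   (pi^-1)%:E * cintegral (fun z => (c z)%:E * UD phi z))%E.
Proof.
move=> c0 u0 mc; transitivity (\int[@area R]_p ((c (to_cplx p))%:E * UD phi (to_cplx p)))%E.
  rewrite integral_mkcond; apply: eq_integral => p _; rewrite patchE /UD.
  have [p1|p1] := ltP (normc (to_cplx p)) 1; first by rewrite mem_set.
  by rewrite memNset ?mule0//; apply/negP; rewrite -leNgt.
rewrite /area ge0_integral_mscale// => p _.
by rewrite mule_ge0// lee_fin.
Qed.

End DirichletWeights.

(** * The extremal integral *)

Section GeometricDifference.
Variable R : realType.
Local Notation C := (Cplx R).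
Implicit Types (c d q z : C) (s : R).

(** Coefficients of [c / (1 - c z) - d / (1 - d z)]. *)
Definition geomdiff c d n : C := c ^+ n.+1 - d ^+ n.+1.

Lemma geom_tail q (s : C) N : normc q <= 1 -> normc s < 1 ->
  normc (q / (1 - q * s) - \sum_(n < N) q ^+ n.+1 * s ^+ n) <= normc s ^+ N / (1 - normc s).
Proof.
move=> q1 s1; have qs : normc (q * s) < 1.
  by rewrite normcM; apply: le_lt_trans s1; rewrite ler_piMl ?normc_ge0.
have d0 : 1 - q * s != 0.
  rewrite -normc_gt0; apply: lt_le_trans (lerB_normcB _ _).
  by rewrite normc1 subr_gt0.
have -> : q / (1 - q * s) - \sum_(n < N) q ^+ n.+1 * s ^+ n = q ^+ N.+1 * s ^+ N / (1 - q * s) :> C.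
  elim: N => [|N IH]; first by rewrite big_ord0 subr0 expr1 expr0 mulr1.
  rewrite big_ord_recr /= opprD addrA IH !exprS.
  by field.
rewrite !normcM normcV !normcX.
have s0 : 0 < 1 - normc s by rewrite subr_gt0.
have h : (normc (1 - q * s))^-1 <= (1 - normc s)^-1.
  rewrite lef_pV2 ?posrE ?normc_gt0//; apply: le_trans (lerB_normcB _ _).
  by rewrite normc1 lerD2l lerN2 normcM ler_piMl ?normc_ge0.
apply: ler_pM => //; rewrite ?mulr_ge0 ?exprn_ge0 ?invr_ge0 ?normc_ge0//.
by rewrite ler_piMl ?exprn_ge0 ?normc_ge0// exprn_ile1 ?normc_ge0.
Qed.

Lemma adm_geomdiff c d : normc c <= 1 -> normc d <= 1 -> adm (geomdiff c d).
Proof.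
move=> c1 d1 r /andP[r0 r1]; exists 2 => n.
have h : normc (geomdiff c d n) <= 2.
  apply: le_trans (ler_normcB _ _) _; rewrite !normcX -[2]/(1 + 1).
  by rewrite lerD// exprn_ile1 ?normc_ge0.
apply: le_trans h; rewrite ler_piMr ?normc_ge0// exprn_ile1// ltW//.
Qed.

Lemma pseries_geomdiff c d z : normc c <= 1 -> normc d <= 1 -> normc z < 1 ->
  pseries (geomdiff c d) z = c / (1 - c * z) - d / (1 - d * z).
Proof.
move=> c1 d1 z1; apply: limn_unique; rewrite -psum_series; apply/cvg_cplxP => e e0.
have z01 : 0 <= normc z < 1 by rewrite normc_ge0.
have [N hN] := geometric_small (2 / (1 - normc z)) z01 e0.
exists N => n Nn; apply: le_trans (hN n Nn).
have hc := geom_tail n c1 z1; have hd := geom_tail n d1 z1.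
have -> : psum (geomdiff c d) n z - (c / (1 - c * z) - d / (1 - d * z)) =
  (d / (1 - d * z) - \sum_(k < n) d ^+ k.+1 * z ^+ k) -
  (c / (1 - c * z) - \sum_(k < n) c ^+ k.+1 * z ^+ k) :> C.
  rewrite /psum big_mkord /geomdiff.
  under eq_bigr do rewrite mulrBl.
  by rewrite sumrB; ring.
apply: le_trans (ler_normcB _ _) _.
have -> : 2 / (1 - normc z) * normc z ^+ n = normc z ^+ n / (1 - normc z) + normc z ^+ n / (1 - normc z) by ring.
exact: lerD.
Qed.

(** The full sum of [|c^(n+1) - d^(n+1)|^2 s^n]: the square is expanded and the resulting geometric
    series are summed. *)
Definition geomdiff_limit c d s : R :=
  complex.Re ((c * (c^*)%C) / (1 - c * (c^*)%C * s%:C%C) + (d * (d^*)%C) / (1 - d * (d^*)%C * s%:C%C)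
    - (c * (d^*)%C) / (1 - c * (d^*)%C * s%:C%C) *+ 2 : C).

Lemma sqr_normc_geomdiff c d n :
  normc (geomdiff c d n) ^+ 2 =
  complex.Re ((c * (c^*)%C) ^+ n.+1 + (d * (d^*)%C) ^+ n.+1 - (c * (d^*)%C) ^+ n.+1 *+ 2 : C).
Proof.
rewrite /geomdiff !exprMn -!conj_exp.
move: (c ^+ n.+1) (d ^+ n.+1) => [x1 x2] [y1 y2].
by rewrite normc_sqr /=; ring.
Qed.

Lemma ReD z w : complex.Re (z + w : C) = complex.Re z + complex.Re w.
Proof. by case: z w => ? ? []. Qed.

Lemma ReB z w : complex.Re (z - w : C) = complex.Re z - complex.Re w.
Proof. by case: z w => ? ? []. Qed.

Lemma Re_mul_real z (r : R) : complex.Re (z * r%:C%C : C) = complex.Re z * r.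
Proof. by case: z => a b /=; rewrite mulr0 subr0. Qed.

Lemma ssum_geomdiff c d z N : normc c <= 1 -> normc d <= 1 -> normc z < 1 ->
  `|geomdiff_limit c d (normc z ^+ 2) - ssum (geomdiff c d) N z| <=
  4 / (1 - normc z ^+ 2) * (normc z ^+ 2) ^+ N.
Proof.
move=> c1 d1 z1; set s := normc z ^+ 2.
have s0 : 0 <= s by exact: sqr_ge0.
have s1 : s < 1 by rewrite exprn_ilt1 ?normc_ge0.
have ns : normc (s%:C%C : C) = s by rewrite normc_real ger0_norm.
have ns1 : normc (s%:C%C : C) < 1 by rewrite ns.
pose E q := q / (1 - q * (s%:C)%C) - \sum_(n < N) q ^+ n.+1 * (s%:C)%C ^+ n : C.
have hE q : normc q <= 1 -> normc (E q) <= s ^+ N / (1 - s).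
  by move=> q1; have := geom_tail N q1 ns1; rewrite ns.
have -> : geomdiff_limit c d s - ssum (geomdiff c d) N z =
  complex.Re (E (c * (c^*)%C) + E (d * (d^*)%C) - E (c * (d^*)%C) *+ 2).
  have -> : ssum (geomdiff c d) N z =
    complex.Re (\sum_(n < N) (c * (c^*)%C) ^+ n.+1 * (s%:C)%C ^+ n +
      \sum_(n < N) (d * (d^*)%C) ^+ n.+1 * (s%:C)%C ^+ n -
      (\sum_(n < N) (c * (d^*)%C) ^+ n.+1 * (s%:C)%C ^+ n) *+ 2 : C).
    rewrite -sumrMnl -big_split -sumrB /= /ssum big_mkord.
    elim: N {E hE} => [|N IH]; first by rewrite !big_ord0.
    rewrite !big_ord_recr /= IH ReD; congr (_ + _).
    rewrite sqr_normc_geomdiff exprM -/s.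
    rewrite -mulrnAl -mulrDl -mulrBl -rmorphXn /=.
    by rewrite Re_mul_real.
  rewrite /geomdiff_limit /E -ReB.
  by congr complex.Re; ring.
apply: le_trans (Re_le_normc _) _; apply: le_trans (ler_normcB _ _) _.
have L (x y : C) : normc x <= 1 -> normc y <= 1 -> normc (x * (y^*)%C) <= 1.
  by move=> x1 y1; rewrite normcM normc_conj mulr_ile1 ?normc_ge0.
rewrite mulr2n; apply: le_trans (lerD (ler_normcD _ _) (ler_normcD _ _)) _.
rewrite mulrAC -mulrA (_ : 4 = 2 + 2)%R; last by rewrite -natrD.
set T := s ^+ N / _ in hE *; rewrite mulrDl !mulr_natl !mulr2n.
by apply: lerD; apply: lerD; apply: hE; exact: L.
Qed.

Lemma Re_div z w : complex.Re (z / w : C) =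
  (complex.Re z * complex.Re w + complex.Im z * complex.Im w) / normc w ^+ 2.
Proof.
rewrite normc_sqr; case: z w => a b [x y] /=; ring.
Qed.

(** The extreme case is [q = -1]. *)
Lemma Re_geom_ge q s : normc q <= 1 -> 0 <= s < 1 ->
  - (1 + s)^-1 <= complex.Re (q / (1 - q * s%:C%C) : C).
Proof.
move=> q1 /andP[s0 s1].
have d0 : 0 < normc (1 - q * s%:C%C).
  apply: lt_le_trans (lerB_normcB _ _); rewrite normc1 subr_gt0 normcM normc_real ger0_norm//.
  by apply: le_lt_trans s1; rewrite ler_piMl.
have m1 : normc q ^+ 2 <= 1 by rewrite exprn_ile1 ?normc_ge0.
have := Re_le_normc q; rewrite ler_norml => /andP[xge _].
have {}xge : -1 <= complex.Re q by apply: le_trans xge; rewrite lerN2.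
have [qs dE] : complex.Re q * complex.Re (1 - q * s%:C%C : C) +
    complex.Im q * complex.Im (1 - q * s%:C%C : C) = complex.Re q - normc q ^+ 2 * s /\
    normc (1 - q * s%:C%C) ^+ 2 = 1 - 2 * s * complex.Re q + normc q ^+ 2 * s ^+ 2.
  by rewrite !normc_sqr; case: (q) => a b /=; split; ring.
have d2 := exprn_gt0 2 d0.
rewrite Re_div qs ler_pdivlMr// mulNr lerNl ler_pdivlMl ?ltr_wpDr//.
rewrite dE; move: (complex.Re q) (normc q ^+ 2) xge m1 => x m xge m1.
nra.
Qed.

Lemma Re_geom_le q s : normc q <= 1 -> 0 <= s < 1 ->
  complex.Re (q / (1 - q * s%:C%C) : C) <= (1 - s)^-1.
Proof.
move=> q1 /andP[s0 s1].
have s1' : normc (s%:C%C : C) < 1 by rewrite normc_real ger0_norm.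
have := geom_tail 0 q1 s1'; rewrite big_ord0 subr0 expr0 div1r normc_real ger0_norm//.
by apply: le_trans; apply: le_trans (Re_le_normc _); exact: ler_norm.
Qed.

(** The two diagonal terms are at most [1 / (1 - s)] each and the real part of the cross term is at
    least [- 1 / (1 + s)]; it enters with factor -2. *)
Lemma geomdiff_limit_le c d s : normc c <= 1 -> normc d <= 1 -> 0 <= s < 1 ->
  geomdiff_limit c d s <= 4 / (1 - s ^+ 2).
Proof.
move=> c1 d1 s01; have L (x y : C) : normc x <= 1 -> normc y <= 1 -> normc (x * (y^*)%C) <= 1.
  by move=> x1 y1; rewrite normcM normc_conj mulr_ile1 ?normc_ge0.
rewrite /geomdiff_limit ReB ReD mulr2n ReD.
have h1 := Re_geom_le (L _ _ c1 c1) s01; have h2 := Re_geom_le (L _ _ d1 d1) s01.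
have h3 := Re_geom_ge (L _ _ c1 d1) s01.
have -> : 4 / (1 - s ^+ 2) = (1 - s)^-1 + (1 - s)^-1 - (- (1 + s)^-1 - (1 + s)^-1).
  case/andP: s01 => s0 s1; field.
  by rewrite !gt_eqF//; nra.
lra.
Qed.

Lemma geomdiff_limit1 s : 0 <= s < 1 -> geomdiff_limit 1 (-1) s = 4 / (1 - s ^+ 2).
Proof.
move=> /andP[s0 s1]; rewrite /geomdiff_limit ReB ReD mulr2n ReD.
have cN : ((-1)^*)%C = -1 :> C by apply: cplx_eq; rewrite /= ?oppr0.
have c1 : (1^*)%C = 1 :> C by apply: cplx_eq; rewrite /= ?oppr0.
rewrite cN c1 mulrNN mulr1 (mul1r (-1)).
have E q (r : R) : q = r%:C%C -> 1 - r * s != 0 ->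
    complex.Re (q / (1 - q * s%:C%C) : C) = r / (1 - r * s).
  move=> -> rs; rewrite Re_div normc_sqr /= !(mul0r, mulr0, addr0, subr0, oppr0, expr0n) /=.
  by field.
rewrite (E 1 1) ?(E (-1) (-1)) ?mul1r ?mulN1r ?opprK//; last 3 first.
- by apply: cplx_eq; rewrite /= ?oppr0.
- by rewrite gt_eqF// ltr_wpDr.
- by rewrite gt_eqF// subr_gt0.
by field; rewrite !gt_eqF//; nra.
Qed.

End GeometricDifference.

(** * Extremality of the pair 1, -1 under a radial weight *)

Section GeometricWeight.
Variable R : realType.
Local Notation C := (Cplx R).
Local Notation D := (@plane_disc R).
Implicit Types (c d z a : C).

(** For a radial weight it suffices to compare circle means. Up to [e], [ssum (geomdiff c d) N] is
    below the limit for [c] and [d], which is at most the limit for 1 and -1, to which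
    [ssum (geomdiff 1 (-1)) n] converges. *)
Lemma cintegral_geomdiff_le (w : C -> \bar R) c d : radial_weight w ->
  normc c <= 1 -> normc d <= 1 ->
  (cintegral (fun z => (normc (pseries (geomdiff c d) z) ^+ 2)%:E * w z) <=
   cintegral (fun z => (normc (pseries (geomdiff 1 (-1)) z) ^+ 2)%:E * w z))%E.
Proof.
move=> rw c1 d1; have [mw w0 _ wD] := rw.
have n1 : normc (1 : C) <= 1 by rewrite normc1.
have nN1 : normc (-1 : C) <= 1 by rewrite normcN normc1.
apply: parseval_le => //; first exact: adm_geomdiff.
move=> N; apply: (weighted_fatou (a_ := fun m z => ssum (geomdiff 1 (-1)) m z)) => //.
- by move=> m; exact: cmeasurable_ssum.
- exact: cmeasurable_ssum.
- by move=> m z; exact: ssum_ge0.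
- by move=> z; exact: ssum_ge0.
- move=> z wz e e0.
  have z1 : normc z < 1 by rewrite ltNge; apply/negP => /wD wz0; rewrite wz0 eqxx in wz.
  have [s sE] : exists s, normc z ^+ 2 = s by exists (normc z ^+ 2).
  have s0 : 0 <= s by rewrite -sE; exact: sqr_ge0.
  have s1 : s < 1 by rewrite -sE exprn_ilt1 ?normc_ge0.
  have s01 : 0 <= s < 1 by rewrite s0.
  have e2 : 0 < e / 2 by rewrite divr_gt0.
  have [M hM] := geometric_small (4 / (1 - s)) s01 e2.
  exists (maxn N M) => n; rewrite geq_max => /andP[Nn Mn].
  have h1 := ssum_le (geomdiff c d) z Nn.
  have b1 := ssum_geomdiff n n1 nN1 z1; have b2 := ssum_geomdiff n c1 d1 z1.
  rewrite sE in b1 b2; rewrite (geomdiff_limit1 s01) in b1; rewrite distrC in b2.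
  have h2 := le_trans (ler_norm _) b1; have h3 := le_trans (ler_norm _) b2.
  have := geomdiff_limit_le c1 d1 s01; have := hM n Mn.
  move: h1 h2 h3; move: (4 / (1 - s) * s ^+ n) (geomdiff_limit c d s) (4 / (1 - s ^+ 2)).
  move: (ssum _ _ _) (ssum _ _ _) (ssum _ _ _) => x1 x2 x3 x4 x5 x6; clear; lra.
- by move=> m; apply: parseval_ge => //; exact: adm_geomdiff.
Qed.

Lemma normc_geomdiff1 z : normc z < 1 ->
  normc (pseries (geomdiff 1 (-1)) z) ^+ 2 = 4 / normc (1 - z ^+ 2) ^+ 2.
Proof.
move=> z1; rewrite pseries_geomdiff ?normcN ?normc1//.
have h1 : 1 - z != 0.
  by rewrite subr_eq0; apply/eqP => E; move: z1; rewrite -E normc1 ltxx.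
have h2 : 1 + z != 0.
  by rewrite addrC -(opprK 1) subr_eq0; apply/eqP => E; move: z1; rewrite E normcN normc1 ltxx.
have -> : 1 / (1 - 1 * z) - -1 / (1 - -1 * z) = 2 / (1 - z ^+ 2) :> C.
  have h3 : 1 - z ^+ 2 != 0 by rewrite -[X in X - _](expr1n _ 2) subr_sqr mulf_neq0.
  by rewrite (mulN1r z) opprK mul1r; field; rewrite ?h1 ?h2 ?h3.
by rewrite normcM normcV normc_nat exprMn exprVn -natrX.
Qed.

Variable mu : {measure set (plane R) -> \bar R}.
Hypothesis mu_fin : (\int[mu]_(p in D) (1 - normc (to_cplx p) ^+ 2)%R%:E < +oo)%E.
Hypothesis mu_radial : radial mu.

Definition extremal_integral :=
  cintegral (fun z => (4 / normc (1 - z ^+ 2) ^+ 2)%:E * UD mu id z)%E.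

Lemma extremal_integralE : extremal_integral =
  cintegral (fun z => (normc (pseries (geomdiff 1 (-1)) z) ^+ 2)%:E * UD mu id z)%E.
Proof.
apply: eq_cintegral => z; have [z1|z1] := ltP (normc z) 1; first by rewrite normc_geomdiff1.
by rewrite /UD ltNge z1 !mule0.
Qed.

(** With [psi = blaschke a] and [c = blaschke (conj a) rho], [1 - rho psi] is a constant times
    [(1 - c z) / (1 - conj a z)]. Its logarithmic derivative gives [rho psi' / (1 - rho psi) = c /
    (1 - c z) - conj a / (1 - conj a z)], the series of a [geomdiff]. *)
Lemma cintegral_kernel_le a (rho : R) : normc a < 1 -> 0 < rho <= 1 ->
  (cintegral (fun z => (normc (1 - rho%:C%C * z)^-1 ^+ 2)%:E * UD mu (blaschke a) z) <=
   (rho ^- 2)%:E * extremal_integral)%E.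
Proof.
move=> a1 /andP[rho0 rho1].
have nrho : normc (rho%:C%C : C) = rho by rewrite normc_real ger0_norm ?ltW.
have rn : (rho%:C%C : C) != 0 by rewrite -normc_gt0 nrho.
have a1' : normc ((a^*)%C : C) < 1 by rewrite normc_conj.
pose c := blaschke (a^*)%C (rho%:C)%C.
have c1 : normc c <= 1 by apply: blaschke_le1 => //; rewrite nrho.
have d1 := ltW a1'.
have mg : cmfun (fun p => (1 - rho%:C%C * @to_cplx R p)^-1 : C).
  apply: cmfunV; apply: cmfunB; first exact: cmfun_cst.
  by apply: cmfunM; [exact: cmfun_cst|exact: cmfun_to_cplx].
have mh : cmeasurable (fun z => (normc (1 - rho%:C%C * z)^-1 ^+ 2)%:E * UD mu (blaschke a) z)%E.
  apply: emeasurable_funM; last exact: cmeasurable_UD.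
  by apply/measurable_EFinP; apply: measurable_funX; exact: measurable_normc.
rewrite -(@cintegral_UD_blaschke R mu mu_fin a (fun z => (1 - rho%:C%C * z)^-1) a1 mh).
have rU := radial_UD mu_fin mu_radial; have [mU U0 _ _] := rU.
have r2 : (0 <= (rho ^- 2)%:E)%E by rewrite lee_fin invr_ge0 sqr_ge0.
have h := cintegral_geomdiff_le rU c1 d1; rewrite extremal_integralE.
apply: (le_trans _ (lee_wpmul2l r2 h)).
have mp := cmeasurable_pseries (adm_geomdiff c1 d1) rU.
rewrite -cintegralZl//; last by move=> z; apply: mule_ge0 => //; rewrite lee_fin sqr_ge0.
rewrite le_eqVlt; apply/orP; left; apply/eqP.
apply: eq_cintegral => z; have [z1|z1] := ltP (normc z) 1; last by rewrite /UD ltNge z1 !mule0.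
rewrite muleA -EFinM pseries_geomdiff//; congr (_%:E * _)%E.
rewrite -nrho -exprVn -normcV -exprMn -normcM; congr (_ ^+ 2).
have ha := blaschke_den_neq0 a1 (ltW z1).
have hr : 1 - a * rho%:C%C != 0 :> C.
  by have := @blaschke_den_neq0 _ (a^*)%C (rho%:C)%C a1'; rewrite conjcK nrho; apply.
have hc : 1 - c * z != 0.
  rewrite -normc_gt0; apply: lt_le_trans (lerB_normcB _ _); rewrite normc1 subr_gt0 normcM.
  by apply: le_lt_trans z1; rewrite ler_piMl ?normc_ge0.
rewrite nrho; have -> : (1 - rho%:C%C * blaschke a z)^-1 * dblaschke a z =
   (rho%:C)%C^-1 * (c / (1 - c * z) - (a^*)%C / (1 - (a^*)%C * z)) :> C.
  have -> : dblaschke a z = (a * (a^*)%C - 1) / (1 - (a^*)%C * z) ^+ 2.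
    by rewrite /dblaschke mul_conjE rmorphB rmorph1.
  move: hc; rewrite /c /blaschke conjcK.
  move: ha hr rn; move: ((a^*)%C) ((rho%:C)%C) => b r ha hr rn hc.
  have E : 1 - a * r - (b - r) * z = (1 - a * r) * (1 - (b - r) / (1 - a * r) * z) by field.
  by field; rewrite ha hr rn E mulf_neq0.
by [].
Qed.

End GeometricWeight.

(** * The upper bound *)

Section CesaroUpperBound.
Variable R : realType.
Local Notation C := (Cplx R).
Local Notation D := (@plane_disc R).
Implicit Types (a : nat -> C) (z : C) (f : C -> C) (rho : R).

Definition psums a n : C := \sum_(0 <= k < n.+1) a k.

Definition cesaro_coef a n : C := (n.+1%:R)^-1 * psums a n.

Lemma cesaro_opE f : cesaro_op f = pseries (cesaro_coef (coefs f)).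
Proof. by []. Qed.

Lemma adm_psums a : adm a -> forall r, 0 < r < 1 -> exists K, forall n,
  normc (psums a n) * r ^+ n <= n.+1%:R * K.
Proof.
move=> aa r r01; have [K hK] := aa r r01; exists K => n.
have [r0 r1] := andP r01.
rewrite /psums; apply: (@le_trans _ _ (\sum_(0 <= k < n.+1) normc (a k) * r ^+ k)).
  apply: le_trans (ler_wpM2r (exprn_ge0 n (ltW r0)) (normc_sum _ _ _)) _.
  rewrite mulr_suml !big_mkord; apply: ler_sum => k _.
  by rewrite ler_wpM2l ?normc_ge0// ler_wiXn2l ?(ltW r0) ?(ltW r1)// -ltnS.
apply: le_trans (ler_sum _ (fun k _ => hK k)) _.
by rewrite sumr_const_nat subn0 mulr_natl.
Qed.

Lemma adm_cesaro_coef a : adm a -> adm (cesaro_coef a).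
Proof.
move=> aa r r01; have [K hK] := adm_psums aa r01; exists K => n.
have h := hK n; rewrite /cesaro_coef normcM normcV normc_nat -mulrA.
by rewrite ler_pdivrMl.
Qed.

Lemma adm_is_power_series f a : is_power_series f a -> adm a.
Proof.
move=> fa r /andP[r0 r1].
have nr : normc (r%:C%C : C) = r by rewrite normc_real ger0_norm ?ltW.
have zD : unit_disc (r%:C%C : C) by rewrite /unit_disc /= nr.
have := fa _ zD; rewrite -psum_series => /cvg_cplxP /(_ 1 ltr01)[N hN].
exists (2 + \sum_(0 <= n < N) normc (a n) * r ^+ n) => n.
have s0 M : 0 <= \sum_(0 <= n < M) normc (a n) * r ^+ n.
  by apply: sumr_ge0 => k _; rewrite mulr_ge0 ?normc_ge0// exprn_ge0// ltW.
have [Nn|nN] := leqP N n.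
  apply: (@le_trans _ _ 2); last by rewrite lerDl.
  have -> : normc (a n) * r ^+ n = normc (psum a n.+1 (r%:C)%C - psum a n (r%:C)%C).
    by rewrite psumS addrC addKr normcM normcX nr.
  apply: le_trans (normc_distD (f (r%:C)%C) _ _) _.
  have := hN n Nn; rewrite normcBC; have := hN n.+1 (leqW Nn); lra.
rewrite (@big_cat_nat _ _ _ n.+1 0 N)//= big_nat_recr//=.
have := s0 n; have : 0 <= \sum_(n.+1 <= k < N) normc (a k) * r ^+ k.
  by apply: sumr_ge0 => k _; rewrite mulr_ge0 ?normc_ge0// exprn_ge0// ltW.
lra.
Qed.

Lemma is_power_series_eq f a z : is_power_series f a -> normc z < 1 -> f z = pseries a z.
Proof. by move=> fa z1; rewrite /pseries (limn_unique (fa z z1)). Qed.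

Lemma psum_at0 a N : psum a N.+1 0 = a 0%N.
Proof.
elim: N => [|N IH]; first by rewrite psumS psum0 expr0 add0r mulr1.
by rewrite psumS IH expr0n mulr0 addr0.
Qed.

Lemma pseries_at0 a : pseries a 0 = a 0%N.
Proof.
apply: limn_unique; rewrite -psum_series; apply/cvg_cplxP => e e0.
by exists 1%N => -[//|n] _; rewrite psum_at0 subrr normc0 ltW.
Qed.

Lemma psum_scale a (t : C) N z : psum (fun n => a n * t ^+ n) N z = psum a N (t * z).
Proof. by rewrite /psum; apply: eq_bigr => n _; rewrite exprMn mulrA. Qed.

Lemma adm_shift a : adm a -> adm (shift a).
Proof.
move=> aa r r01; have [K hK] := aa r r01; exists K => n; have [r0 r1] := andP r01.
have K0 : 0 <= K.
  by apply: le_trans (hK 0%N); rewrite mulr_ge0 ?normc_ge0// exprn_ge0// ltW.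
case: n => [|n]; first by rewrite normc0 mul0r.
apply: le_trans (hK n); rewrite ler_wpM2l ?normc_ge0//.
by rewrite exprS ler_piMl ?exprn_ge0// ltW.
Qed.

(** [shift] multiplies the Cesaro transform [F] by [z], so the sums [psums a] are the coefficients
    of [(z F)']. *)
Lemma psumsE a : psums a = dseq (shift (cesaro_coef a)).
Proof.
apply/funext => n; rewrite /dseq /= /cesaro_coef mulVKf//.
Qed.

Lemma adm_psums_seq a : adm a -> adm (psums a).
Proof. by move=> aa; rewrite psumsE; exact/adm_dseq/adm_shift/adm_cesaro_coef. Qed.

Lemma pseries_psums a z : adm a -> normc z < 1 -> pseries a z = (1 - z) * pseries (psums a) z.
Proof.
move=> aa z1; have E N : psum a N.+1 z =
    0 + 1 * psum (psums a) N.+1 z + (- z) * psum (psums a) N z.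
  have := psum_shift (psums a) 1 (-1) z N.
  have -> : (fun n => 1 * psums a n + -1 * shift (psums a) n) = a.
    apply/funext => -[|n] /=; rewrite /psums ?big_nat1 ?mulr0 ?addr0 ?mul1r//.
    by rewrite [in X in X + _]big_nat_recr//= mulN1r addrAC subrr add0r.
  by move=> ->; rewrite mulN1r add0r.
by rewrite (pseries_linear (adm_psums_seq aa) z1 E) add0r.
Qed.

(** The tails are uniformly small for [|w| <= rho], and an error of [d / 2] is absorbed by the
    factor [1 + d] because [1 / |1 - w|] is at least 1/2. *)
Lemma normc_psums_le a rho d : adm a ->
  (forall z, normc z < 1 -> normc (pseries a z) <= 1) -> 0 < rho < 1 -> 0 < d ->
  exists N, forall n z, (N <= n)%N -> normc z < 1 ->
    normc (psum (psums a) n (rho%:C%C * z)) <= (1 + d) * normc (1 - rho%:C%C * z)^-1.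
Proof.
move=> aa fa /andP[rho0 rho1] d0.
have nrho : normc (rho%:C%C : C) = rho by rewrite normc_real ger0_norm ?ltW.
pose r := (1 + rho) / 2.
have r01 : 0 < r < 1 by rewrite /r; apply/andP; split; lra.
have [r0 r1] := andP r01.
pose q := rho / r.
have q01 : 0 <= q < 1.
  by rewrite /q divr_ge0 ?(ltW rho0) ?(ltW r0)//= ltr_pdivrMr// /r; lra.
have [K hK] := adm_psums_seq aa r01.
have d2 : 0 < d / 2 by rewrite divr_gt0.
have [N hN] := geometric_small (2 * K / (1 - q)) q01 d2.
exists N => n z Nn z1.
have zr : normc (rho%:C%C * z) <= rho by rewrite normcM nrho ler_piMr ?ltW.
have wr : normc (rho%:C%C * z) < 1 := le_lt_trans zr rho1.
have zq : normc (rho%:C%C * z) <= q * r by rewrite /q mulfVK// gt_eqF.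
have [_ /(_ n) h] := pseries_tail r0 q01 zq hK.
have h2 : normc (psum (psums a) n (rho%:C%C * z) - pseries (psums a) (rho%:C%C * z)) <= d / 2.
  apply: le_trans h (le_trans _ (hN n Nn)); rewrite le_eqVlt; apply/orP; left; apply/eqP; ring.
move: (rho%:C%C * z) wr h2 => w wr h2.
have w0 : 0 < normc (1 - w).
  by apply: lt_le_trans (lerB_normcB _ _); rewrite normc1 subr_gt0.
have w2 : normc (1 - w) <= 2.
  by apply: le_trans (ler_normcB _ _) _; rewrite normc1 -[leRHS]/(1 + 1) lerD2l ltW.
have h3 : normc (pseries (psums a) w) <= normc (1 - w)^-1.
  rewrite normcV -[leRHS]mul1r ler_pdivlMr// mulrC -normcM -pseries_psums//; exact: fa.
have h4 : d / 2 <= d * normc (1 - w)^-1.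
  by rewrite normcV ler_pM2l// lef_pV2// posrE.
rewrite mulrDl mul1r addrC.
have := ler_normcD (psum (psums a) n w - pseries (psums a) w) (pseries (psums a) w).
rewrite subrK => h5; apply: le_trans h5 _; apply: lerD => //.
exact: le_trans h2 h4.
Qed.

(** A multiplicative error [1 + e] keeps its meaning when [M] is infinite, and for finite [M] it
    tends to nothing. *)
Lemma fatou_factor (a_ : nat -> C -> R) (g : C -> R) (w : C -> \bar R) (M : \bar R) :
  (forall n, cmeasurable (fun z => (a_ n z)%:E * w z)%E) ->
  cmeasurable (fun z => (g z)%:E * w z)%E ->
  (forall n z, 0 <= a_ n z) -> (forall z, 0 <= g z) -> (forall z, 0 <= w z)%E ->
  (forall z, w z != 0%E -> forall e : R, 0 < e ->
    exists N, forall n, (N <= n)%N -> g z - e <= a_ n z) ->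
  (forall e : R, 0 < e -> exists N, forall n, (N <= n)%N ->
    (cintegral (fun z => (a_ n z)%:E * w z) <= (1 + e)%:E * M)%E) ->
  (0 <= M)%E -> (cintegral (fun z => (g z)%:E * w z) <= M)%E.
Proof.
move=> ma mg a0 g0 w0 lim hM M0.
have H e : 0 < e -> (cintegral (fun z => (g z)%:E * w z) <= (1 + e)%:E * M)%E.
  move=> e0; have [N hN] := hM e e0.
  apply: (weighted_fatou (a_ := fun n => a_ (N + n)%N)) => //.
    move=> z wz e' e'0; have [N2 hN2] := lim z wz e' e'0.
    by exists N2 => n n2; apply: hN2; apply: leq_trans n2 _; exact: leq_addl.
  by move=> n; apply: hN; exact: leq_addr.
case: M M0 H {hM} => [m m0 H| |//]; last by move=> _ _; rewrite leey.
rewrite lee_fin in m0; apply/lee_addgt0Pr => e e0.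
have m1 : 0 < m + 1 by rewrite ltr_wpDl.
apply: le_trans (H _ (divr_gt0 e0 m1)) _; rewrite -EFinM -EFinD lee_fin.
by rewrite mulrDl mul1r lerD2l mulrAC ler_pdivrMr// ler_pM2l//; lra.
Qed.

Lemma ccont_sqr_lower (q : C -> C) z e : ccont q z -> 0 < e ->
  exists2 d : R, 0 < d & forall w, normc (w - z) < d -> normc (q z) ^+ 2 - e <= normc (q w) ^+ 2.
Proof.
move=> cq e0; have G0 := normc_ge0 (q z).
have G1 : 0 < 2 * normc (q z) + 1 by rewrite ltr_wpDl// mulr_ge0.
have [d d0 hd] := cq _ (divr_gt0 e0 G1).
exists d => // w wd; have := hd w wd; rewrite normcBC => h.
apply: le_trans (sqr_normc_lower (lexx _) h); rewrite lerD2l lerN2 mulrA ler_pdivrMr//.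
by rewrite mulrC ler_pM2l// lerDl.
Qed.

Lemma pseries_scale (b : nat -> C) (t : C) z : pseries (fun n => b n * t ^+ n) z = pseries b (t * z).
Proof.
congr (limn (series _)); apply/funext => n; by rewrite exprMn mulrA.
Qed.

Lemma pseriesZ (b : nat -> C) (t : C) z : adm b -> normc z < 1 ->
  pseries (fun n => t * b n) z = t * pseries b z.
Proof.
move=> ab z1; rewrite (@pseries_linear _ b (fun n => t * b n) z 0 t 0)// ?add0r ?addr0//.
by move=> N; rewrite mul0r addr0 add0r /psum mulr_sumr; apply: eq_bigr => n _; rewrite mulrA.
Qed.

Definition dilate (t : C) (b : nat -> C) n : C := b n * t ^+ n.

Lemma adm_dilate t b : normc t <= 1 -> adm b -> adm (dilate t b).
Proof.
move=> t1 ab r r01; have [K hK] := ab r r01; have [r0 r1] := andP r01; exists K => n.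
apply: le_trans (hK n); rewrite ler_wpM2r ?exprn_ge0 ?(ltW r0)//.
by rewrite normcM normcX ler_piMr ?normc_ge0// exprn_ile1 ?normc_ge0.
Qed.

Lemma pseries_dseq_dilate t b z : normc t <= 1 -> adm b -> normc z < 1 ->
  pseries (dseq (dilate t b)) z = t * pseries (dseq b) (t * z).
Proof.
move=> t1 ab z1; have tz : normc (t * z) < 1.
  by rewrite normcM; apply: le_lt_trans z1; rewrite ler_piMl ?normc_ge0.
rewrite -pseries_scale -pseriesZ//; last by apply: adm_dilate => //; exact: adm_dseq.
by congr pseries; apply/funext => n; rewrite /dseq /dilate exprS mulrA mulrCA.
Qed.

Lemma cmeasurable_sqr_pseries b (w : C -> \bar R) : adm b -> cmeasurable w ->
  (forall z, 1 <= normc z -> w z = 0%E) ->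
  cmeasurable (fun z => (normc (pseries b z) ^+ 2)%:E * w z)%E.
Proof.
move=> ab mw wD.
apply: (cmeasurable_disc_limit (a_ := fun N z => normc (psum b N z) ^+ 2)) => //.
  by move=> n; exact: measurable_sqr_psum.
by move=> z z1; exact: sqr_psum_cvg.
Qed.

Variable mu : {measure set (plane R) -> \bar R}.
Hypothesis mu_fin : (\int[mu]_(p in D) (1 - normc (to_cplx p) ^+ 2)%R%:E < +oo)%E.
Hypothesis mu_radial : radial mu.

Lemma UD_out phi z : 1 <= normc z -> UD mu phi z = 0%E.
Proof. by move=> z1; rewrite /UD ltNge z1. Qed.

Lemma UD_neq0 phi z : UD mu phi z != 0%E -> normc z < 1.
Proof. by move=> h; rewrite ltNge; apply/negP => /(UD_out phi) E; rewrite E eqxx in h. Qed.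

Lemma extremal_integral_ge0 : (0 <= extremal_integral mu)%E.
Proof.
have [_ U0 _ _] := radial_UD mu_fin mu_radial.
by apply: integral_ge0 => p _; apply: mule_ge0 => //; rewrite lee_fin divr_ge0 ?sqr_ge0.
Qed.

Section FixedFunction.
Variables (a : nat -> C) (b : C).
Hypotheses (aa : adm a) (fa : forall z, normc z < 1 -> normc (pseries a z) <= 1).
Hypothesis b1 : normc b < 1.
Local Notation s := (cesaro_coef a).
Local Notation W := (UD mu (blaschke b)).

Let W0 z : (0 <= W z)%E. Proof. exact: UD_ge0. Qed.
Let mW : cmeasurable W. Proof. exact: cmeasurable_UD. Qed.
Let as_ : adm s. Proof. exact: adm_cesaro_coef. Qed.

(** Dilation makes the partial sums converge uniformly on the disc. [UD_poly_le] replaces [P'] by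
    [(zP)'], [normc_psums_le] bounds the latter by the kernel, and [cintegral_kernel_le] integrates
    it. *)
Lemma cesaro_dilate_le rho : 0 < rho < 1 ->
  (cintegral (fun z => (normc (pseries (dseq (dilate rho%:C%C s)) z) ^+ 2)%:E * W z) <=
   (rho ^- 2)%:E * extremal_integral mu)%E.
Proof.
move=> rho01; have [rho0 rho1] := andP rho01.
have nrho : normc (rho%:C%C : C) = rho by rewrite normc_real ger0_norm ?ltW.
have nrho1 : normc (rho%:C%C : C) <= 1 by rewrite nrho ltW.
pose p := dilate (rho%:C)%C s.
have ap : adm p by exact: adm_dilate.
have r2 : (0 <= (rho ^- 2)%:E)%E by rewrite lee_fin invr_ge0 sqr_ge0.
have mpsum (h : nat -> C) n : cmeasurable (fun z => (normc (psum h n z) ^+ 2)%:E * W z)%E.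
  by apply: emeasurable_funM => //; apply/measurable_EFinP; exact: measurable_sqr_psum.
apply: (fatou_factor (a_ := fun n z => normc (psum (dseq p) n z) ^+ 2)) => //.
- exact: (cmeasurable_sqr_pseries (adm_dseq ap) mW (@UD_out _)).
- by move=> n z; exact: sqr_ge0.
- by move=> z; exact: sqr_ge0.
- move=> z /UD_neq0 z1 e e0.
  have /cvgrPdist_le /(_ e e0) [N _ hN] := sqr_psum_cvg (adm_dseq ap) z1.
  by exists N => n Nn; have := hN _ Nn; rewrite /= ler_norml => /andP[_]; rewrite lerBlDr addrC -lerBlDr.
(* Then [(1 + d) ^+ 2 <= 1 + 3 * d <= 1 + e], using [d <= 1]. *)
- move=> e e0; pose d := Num.min (e / 3) 1.
  have d0 : 0 < d by rewrite lt_min divr_gt0//= ltr01.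
  have d1 : d <= 1 by rewrite ge_min lexx orbT.
  have de : d <= e / 3 by rewrite ge_min lexx.
  have dd : (1 + d) ^+ 2 <= 1 + e.
    by have : 3 * d <= e; [rewrite mulrC -ler_pdivlMr|nra].
  have [N hN] := normc_psums_le aa fa rho01 d0.
  exists N => n Nn; apply: le_trans (UD_poly_le mu_fin p n b1) _.
  (* For [P] a partial sum of [F(rho z)], [(zP)'] is a partial sum of [psums a] evaluated at
     [rho z], with no extra factor [rho]. *)
  have E : dseq (shift p) = dilate (rho%:C)%C (psums a).
    by rewrite psumsE; apply/funext => k; rewrite /dseq /dilate /= /p /dilate mulrA.
  have rho01' : 0 < rho <= 1 by rewrite rho0 ltW.
  have mk : cmeasurable (fun z => (normc (1 - rho%:C%C * z)^-1 ^+ 2)%:E * W z)%E.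
    apply: emeasurable_funM => //; apply/measurable_EFinP; apply: measurable_funX.
    apply: measurable_normc; apply: cmfunV; apply: cmfunB; first exact: cmfun_cst.
    by apply: cmfunM; [exact: cmfun_cst|exact: cmfun_to_cplx].
  have k0 z : (0 <= (normc (1 - rho%:C%C * z)^-1 ^+ 2)%:E * W z)%E.
    by apply: mule_ge0 => //; rewrite lee_fin sqr_ge0.
  have dd0 : (0 <= ((1 + d) ^+ 2)%:E)%E by rewrite lee_fin sqr_ge0.
  have B0 : (0 <= (rho ^- 2)%:E * extremal_integral mu)%E.
    by apply: mule_ge0 => //; exact: extremal_integral_ge0.
  have dde : (((1 + d) ^+ 2)%:E <= (1 + e)%:E)%E by rewrite lee_fin.
  apply: (le_trans _ (lee_wpmul2r B0 dde)).
  apply: (le_trans _ (lee_wpmul2l dd0 (cintegral_kernel_le mu_fin mu_radial b1 rho01'))).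
  rewrite -(cintegralZl dd0 mk k0); apply: cintegral_le.
  + exact: mpsum.
  + by apply: measurable_funeM; exact: mk.
  + by move=> z; apply: mule_ge0 => //; rewrite lee_fin sqr_ge0.
  + move=> z; have [z1|z1] := ltP (normc z) 1; last by rewrite UD_out// !mule0.
    rewrite muleA -EFinM; apply: lee_wpmul2r => //; rewrite lee_fin E psum_scale -exprMn.
    have d10 : 0 <= 1 + d by rewrite addr_ge0// ltW.
    rewrite ler_sqr ?nnegrE ?normc_ge0 ?mulr_ge0 ?normc_ge0//.
    by apply: hN => //; exact: leqW.
- by apply: mule_ge0 => //; exact: extremal_integral_ge0.
Qed.

Lemma cesaro_integral_le :
  (cintegral (fun z => (normc (pseries (dseq s) z) ^+ 2)%:E * W z) <= extremal_integral mu)%E.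
Proof.
(* Its inverse is [1 + 1 / (n + 1)], so the factor [rho ^- 2] tends to 1 and is absorbed by
   [fatou_factor]. *)
pose rho n : R := n.+1%:R / n.+2%:R.
have rho01 n : 0 < rho n < 1.
  by rewrite /rho divr_gt0//= ltr_pdivrMr// mul1r ltr_nat.
have nrho1 n : normc ((rho n)%:C%C : C) <= 1.
  by have /andP[h0 h1] := rho01 n; rewrite normc_real ger0_norm ?ltW.
have small (e : R) : 0 < e -> exists N, forall n, (N <= n)%N -> n.+1%:R^-1 < e.
  move=> e0; exists (Num.truncn e^-1) => n Nn.
  rewrite invf_plt ?posrE//; apply: lt_le_trans (truncnS_gt _) _.
  by rewrite ler_nat ltnS.
have mp b' : adm b' -> cmeasurable (fun z => (normc (pseries b' z) ^+ 2)%:E * W z)%E.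
  by move=> ab; exact: (cmeasurable_sqr_pseries ab mW (@UD_out _)).
apply: (fatou_factor (a_ := fun n z => normc (pseries (dseq (dilate (rho n)%:C%C s)) z) ^+ 2)) => //.
- by move=> n; apply: mp; apply: adm_dseq; exact: adm_dilate.
- by apply: mp; exact: adm_dseq.
- by move=> n z; exact: sqr_ge0.
- by move=> z; exact: sqr_ge0.
- move=> z /UD_neq0 z1 e e0; pose q (t : C) := t * pseries (dseq s) (t * z).
  have cq : ccont q 1.
    apply: ccontM; first exact: ccont_id.
    apply: (@ccont_comp _ (pseries (dseq s)) (fun t => t * z)).
      by apply: ccontM; [exact: ccont_id|exact: ccont_cst].
    rewrite mul1r; apply: cderive_continuous.
    by apply: cderive_pseries => //; exact: adm_dseq.
  have [d d0 hd] := ccont_sqr_lower cq e0.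
  have [N hN] := small d d0; exists N => n Nn.
  have := hd ((rho n)%:C)%C; rewrite /q !mul1r => h.
  rewrite pseries_dseq_dilate//; apply: h.
  have -> : (rho n)%:C%C - 1 = - ((n.+2%:R^-1)%:C)%C :> C.
    rewrite -(rmorph1 (real_complex R)) -rmorphB -rmorphN; congr (_%:C)%C.
    have -> : rho n = 1 - n.+2%:R^-1; last by rewrite addrAC subrr add0r.
    have h : n.+1%:R = n.+2%:R - 1 :> R by rewrite -(natr1 n.+1) addrK.
    by rewrite /rho h mulrBl divff ?pnatr_eq0// mul1r.
  rewrite normcN normc_real ger0_norm//; apply: le_lt_trans (hN n Nn).
  by rewrite lef_pV2 ?posrE// ler_nat.
- move=> e e0; pose d := Num.min (e / 3) 1.
  have d0 : 0 < d by rewrite lt_min divr_gt0//= ltr01.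
  have d1 : d <= 1 by rewrite ge_min lexx orbT.
  have de : d <= e / 3 by rewrite ge_min lexx.
  have dd : (1 + d) ^+ 2 <= 1 + e.
    by have : 3 * d <= e; [rewrite mulrC -ler_pdivlMr|nra].
  have [N hN] := small d d0; exists N => n Nn.
  apply: le_trans (cesaro_dilate_le (rho01 n)) _.
  apply: lee_wpmul2r; first exact: extremal_integral_ge0.
  rewrite lee_fin; apply: le_trans dd; rewrite -exprVn.
  have -> : (rho n)^-1 = 1 + n.+1%:R^-1.
    by rewrite /rho invf_div -(natr1 n.+1) mulrDl mulfV ?mul1r.
  have h0 : 0 <= n.+1%:R^-1 :> R by [].
  by rewrite ler_sqr ?nnegrE ?addr_ge0 ?(ltW d0)// lerD2l ltW// hN.
- exact: extremal_integral_ge0.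
Qed.

End FixedFunction.

End CesaroUpperBound.

(** * The lower bound *)

Section BoundaryBehaviour.
Variable R : realType.
Local Notation C := (Cplx R).
Implicit Types (z w : C) (t d : R).

(** Coefficients of [F'] for [f = 1], where [F(z) = sum z^n / (n + 1)]. *)
Definition cesaro1_deriv n : C := n.+1%:R / n.+2%:R.

(** Since [(n + 1) / (n + 2) = 1 - 1 / (n + 2)], a geometric series splits off and a series of
    logarithmic growth remains. *)
Lemma psum_cesaro1_deriv M w :
  (1 - w) * psum cesaro1_deriv M w =
  1 - w ^+ M - (1 - w) * psum (fun n => n.+2%:R^-1) M w.
Proof.
elim: M => [|M IH]; first by rewrite !psum0 expr0; ring.
have E : cesaro1_deriv M = 1 - M.+2%:R^-1.
  have m2 : M.+2%:R != 0 :> C by rewrite -normc_gt0 normc_nat.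
  have h : M.+1%:R = M.+2%:R - 1 :> C by rewrite -(natr1 M.+1) addrK.
  by rewrite /cesaro1_deriv h mulrBl divff// mul1r.
by rewrite psumS (psumS _ M) mulrDr IH E exprS; ring.
Qed.

(** The first [N] terms are at most 1 each, the later ones at most [1 / (N + 1)] times a geometric
    series. As [N] is free, the sum is [o(1 / (1 - |w|))]. *)
Lemma psum_harmonic_le M N w : normc w < 1 ->
  normc (psum (fun n => n.+2%:R^-1) M w) <= N%:R + (N.+1%:R)^-1 / (1 - normc w).
Proof.
move=> w1; have w0 := normc_ge0 w; have w1' : 0 < 1 - normc w by rewrite subr_gt0.
apply: le_trans (normc_sum _ _ _) _.
apply: (@le_trans _ _ (\sum_(0 <= n < M) ((n < N)%N%:R + (N.+1%:R)^-1 * normc w ^+ n))).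
  apply: ler_sum => n _; rewrite normcM normcV normc_nat normcX.
  have wn : 0 <= normc w ^+ n by exact: exprn_ge0.
  have [nN|Nn] := ltnP n N.
    apply: (@le_trans _ _ 1); last by rewrite lerDl mulr_ge0.
    by rewrite mulr_ile1 ?invr_ge0// ?invf_le1 ?ler1n ?exprn_ile1// ltW.
  by rewrite add0r ler_wpM2r// lef_pV2 ?posrE// ler_nat ltnS (leq_trans Nn).
rewrite big_split /= -mulr_sumr; apply: lerD.
  have -> : \sum_(0 <= n < M) (n < N)%N%:R = (minn M N)%:R :> R; last by rewrite ler_nat geq_minr.
  elim: M => [|M IH]; first by rewrite big_nil min0n.
  rewrite big_nat_recr//= IH -natrD; congr (_%:R).
  rewrite /minn; case: (ltnP M N) => h; last by rewrite addn0 ltnNge ltnW ?ltnS//.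
  by case: (ltnP M.+1 N) => h'; rewrite addn1//; apply/eqP; rewrite eqn_leq h h'.
have w01 : 0 <= normc w < 1 by rewrite w0.
by rewrite ler_wpM2l ?invr_ge0//; have := geometric_tail 0 M w01; rewrite add0n expr0 mul1r.
Qed.

Lemma cesaro1_boundary N w : adm cesaro1_deriv -> normc w < 1 ->
  normc ((1 - w) * pseries cesaro1_deriv w - 1) <=
  normc (1 - w) * (N%:R + (N.+1%:R)^-1 / (1 - normc w)).
Proof.
move=> ah w1; apply/ler_addgt0Pr => e e0.
have w01 : 0 <= normc w < 1 by rewrite normc_ge0.
have e2 : 0 < e / 3 by rewrite divr_gt0.
have [N1 hN1] := geometric_small 1 w01 e2.
have /cvg_cplxP /(_ _ e2) [N2 hN2] := pseries_cvg ah w1.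
pose M := maxn N1 N2; have h1 := hN1 M (leq_maxl _ _); have h2 := hN2 M (leq_maxr _ _).
have E : (1 - w) * pseries cesaro1_deriv w - 1 =
  - ((1 - w) * (psum cesaro1_deriv M w - pseries cesaro1_deriv w)) -
  (w ^+ M + (1 - w) * psum (fun n => n.+2%:R^-1) M w) :> C.
  by rewrite mulrBr psum_cesaro1_deriv; ring.
rewrite E; apply: le_trans (ler_normcB _ _) _; rewrite normcN normcM.
have h3 : normc (1 - w) <= 2.
  by apply: le_trans (ler_normcB _ _) _; rewrite normc1 -[leRHS]/(1 + 1) lerD2l ltW.
have h4 := ler_normcD (w ^+ M) ((1 - w) * psum (fun n => n.+2%:R^-1) M w).
rewrite normcM normcX in h4; rewrite mul1r in h1.
have h5 := ler_wpM2l (normc_ge0 (1 - w)) (psum_harmonic_le M N w1).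
have h6 : normc (1 - w) * normc (psum cesaro1_deriv M w - pseries cesaro1_deriv w) <= 2 * (e / 3).
  by apply: ler_pM => //; exact: normc_ge0.
apply: le_trans (lerD h6 (le_trans h4 (lerD h1 h5))) _.
rewrite addrA [leRHS]addrC lerD2r; lra.
Qed.

Lemma blaschke_real_1B t z : 0 < t < 1 -> normc z < 1 ->
  1 - blaschke t%:C%C z = (1 - t)%:C%C * (1 + z) / (1 - t%:C%C * z) :> C.
Proof.
move=> /andP[t0 t1] z1; have nt : normc (t%:C%C : C) < 1 by rewrite normc_real ger0_norm// ltW.
have := blaschke_den_neq0 nt (ltW z1); rewrite /blaschke conjc_real rmorphB rmorph1 => h.
by field.
Qed.

(** As [t] tends to 1, [w = blaschke t z] tends to 1 inside a Stolz angle: [|1 - w| / (1 - |w|)]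
    stays below [K], which depends on [z] only. *)
Lemma cesaro1_blaschke_limit z d : adm cesaro1_deriv -> normc z < 1 -> 0 < d ->
  exists2 u : R, 0 < u & forall t, 0 < t < 1 -> 1 - t < u ->
    normc ((1 - blaschke t%:C%C z) * pseries cesaro1_deriv (blaschke t%:C%C z) - 1) <= d.
Proof.
move=> ah z1 d0; have z0 := normc_ge0 z; have z1' : 0 < 1 - normc z by rewrite subr_gt0.
pose K := 8 / (1 - normc z).
have K0 : 0 < K by rewrite divr_gt0.
(* This [N] makes [K / (N + 1) <= d / 2]; the radius given next makes
   [normc (1 - w) * N <= d / 2]. *)
pose N := Num.truncn (2 * K / d).
exists (d * (1 - normc z) / (4 * (N%:R + 1))).
  by rewrite divr_gt0 ?mulr_gt0// ltr_wpDl.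
move=> t t01 tu; have [t0 t1] := andP t01.
have t1' : 0 < 1 - t by rewrite subr_gt0.
have nt' : normc (t%:C%C : C) = t by rewrite normc_real ger0_norm// ltW.
have nt : normc (t%:C%C : C) < 1 by rewrite nt'.
set w := blaschke _ z; have w1 : normc w < 1 by exact: blaschke_lt1.
apply: le_trans (cesaro1_boundary N ah w1) _.
have den : 1 - normc z <= normc (1 - t%:C%C * z) <= 2.
  rewrite (le_trans _ (lerB_normcB _ _)) ?normc1 ?lerD2l ?lerN2 ?normcM ?nt' ?ler_piMl ?(ltW t1)//=.
  apply: le_trans (ler_normcB _ _) _; rewrite normc1 normcM nt' -[leRHS]/(1 + 1) lerD2l.
  by rewrite mulr_ile1// ltW.
have [den1 den2] := andP den.
have den0 : 0 < normc (1 - t%:C%C * z) by exact: lt_le_trans den1.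
have nz : normc (1 + z) <= 2.
  by apply: le_trans (ler_normcD _ _) _; rewrite normc1 -[leRHS]/(1 + 1) lerD2l ltW.
have E : normc (1 - w) = (1 - t) * normc (1 + z) / normc (1 - t%:C%C * z).
  by rewrite /w blaschke_real_1B// !normcM normcV normc_real gtr0_norm.
have E2 : 1 - normc w ^+ 2 = (1 - t ^+ 2) * (1 - normc z ^+ 2) / normc (1 - t%:C%C * z) ^+ 2.
  by rewrite /w blaschke_1Bnorm// ?nt' ?conjc_real// ltW.
have b1 : normc (1 - w) <= (1 - t) * (2 / (1 - normc z)).
  rewrite E -mulrA ler_pM2l//; apply: ler_pM => //; rewrite ?normc_ge0 ?invr_ge0 ?normc_ge0//.
  by rewrite lef_pV2// posrE.
have x1 : 0 < 1 - normc w by rewrite subr_gt0.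
have b2 : normc (1 - w) / (1 - normc w) <= K.
  rewrite E ler_pdivrMr// ler_pdivrMr// /K (mulrAC 8) (mulrAC (8 * _)) ler_pdivlMr//.
  have := E2; move/(congr1 (fun x => x * normc (1 - t%:C%C * z) ^+ 2)).
  rewrite divfK ?expf_neq0 ?gt_eqF//.
  move: (normc (1 - t%:C%C * z)) (normc (1 + z)) (normc_ge0 (1 + z)) (normc w) x1 (normc_ge0 w) nz den0 den2
    (normc z) z0 z1' => D p p0 x x1 x0 p2 D0 D2 r r0 r1 E3.
  have q1 : (1 - t) * (1 - r) <= (1 - x ^+ 2) * D ^+ 2.
    rewrite E3; have -> : (1 - t ^+ 2) * (1 - r ^+ 2) = (1 - t) * (1 - r) * ((1 + t) * (1 + r)) by ring.
    rewrite ler_peMr ?mulr_ge0// ?ltW//; nra.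
  have q2 : (1 - x ^+ 2) * D ^+ 2 <= 2 * (1 - x) * D ^+ 2.
    by rewrite ler_wpM2r ?sqr_ge0//; nra.
  have q3 : D * p <= 4 by nra.
  have q4 := ler_wpM2r p0 (le_trans q1 q2).
  have q5 : 0 <= 2 * (1 - x) * D by rewrite !mulr_ge0// ltW.
  have q6 := ler_wpM2l q5 q3.
  by nra.
rewrite mulrDr mulrCA.
have N0 : 0 <= N%:R :> R by [].
have c1 : normc (1 - w) * N%:R <= d / 2.
  apply: le_trans (ler_wpM2r N0 b1) _.
  rewrite ltr_pdivlMr ?mulr_gt0 ?ltr_wpDl// in tu.
  rewrite mulrA mulrAC ler_pdivrMr//.
  move: (N%:R) N0 tu => y y0 tu; clear -y0 tu t1' z1' d0.
  move: (normc z) z1' tu => r r1 tu; nra.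
have c2 : N.+1%:R^-1 * (normc (1 - w) / (1 - normc w)) <= d / 2.
  apply: le_trans (ler_wpM2l _ b2) _; first by rewrite invr_ge0.
  rewrite ler_pdivrMl//; have := truncnS_gt (2 * K / d); rewrite -/N ltr_pdivrMr// => h.
  by rewrite mulrA ler_pdivlMr// mulrC ltW.
by apply: le_trans (lerD c1 c2) _; rewrite -splitr.
Qed.

Lemma cesaro1_pointwise z e : adm cesaro1_deriv -> normc z < 1 -> 0 < e ->
  exists2 u : R, 0 < u & forall t, 0 < t < 1 -> 1 - t < u ->
    4 / normc (1 - z ^+ 2) ^+ 2 - e <=
    normc (pseries cesaro1_deriv (blaschke t%:C%C z) * dblaschke t%:C%C z) ^+ 2.
Proof.
move=> ah z1 e0.
have z1n : 1 - z != 0.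
  by rewrite subr_eq0; apply/eqP => E; move: z1; rewrite -E normc1 ltxx.
have z2n : 1 + z != 0.
  by rewrite addrC -(opprK 1) subr_eq0; apply/eqP => E; move: z1; rewrite E normcN normc1 ltxx.
(* For real [t] in []0, 1[] this is [dblaschke t z / (1 - blaschke t z)], simplified so as to be
   continuous at [t = 1], where it equals [- 2 / (1 - z^2)]. *)
pose l (t : C) := - (1 + t) * ((1 - t * z) * (1 + z))^-1 : C.
have cl : ccont l 1.
  apply: ccontM.
    have H := ccontM (@ccont_cst R (-1) 1) (ccontD (@ccont_cst R 1 1) (@ccont_id R 1)).
    by apply: (ccont_near _ H); apply: cnearW => w; rewrite /= mulN1r.
  apply: ccontV; last by rewrite mul1r mulf_neq0.
  apply: ccontM; last exact: ccont_cst.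
  have H := ccontD (@ccont_cst R 1 1) (ccontM (@ccont_id R 1) (@ccont_cst R (- z) 1)).
  by apply: (ccont_near _ H); apply: cnearW => w; rewrite /= mulrN.
set T := 4 / _.
have lT : normc (l 1) ^+ 2 = T.
  rewrite /l mul1r normcM normcN normcV exprMn exprVn.
  have -> : (1 - z) * (1 + z) = 1 - z ^+ 2 :> C by ring.
  by have -> : 1 + 1 = 2%:R :> C; rewrite // normc_nat -natrX.
have T0 : 0 <= T by rewrite -lT sqr_ge0.
have T1 : 0 < T + 1 by rewrite ltr_wpDl.
have e2 : 0 < e / 2 by rewrite divr_gt0.
have [u u0 hu] := ccont_sqr_lower cl e2.
(* A tolerance [e / (4 (T + 1))] for the factor close to 1 costs at most [e / 2] after squaring and
   multiplying by at most [T]; the other [e / 2] is spent on [l]. *)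
have [v v0 hv] := cesaro1_blaschke_limit ah z1 (divr_gt0 e0 (mulr_gt0 (ltr0Sn R 3) T1)).
exists (Num.min u v) => [|t t01]; first by rewrite lt_min u0.
rewrite lt_min => /andP[tu tv]; have := hv t t01 tv.
have [t0 t1] := andP t01.
have nt : normc (t%:C%C : C) < 1 by rewrite normc_real ger0_norm// ltW.
have den : 1 - t%:C%C * z != 0.
  by have := blaschke_den_neq0 nt (ltW z1); rewrite conjc_real.
have -> : pseries cesaro1_deriv (blaschke t%:C%C z) * dblaschke t%:C%C z =
  (1 - blaschke t%:C%C z) * pseries cesaro1_deriv (blaschke t%:C%C z) * l t%:C%C.
  rewrite blaschke_real_1B// /l /dblaschke conjc_real normc_real real_normK ?num_real//.
  move: den; rewrite !rmorphB rmorphXn rmorph1 /=.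
  by move: (pseries cesaro1_deriv (blaschke (t%:C)%C z) : C) ((t%:C)%C : C) => x y den; field; rewrite den z2n.
have ht : normc (t%:C%C - 1 : C) < u.
  by rewrite -(rmorph1 (real_complex R)) -rmorphB normc_real distrC gtr0_norm// subr_gt0.
move=> hk; have hl := hu _ ht; rewrite lT in hl; rewrite normcM exprMn; move: hl hk.
move: ((1 - blaschke (t%:C)%C z) * pseries cesaro1_deriv (blaschke (t%:C)%C z) : C) (l (t%:C)%C) => k lt hl hk.
have hk1 := lerB_normcD 1 (k - 1); rewrite normc1 subrKC in hk1.
rewrite ler_pdivlMr ?mulr_gt0// in hk.
move: (normc k) (normc_ge0 k) (normc (k - 1)) (normc_ge0 (k - 1)) hk hk1 (normc lt ^+ 2) (sqr_ge0 (normc lt)) hl.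
move=> x x0 y y0 hy hx m m0 hm; clear -e0 T0 x0 y0 hy hx m0 hm.
have h1 : 1 - 2 * y <= x ^+ 2.
  have : 0 <= y ^+ 2 by exact: sqr_ge0.
  by have [y1|y1] := leP y 1; nra.
have [Te|Te] := leP T (e / 2).
  have p0 : 0 <= x ^+ 2 * m by apply: mulr_ge0 => //; exact: sqr_ge0.
  by apply: le_trans p0; lra.
have h2 : (1 - 2 * y) * (T - e / 2) <= x ^+ 2 * m.
  apply: le_trans (ler_wpM2l (sqr_ge0 x) hm); rewrite ler_wpM2r//; lra.
apply: le_trans h2; nra.
Qed.

End BoundaryBehaviour.

(** * The operator norm *)

Section CesaroNorm.
Variable R : realType.
Local Notation C := (Cplx R).
Local Notation D := (@plane_disc R).
Implicit Types (a s : nat -> C) (z b : C) (f : C -> C).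

(** Either [f] is the sum of the series with coefficients [coefs f], or [coefs f] is the zero
    sequence by default; the bound holds in both cases. *)
Lemma coefs_Hinf1 f : (Hinf_norm f <= 1)%E -> adm (coefs f) /\
  forall z, normc z < 1 -> normc (pseries (coefs f) z) <= 1.
Proof.
move=> f1; have [ex|nex] := pselect (exists a, is_power_series f a).
  have fa : is_power_series f (coefs f) by exact: (xgetPex (fun=> 0) ex).
  split=> [|z z1]; first exact: adm_is_power_series fa.
  rewrite -(is_power_series_eq fa z1) -lee_fin; apply: le_trans f1.
  by apply: ereal_sup_ubound; exists z.
have -> : coefs f = (fun=> 0).
  by apply: xgetPN => a fa; apply: nex; exists a.
have a0 : adm (fun=> 0 : C) by move=> r _; exists 0 => n; rewrite normc0 mul0r.
split=> // z z1; rewrite (@pseries_linear _ _ (fun=> 0) z 0 0 0 a0 z1).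
  by rewrite addr0 mul0r addr0 normc0.
by move=> n; rewrite !mul0r !addr0 /psum big1// => i _; rewrite mul0r.
Qed.

Lemma cesaro_coef0 a : cesaro_coef a 0%N = a 0%N.
Proof. by rewrite /cesaro_coef /psums big_nat1 invr1 mul1r. Qed.

Lemma normc_coef0_le a : (forall z, normc z < 1 -> normc (pseries a z) <= 1) ->
  normc (a 0%N) <= 1.
Proof. by move=> /(_ 0); rewrite pseries_at0 normc0; apply. Qed.

(** [coefs] selects an expansion through [xget]; uniqueness identifies the one selected for the
    function 1. *)
Lemma power_series_uniq f a c : is_power_series f a -> is_power_series f c -> a = c.
Proof.
move=> fa fc; have aa := adm_is_power_series fa; have ac := adm_is_power_series fc.
pose d n := a n - c n.
have psumd N z : psum d N z = psum a N z - psum c N z.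
  by rewrite /psum -sumrB; apply: eq_bigr => i _; rewrite mulrBl.
have ad : adm d.
  move=> r r01; have [K1 h1] := aa r r01; have [K2 h2] := ac r r01; exists (K1 + K2) => n.
  have [r0 _] := andP r01.
  apply: le_trans (lerD (h1 n) (h2 n)); rewrite -mulrDl ler_wpM2r ?exprn_ge0 ?(ltW r0)//.
  exact: ler_normcB.
apply/funext => n; apply/eqP; rewrite -subr_eq0; apply/eqP.
apply: (@pseries_eq0 _ d ad) => z z1.
apply: limn_unique; rewrite -psum_series; apply/cvg_cplxP => e e0.
have e2 : 0 < e / 2 by rewrite divr_gt0.
have := fa z z1; rewrite -psum_series => /cvg_cplxP /(_ _ e2) [N1 h1].
have := fc z z1; rewrite -psum_series => /cvg_cplxP /(_ _ e2) [N2 h2].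
exists (maxn N1 N2) => m; rewrite geq_max => /andP[m1 m2].
rewrite subr0 psumd; apply: le_trans (normc_distD (f z) _ _) _.
by rewrite [leRHS]splitr lerD ?h1// normcBC h2.
Qed.

Lemma adm_delta0 : adm (fun n => (n == 0%N)%:R : C).
Proof.
move=> r /andP[r0 r1]; exists 1 => n; rewrite normc_nat.
by rewrite mulr_ile1 ?exprn_ge0 ?exprn_ile1 ?(ltW r0) ?(ltW r1)//; case: n.
Qed.

Lemma coefs_one : coefs (fun=> 1 : C) = (fun n => (n == 0%N)%:R).
Proof.
pose e n : C := (n == 0%N)%:R.
have pe N z : psum e N.+1 z = 1.
  elim: N => [|N IH]; first by rewrite psumS psum0 expr0 add0r mulr1.
  by rewrite psumS IH /e mul0r addr0.
have e1 : is_power_series (fun=> 1) e.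
  move=> z _; rewrite -psum_series; apply/cvg_cplxP => d d0.
  by exists 1%N => -[//|n] _; rewrite pe subrr normc0 ltW.
apply: (power_series_uniq _ e1).
by apply: (xgetPex (fun=> 0)); exists e.
Qed.

Lemma dseq_cesaro_one : dseq (cesaro_coef (fun n => (n == 0%N)%:R)) = @cesaro1_deriv R.
Proof.
apply/funext => n; rewrite /dseq /cesaro1_deriv /cesaro_coef /psums.
by rewrite big_nat_recl//= big1_seq// addr0 mulr1.
Qed.

Variable mu : {measure set (plane R) -> \bar R}.
Hypothesis mu_fin : (\int[mu]_(p in D) (1 - normc (to_cplx p) ^+ 2)%R%:E < +oo)%E.
Hypothesis mu_radial : radial mu.

Lemma area_dirichlet s phi b : adm s -> normc b < 1 -> UD mu phi = UD mu (blaschke b) ->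
  (\int[@area R]_(p in D) ((normc (derive1 (pseries s) (to_cplx p)) ^+ 2)%:E * U mu (phi (to_cplx p))) =
   (pi^-1)%:E * cintegral (fun z => (normc (pseries (dseq s) z) ^+ 2)%:E * UD mu (blaschke b) z))%E.
Proof.
move=> as_ b1 E; rewrite -E -integral_area.
- apply: eq_integral => p; rewrite inE => p1; congr (_%:E * _)%E.
  by rewrite (cderive_derive1 (cderive_pseries as_ p1)).
- by move=> z; exact: sqr_ge0.
- by move=> z; rewrite E UD_ge0.
- rewrite E; apply: cmeasurable_sqr_pseries; first exact: adm_dseq.
    exact: cmeasurable_UD.
  exact: UD_out.
Qed.

Lemma M_norm_cesaro_le f : (Hinf_norm f <= 1)%E ->
  (M_norm mu (cesaro_op f) <= 1 + sqrte ((pi^-1)%:E * extremal_integral mu))%E.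
Proof.
move=> /coefs_Hinf1 [aa fa]; rewrite cesaro_opE; set s := cesaro_coef _.
have as_ : adm s by exact: adm_cesaro_coef.
apply: leeD; first by rewrite lee_fin pseries_at0 /s cesaro_coef0 normc_coef0_le.
apply: ge_ereal_sup => _ [phi Aphi <-].
have [b b1 E] := Aut_U mu_fin mu_radial Aphi.
have p0 : (0 <= (pi^-1)%:E :> \bar R)%E by rewrite lee_fin invpi_ge0.
rewrite (area_dirichlet as_ b1 E) lee_sqrt; last first.
  by apply: mule_ge0 => //; exact: extremal_integral_ge0.
exact: (lee_wpmul2l p0 (cesaro_integral_le mu_fin mu_radial aa fa b1)).
Qed.

(** Fatou's lemma along [b = t n], real and tending to 1, after the substitution [blaschke b] has
    brought all integrals to the fixed weight [UD mu id]. *)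
Lemma extremal_integral_le (M : \bar R) :
  (forall b, normc b < 1 -> (cintegral (fun z => (normc (pseries (@cesaro1_deriv R) z) ^+ 2)%:E *
     UD mu (blaschke b) z) <= M)%E) -> (extremal_integral mu <= M)%E.
Proof.
move=> HM; have rU := radial_UD mu_fin mu_radial; have [mU U0 _ _] := rU.
have ah : adm (@cesaro1_deriv R).
  by rewrite -dseq_cesaro_one; apply: adm_dseq; apply: adm_cesaro_coef; exact: adm_delta0.
pose t n : R := n.+1%:R / n.+2%:R.
have t01 n : 0 < t n < 1.
  by rewrite /t divr_gt0//= ltr_pdivrMr// mul1r ltr_nat.
have nt n : normc ((t n)%:C%C : C) < 1.
  by have /andP[h0 h1] := t01 n; rewrite normc_real ger0_norm ?ltW.
have tE n : 1 - t n = n.+2%:R^-1.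
  have h : n.+1%:R = n.+2%:R - 1 :> R by rewrite -(natr1 n.+1) addrK.
  by rewrite /t h mulrBl divff ?pnatr_eq0// mul1r opprB addrCA subrr addr0.
pose g n z := pseries (@cesaro1_deriv R) (blaschke (t n)%:C%C z) * dblaschke (t n)%:C%C z.
have mb n : cmeasurable (fun z => (normc (pseries (@cesaro1_deriv R) z) ^+ 2)%:E * UD mu (blaschke (t n)%:C%C) z)%E.
  exact: (cmeasurable_sqr_pseries ah (cmeasurable_UD mu_fin (nt n)) (@UD_out _ _ _)).
apply: (weighted_fatou (a_ := fun n z => normc (g n z) ^+ 2)).
- move=> n; pose h z : \bar R := ((normc (pseries (@cesaro1_deriv R) z) ^+ 2)%:E * UD mu (blaschke (t n)%:C%C) z)%E.
  (* Measurability of [pseries] is known only against a weight that vanishes off the disc, so the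
     product is rewritten as such a function composed with [blaschke], times a Jacobian cut off to
     the disc. *)
  have -> : (fun z => ((normc (g n z) ^+ 2)%:E * UD mu id z)%E) =
    (fun z => h (blaschke (t n)%:C%C z) * (if (normc z < 1)%R then (normc (dblaschke (t n)%:C%C z) ^+ 2)%:E else 0))%E.
    apply/funext => z; rewrite /h; have [z1|z1] := ltP (normc z) 1; last by rewrite UD_out// !mule0.
    rewrite /g normcM exprMn EFinM /UD z1 blaschke_lt1// blaschkeK ?ltW//.
    by rewrite muleAC.
  apply: emeasurable_funM.
    apply: (cmeasurable_comp (mb n)).
    by case: (disc_map_blaschke (nt n)).
  apply: measurable_fun_ifT.
  + apply: measurable_fun_ltr; last exact: measurable_cst.
    by apply: measurable_normc; exact: cmfun_to_cplx.
  + apply/measurable_EFinP; apply: measurable_funX; apply: measurable_normc.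
    apply: cmfun_div; first exact: cmfun_cst.
    apply: cmfunX; apply: cmfunB; first exact: cmfun_cst.
    by apply: cmfunM; [exact: cmfun_cst|exact: cmfun_to_cplx].
  + exact: measurable_cst.
- apply: emeasurable_funM => //; apply/measurable_EFinP; apply: measurable_funM; first exact: measurable_cst.
  apply: measurable_fun_inv; apply: measurable_funX; apply: measurable_normc.
  by apply: cmfunB; [exact: cmfun_cst|apply: cmfunX; exact: cmfun_to_cplx].
- by move=> n z; exact: sqr_ge0.
- by move=> z; rewrite divr_ge0 ?sqr_ge0.
- exact: U0.
- move=> z /UD_neq0 z1 e e0; have [u u0 hu] := cesaro1_pointwise ah z1 e0.
  exists (Num.truncn u^-1) => n Nn; apply: hu => //; rewrite tE.
  rewrite invf_plt ?posrE//; apply: lt_le_trans (truncnS_gt _) _.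
  by rewrite ler_nat ltnS (leq_trans Nn).
- move=> n; apply: le_trans (HM _ (nt n)); rewrite le_eqVlt; apply/orP; left; apply/eqP.
  exact: (cintegral_UD_blaschke mu_fin (nt n) (mb n)).
Qed.

Lemma M_norm_cesaro_one_ge :
  (1 + sqrte ((pi^-1)%:E * extremal_integral mu) <= M_norm mu (cesaro_op (fun=> 1%R : C)))%E.
Proof.
rewrite cesaro_opE coefs_one; set s := cesaro_coef _.
have as_ : adm s by apply: adm_cesaro_coef; exact: adm_delta0.
rewrite /M_norm; set S := ereal_sup _.
apply: leeD; first by rewrite pseries_at0 /s cesaro_coef0 normc1.
have HS b : normc b < 1 -> (sqrte ((pi^-1)%:E * cintegral (fun z =>
    (normc (pseries (@cesaro1_deriv R) z) ^+ 2)%:E * UD mu (blaschke b) z)) <= S)%E.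
  move=> b1; apply: ereal_sup_ubound; exists (blaschke b); first exact: blaschke_Aut.
  by rewrite (area_dirichlet as_ b1 erefl) dseq_cesaro_one.
have S0 : (0 <= S)%E.
  have n0 : normc (0 : C) < 1 by rewrite normc0.
  exact: le_trans (sqrte_ge0 _) (HS _ n0).
(* The supremum [S] may be infinite. Written as the square root of [S * S], it can be compared under
   the root, and [S * S] yields the bound passed to [extremal_integral_le]. *)
have SE : sqrte (S * S) = S by rewrite sqrteM// -expe2 sqr_sqrte.
have SS0 : (0 <= S * S)%E by exact: mule_ge0.
have pi0 : 0 < (pi : R) by exact: pi_gt0.
rewrite -SE lee_sqrt// muleC lee_pdivrMr//.
apply: extremal_integral_le => b b1; rewrite -lee_pdivrMr// muleC -lee_sqrt// SE.
exact: HS.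
Qed.

End CesaroNorm.

Theorem theorem1p4 (R : realType) (mu : {measure set (plane R) -> \bar R})
    (mu_radial : radial mu)
    (mu_fin : (\int[mu]_(p in @plane_disc R)
                 (1 - Normc.normc (to_cplx p) ^+ 2)%R%:E < +oo)%E)
    (C_bounded : cesaro_bounded mu) :
  (cesaro_opnorm mu =
   1 + sqrte (\int[@area R]_(p in @plane_disc R)
         ((4 / Normc.normc (1 - to_cplx p ^+ 2) ^+ 2)%R%:E * U mu (to_cplx p))))%E.
Proof.
have E : (\int[@area R]_(p in @plane_disc R)
    ((4 / Normc.normc (1 - to_cplx p ^+ 2) ^+ 2)%R%:E * U mu (to_cplx p)) =
    (pi^-1)%:E * extremal_integral mu)%E.
  have [mU U0 _ _] := radial_UD mu_fin mu_radial.
  apply: (integral_area (c := fun z => 4 / Normc.normc (1 - z ^+ 2) ^+ 2) (phi := id)) => //.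
    by move=> z; rewrite divr_ge0 ?sqr_ge0.
  apply: emeasurable_funM => //; apply/measurable_EFinP; apply: measurable_funM; first exact: measurable_cst.
  apply: measurable_fun_inv; apply: measurable_funX; apply: measurable_normc.
  by apply: cmfunB; [exact: cmfun_cst|apply: cmfunX; exact: cmfun_to_cplx].
rewrite E; apply/eqP; rewrite eq_le; apply/andP; split.
  by apply: ge_ereal_sup => _ [f [_ f1] <-]; exact: M_norm_cesaro_le.
(* The constant function 1 lies in the unit ball and is extremal. *)
apply: le_trans (M_norm_cesaro_one_ge mu_fin mu_radial) _.
have one1 : (Hinf_norm (fun=> 1%R : Cplx R) <= 1)%E.
  by apply: ge_ereal_sup => _ [z _ <-]; rewrite normc1.
apply: ereal_sup_ubound; exists (fun=> 1) => //; split=> //; split.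
  by move=> z _; apply/derivable_cderive; exists 0; exact: cderive_cst.
by apply: le_lt_trans one1 _; rewrite ltry.
Qed.
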